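(* Let $Y=(Y^1,Y^2)$ be the bivariate fractional Ornstein--Uhlenbeck process with parameters $\alpha_1,\alpha_2,\nu_1,\nu_2>0$, $H_1,H_2\in(0,1)\setminus\{1/2\}$, $H=H_1+H_2$, and correlation parameters $\rho,\eta_{12}$. Let $s\ge1$ be a fixed integer. Then, for any $H\in(0,2)$, $H\neq1$, the estimators $\hat\rho_n$ and $\hat\eta_{12,n}$ (defined in the context) converge, as $n\to\infty$, to $\rho$ and $\eta_{12}$ respectively in $L^2(\mathbb{P})$, and so in probability.
   Context: Let $H_1,H_2\in(0,1)\setminus\{1/2\}$, $H=H_1+H_2$. A bivariate fractional Brownian motion is a centered Gaussian process $(B^{H_1}_t,B^{H_2}_t)_{t\in\mathbb{R}}$ (with continuous paths) whose components are fractional Brownian motions with Hurst indices $H_1,H_2$, with $(B^{H_1}_{\lambda t},B^{H_2}_{\lambda t})_t\overset{d}{=}(\lambda^{H_1}B^{H_1}_t,\lambda^{H_2}B^{H_2}_t)_t$ for all $\lambda>0$ and with stationary increments, normalized by $\mathrm{Var}(B^{H_i}_1)=1$. There are then (known fact) $\rho=\rho_{12}=\rho_{21}\in[-1,1]$ and $\eta_{12}=-\eta_{21}\in\mathbb{R}$ with, if $H\ne1$, $$\mathrm{Cov}(B^{H_1}_t,B^{H_2}_u)=\tfrac12\big((\rho+\mathrm{sign}(t)\eta_{12})|t|^{H}+(\rho-\mathrm{sign}(u)\eta_{12})|u|^{H}-(\rho-\mathrm{sign}(u-t)\eta_{12})|u-t|^{H}\big),$$ where $\mathrm{sign}(x)=1$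 for $x\ge0$, $-1$ for $x<0$. The bivariate fractional Ornstein--Uhlenbeck process is $Y^i_t=\nu_i\int_{-\infty}^te^{-\alpha_i(t-u)}dB^{H_i}_u$, $i=1,2$, $t\in\mathbb{R}$, with $\alpha_i,\nu_i>0$ and pathwise Riemann--Stieltjes integrals, i.e. $Y^i_t=\nu_i(B^{H_i}_t-\alpha_i\int_{-\infty}^tB^{H_i}_ue^{-\alpha_i(t-u)}du)$. For an integer $s\ge1$ let $I_{12}(s)=\int_0^se^{\alpha_1u}\int_{-\infty}^0e^{\alpha_2v}(u-v)^{H-2}dv\,du$ and $I_{21}(s)=\int_0^se^{\alpha_2u}\int_{-\infty}^0e^{\alpha_1v}(u-v)^{H-2}dv\,du$. For $H\neq1$ set $$a_1(s)=-\frac{I_{12}(s)+I_{21}(s)}{\nu_1\nu_2H(H-1)I_{12}(s)I_{21}(s)},\quad a_2(s)=\frac1{\nu_1\nu_2H(H-1)e^{-\alpha_1s}I_{12}(s)},\quad a_3(s)=\frac1{\nu_1\nu_2H(H-1)e^{-\alpha_2s}I_{21}(s)},$$ $$b_1(s)=\frac{I_{12}(s)-I_{21}(s)}{\nu_1\nu_2H(H-1)I_{12}(s)I_{21}(s)},\quad b_2(s)=a_2(s),\quad b_3(s)=-a_3(s).$$ The estimators based on the observations $Y_k=(Y^1_k,Y^2_k)$, $k=0,\dots,n$, are $$\hat\rho_n=\frac{a_1(s)}n\sum_{j=1}^nY^1_jY^2_j+\frac{a_2(s)}n\sum_{j=1}^{n-s}Y^1_{j+s}Y^2_j+\frac{a_3(s)}n\sum_{j=1}^{n-s}Y^1_jY^2_{j+s},$$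 $$\hat\eta_{12,n}=\frac{b_1(s)}n\sum_{j=1}^nY^1_jY^2_j+\frac{b_2(s)}n\sum_{j=1}^{n-s}Y^1_{j+s}Y^2_j+\frac{b_3(s)}n\sum_{j=1}^{n-s}Y^1_jY^2_{j+s}.$$ *)

(* Defs.v *)
From HB Require Import structures.
From mathcomp Require Import all_boot all_order all_algebra.
From mathcomp Require Import all_classical all_reals all_analysis.

Set Implicit Arguments.
Unset Strict Implicit.
Unset Printing Implicit Defensive.

Import Order.TTheory GRing.Theory Num.Theory.
Import numFieldNormedType.Exports.

Local Open Scope classical_set_scope.
Local Open Scope ring_scope.

(** Gaussian processes and equality in law *)

(* The degenerate case is separate because the library's [normal_prob m 0] is
   the uniform distribution on [0, 1], not the Dirac mass at [m]. *)
Definition is_gaussian (d : measure_display) (T : measurableType d)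
    (R : realType) (P : probability T R) (X : T -> R) : Prop :=
  exists m s : R, forall A : set R, measurable A ->
    P (X @^-1` A) = if s == 0 then dirac m A else normal_prob m s A.

Definition gaussian_process (d : measure_display) (T : measurableType d)
    (R : realType) (P : probability T R) (I : Type) (X : I -> T -> R) : Prop :=
  forall (n : nat) (i : 'I_n -> I) (a : 'I_n -> R),
    is_gaussian P (fun w => \sum_(k < n) a k * X (i k) w).

Definition centered (d : measure_display) (T : measurableType d)
    (R : realType) (P : probability T R) (I : Type) (X : I -> T -> R) : Prop :=
  forall i : I, ('E_P[X i] = 0)%E.

(* Equality of all finite-dimensional distributions. *)
Definition eq_law (d d' : measure_display) (T : measurableType d)
    (S : measurableType d') (R : realType) (P : probability T R) (I : Type)
    (X Y : I -> T -> S) : Prop :=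
  forall (n : nat) (i : 'I_n -> I) (A : set (n.-tuple S)), measurable A ->
    P [set w | A [tuple X (i k) w | k < n]] =
    P [set w | A [tuple Y (i k) w | k < n]].

(** Fractional Brownian motions indexed by the real line *)

Definition is_fbm (d : measure_display) (T : measurableType d) (R : realType)
    (P : probability T R) (h : R) (X : R -> {RV P >-> R}) : Prop :=
  [/\ gaussian_process P (fun t => X t : T -> R),
      centered P (fun t => X t : T -> R),
      (exists2 sigma : R, 0 < sigma & forall t u : R,
         covariance P (X t) (X u) =
           (sigma ^+ 2 / 2 * (`|t| `^ (2 * h) + `|u| `^ (2 * h)
                              - `|t - u| `^ (2 * h)))%:E)
    & forall w : T, continuous (fun t => X t w)].

Definition pair_process (T R : Type) (X1 X2 : R -> T -> R) :
    R -> T -> R * R :=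
  fun t w => (X1 t w, X2 t w).

Record is_bivariate_fbm (d : measure_display) (T : measurableType d)
    (R : realType) (P : probability T R) (H1 H2 : R)
    (B1 B2 : R -> {RV P >-> R}) : Prop := IsBivariateFbm {
  bfbm_gaussian : gaussian_process P (fun i : R + R =>
    match i with inl t => B1 t : T -> R | inr t => B2 t : T -> R end);
  bfbm_fbm1 : is_fbm H1 B1;
  bfbm_fbm2 : is_fbm H2 B2;
  bfbm_self_similar : forall lambda : R, 0 < lambda ->
    eq_law P
      (pair_process (fun t => B1 (lambda * t)) (fun t => B2 (lambda * t)))
      (pair_process (fun t w => lambda `^ H1 * B1 t w)
                    (fun t w => lambda `^ H2 * B2 t w));
  bfbm_stationary_increments : forall h : R,
    eq_law P
      (pair_process (fun t w => B1 (t + h) w - B1 h w)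
                    (fun t w => B2 (t + h) w - B2 h w))
      (pair_process (fun t w => B1 t w - B1 0 w)
                    (fun t w => B2 t w - B2 0 w));
  bfbm_var1 : ('V_P[B1 1%R] = 1)%E;
  bfbm_var2 : ('V_P[B2 1%R] = 1)%E
}.

(* Unlike [Num.sg], equal to 1 at 0. *)
Definition sign (R : realType) (x : R) : R := if 0 <= x then 1 else -1.

(* For [H1 + H2 != 1] these conditions determine [rho] and [eta12]. *)
Definition bfbm_correlation (d : measure_display) (T : measurableType d)
    (R : realType) (P : probability T R) (H1 H2 rho eta12 : R)
    (B1 B2 : R -> {RV P >-> R}) : Prop :=
  -1 <= rho <= 1 /\
  forall t u : R,
    covariance P (B1 t) (B2 u) =
      (2^-1 * ((rho + sign t * eta12) * `|t| `^ (H1 + H2)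
               + (rho - sign u * eta12) * `|u| `^ (H1 + H2)
               - (rho - sign (u - t) * eta12) * `|u - t| `^ (H1 + H2)))%:E.

(** Fractional Ornstein-Uhlenbeck process driven by [B] *)

(* nu * int_{-oo}^t e^{-alpha (t - u)} dB_u, after integration by parts. *)
Definition fOU (T : Type) (R : realType) (alpha nu : R) (B : R -> T -> R)
    (t : R) (w : T) : R :=
  nu * (B t w - alpha *
    \int[lebesgue_measure]_(u in `]-oo, t]) (B u w * expR (- alpha * (t - u)))).

(** Estimators *)

(* I_12 is [crossI alpha1 alpha2 H] and I_21 is [crossI alpha2 alpha1 H]. *)
Definition crossI (R : realType) (alpha beta H : R) (s : nat) : R :=
  \int[lebesgue_measure]_(u in `[0, s%:R])
    (expR (alpha * u) *
     \int[lebesgue_measure]_(v in `]-oo, 0])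
       (expR (beta * v) * (u - v) `^ (H - 2))).

Definition coef_a1 (R : realType) (alpha1 alpha2 nu1 nu2 H : R) (s : nat) : R :=
  let I12 := crossI alpha1 alpha2 H s in
  let I21 := crossI alpha2 alpha1 H s in
  - ((I12 + I21) / (nu1 * nu2 * H * (H - 1) * I12 * I21)).

Definition coef_a2 (R : realType) (alpha1 alpha2 nu1 nu2 H : R) (s : nat) : R :=
  1 / (nu1 * nu2 * H * (H - 1) * expR (- alpha1 * s%:R)
       * crossI alpha1 alpha2 H s).

Definition coef_a3 (R : realType) (alpha1 alpha2 nu1 nu2 H : R) (s : nat) : R :=
  1 / (nu1 * nu2 * H * (H - 1) * expR (- alpha2 * s%:R)
       * crossI alpha2 alpha1 H s).

Definition coef_b1 (R : realType) (alpha1 alpha2 nu1 nu2 H : R) (s : nat) : R :=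
  let I12 := crossI alpha1 alpha2 H s in
  let I21 := crossI alpha2 alpha1 H s in
  (I12 - I21) / (nu1 * nu2 * H * (H - 1) * I12 * I21).

Definition coef_b2 (R : realType) (alpha1 alpha2 nu1 nu2 H : R) (s : nat) : R :=
  coef_a2 alpha1 alpha2 nu1 nu2 H s.

Definition coef_b3 (R : realType) (alpha1 alpha2 nu1 nu2 H : R) (s : nat) : R :=
  - coef_a3 alpha1 alpha2 nu1 nu2 H s.

(* In the lagged sums [n - s] is truncated: they are empty when [n <= s]. *)
Definition cross_estimator (T : Type) (R : realType) (c1 c2 c3 : R) (s : nat)
    (Y1 Y2 : R -> T -> R) (n : nat) (w : T) : R :=
  c1 / n%:R * (\sum_(1 <= j < n.+1) Y1 j%:R w * Y2 j%:R w)
  + c2 / n%:R * (\sum_(1 <= j < (n - s).+1) Y1 (j + s)%:R w * Y2 j%:R w)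
  + c3 / n%:R * (\sum_(1 <= j < (n - s).+1) Y1 j%:R w * Y2 (j + s)%:R w).

Definition rho_hat (T : Type) (R : realType) (alpha1 alpha2 nu1 nu2 H : R)
    (s : nat) (Y1 Y2 : R -> T -> R) : nat -> T -> R :=
  cross_estimator (coef_a1 alpha1 alpha2 nu1 nu2 H s)
    (coef_a2 alpha1 alpha2 nu1 nu2 H s) (coef_a3 alpha1 alpha2 nu1 nu2 H s)
    s Y1 Y2.

Definition eta12_hat (T : Type) (R : realType) (alpha1 alpha2 nu1 nu2 H : R)
    (s : nat) (Y1 Y2 : R -> T -> R) : nat -> T -> R :=
  cross_estimator (coef_b1 alpha1 alpha2 nu1 nu2 H s)
    (coef_b2 alpha1 alpha2 nu1 nu2 H s) (coef_b3 alpha1 alpha2 nu1 nu2 H s)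
    s Y1 Y2.

(** Modes of convergence *)

Definition cvg_L2 (d : measure_display) (T : measurableType d) (R : realType)
    (P : probability T R) (X : nat -> T -> R) (Z : T -> R) : Prop :=
  [/\ forall n, X n \in Lfun P 2%:E, Z \in Lfun P 2%:E
    & ('E_P[fun w => ((X n w - Z w) ^+ 2)%R])%E @[n --> \oo] --> 0%E].

Definition cvg_in_probability (d : measure_display) (T : measurableType d)
    (R : realType) (P : probability T R) (X : nat -> T -> R) (Z : T -> R) :
    Prop :=
  forall eps : R, 0 < eps ->
    P [set w | eps < `|X n w - Z w|] @[n --> \oo] --> 0%E.

(* Main.v *)
Require Import Defs.
From HB Require Import structures.
From mathcomp Require Import all_boot all_order all_algebra.
From mathcomp Require Import all_classical all_reals all_analysis measurable_realfun.
From mathcomp Require Import ring lra.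

Set Implicit Arguments.
Unset Strict Implicit.
Unset Printing Implicit Defensive.

Import Order.TTheory GRing.Theory Num.Theory.
Import numFieldNormedType.Exports.

Local Open Scope classical_set_scope.
Local Open Scope ring_scope.

(** The estimators are linear combinations of three empirical averages, of
    [Y1 Y2] at equal times and at the lags [s] and [- s]. They converge because
    each average converges in mean square to its expectation, and their limits
    are [rho] and [eta12] because the weights solve the linear system that links
    the three expectations to the two parameters.

    Each [Y] is a weighted integral of increments of its fractional Brownian
    motion: after reflection, [Y t = nu * (B t - average of B (t - u))] with [u]
    exponentially distributed ([fOU_ou]). Three facts follow from the linearity
    of this average and Fubini's theorem.

    - Isserlis' formula for mixed fourth moments passes from [B1, B2] to
      [Y1, Y2] ([isserlis_average], [ou_isserlis]). For the Gaussian motions it is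
      obtained by polarization ([isserlis_polarization]) from the fourth moment
      of a centered Gaussian variable ([gaussian_fourth_moment]).
    - Covariances of the [Y]s are averages of second differences of
      [x |-> c * x `^ h] with [0 < h < 2], hence depend only on the lag
      ([mean_ou_stationary]) and vanish at infinity ([mean_ou_decay]), because
      these second differences are of order [x `^ (h - 2)] ([second_diff_powR]).
      By Isserlis' formula the covariances of the sequence of products [Y1 Y2]
      then vanish at infinity too, and a Cesaro argument gives the convergence of
      the averages ([cvg_mean2_average], [cvg_mean2_lagged]).
    - To go from lag [0] to lag [s], split the exponential average that defines
      [Y1 s] at time [0]. By lack of memory, the past before [0] contributes
      [expR (- alpha1 * s)] times the covariance at lag [0]. The rest only
      involves [B1] after time [0] and [B2] before it, whose cross covariance is
      [(rho + eta12) / 2 * (u `^ H + v `^ H - (u + v) `^ H)]; writing this power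
      defect as a double integral of [(x + y) `^ (H - 2)] produces [crossI]
      ([integral_power_kernel], [mean_ou_lag]). Exchanging the two components
      replaces [rho + eta12] by [rho - eta12].

    The covariance at lag [0] is not computed: it is eliminated between the three
    expectations ([weights_recover_parameters]). *)

(** * Lebesgue measure, and measures with a density *)

Section lebesgue_symmetry.
Context {R : realType}.
Notation leb := (@lebesgue_measure R).
Implicit Types (a : R).

Let reflect_map a : measurableTypeR R -> measurableTypeR R := fun x => a - x.

Let measurable_reflect a : measurable_fun [set: measurableTypeR R] (reflect_map a).
Proof. exact: (@measurable_funB _ _ R setT (cst a) id). Qed.

Let lebesgue_reflect a (A : set R) : measurable A ->
  pushforward leb (reflect_map a) A = leb A.
Proof.
move=> mA; have mr := measurable_reflect a.
pose m : {measure set (measurableTypeR R) -> \bar R} :=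
  pushforward leb (reflect_map a).
rewrite -[LHS]/(m mr A); symmetry; apply: (@lebesgue_measure_unique R (m mr)) => //.
move=> _ [[x y] _ <-].
rewrite /m /= /pushforward.
rewrite (_ : reflect_map a @^-1` _ = `[a - y, a - x[%classic); last first.
  by apply/seteqP; split => t /=; rewrite !in_itv/= /reflect_map => /andP[h1 h2];
    apply/andP; split; lra.
rewrite !lebesgue_measure_itv/= !lte_fin.
rewrite ltrD2l ltrN2; case: ifP => // xy.
by rewrite -!EFinB; congr EFin; ring.
Qed.

Lemma ge0_integral_reflect a (D : set R) (f : R -> \bar R) :
  measurable D -> measurable_fun [set: R] f -> (forall x, 0 <= f x)%E ->
  (\int[leb]_(x in D) f x = \int[leb]_(x in (fun x => (a - x)%R)@^-1` D) f (a - x)%R)%E.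
Proof.
move=> mD mf f0; have mr := measurable_reflect a.
have := @ge0_integral_pushforward _ _ (measurableTypeR R) (measurableTypeR R) R
  (reflect_map a) mr leb D f mD (measurable_funTS mf) (in1W f0).
rewrite /= /reflect_map => <-.
by apply: eq_measure_integral => A mA _; exact/esym/lebesgue_reflect.
Qed.

Lemma ge0_integral_shift a (D : set R) (f : R -> \bar R) :
  measurable D -> measurable_fun [set: R] f -> (forall x, 0 <= f x)%E ->
  (\int[leb]_(x in D) f x = \int[leb]_(x in (fun x => (a + x)%R)@^-1` D) f (a + x)%R)%E.
Proof.
move=> mD mf f0.
have mr b : measurable_fun [set: R] (fun x : R => b - x) by exact: measurable_reflect.
rewrite (ge0_integral_reflect a)// (ge0_integral_reflect 0)//=.
- congr (integral _ _ _); last by apply/funext => x; congr f; ring.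
  by apply/seteqP; split => x /=; rewrite sub0r opprK.
- by rewrite -[X in measurable X]setTI; exact: mr.
- exact: measurableT_comp.
Qed.

End lebesgue_symmetry.

Section density.
Context d (T : measurableType d) (R : realType).
Variables (m : {measure set T -> \bar R}) (nu : {measure set T -> \bar R}).
Variable p : T -> R.
Hypothesis p0 : forall x, 0 <= p x.
Hypothesis mp : measurable_fun setT p.
Hypothesis nuE : forall A, measurable A -> nu A = (\int[m]_(x in A) (p x)%:E)%E.
Local Open Scope ereal_scope.

Import HBNNSimple.

(** It holds for indicators by hypothesis, hence for simple functions, and both
    sides commute with monotone limits. *)
Lemma ge0_integral_density (f : T -> \bar R) :
  measurable_fun setT f -> (forall x, 0 <= f x) ->
  \int[nu]_x f x = \int[m]_x (f x * (p x)%:E).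
Proof.
move=> mf f0; have mpE : measurable_fun setT (EFin \o p) by exact/measurable_EFinP.
pose h := nnsfun_approx measurableT mf.
have fE x : f x = limn (fun n => (h n x)%:E).
  by apply/esym/cvg_lim => //; exact: cvg_nnsfun_approx.
have fpE x : f x * (p x)%:E = limn (fun n => (h n x)%:E * (p x)%:E).
  by apply/esym/cvg_lim => //; apply: cvgeZr => //; exact: cvg_nnsfun_approx.
rewrite (eq_integral _ _ (fun x _ => fE x)) (eq_integral _ _ (fun x _ => fpE x)).
rewrite monotone_convergence//=; last 3 first.
- by move=> n; apply/measurable_EFinP.
- by move=> n x _; rewrite lee_fin.
- by move=> x _ a b ab; rewrite lee_fin; exact/lefP/nd_nnsfun_approx.
rewrite [RHS]monotone_convergence//=; last 3 first.
- by move=> n; apply: emeasurable_funM => //; exact/measurable_EFinP.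
- by move=> n x _; rewrite mule_ge0// lee_fin.
- move=> x _ a b ab; rewrite lee_wpmul2r ?lee_fin//.
  exact/lefP/nd_nnsfun_approx.
apply/congr_lim/funext => n.
transitivity (\sum_(y \in range (h n)) (y%:E * nu (h n @^-1` [set y]))).
  by rewrite integral_nnsfun// patch_setT sintegralE.
transitivity (\int[m]_x (\sum_(y \in range (h n))
    (y * \1_(h n @^-1` [set y]) x)%:E * (p x)%:E)); last first.
  apply: eq_integral => x _; rewrite [in RHS]fimfunE -fsumEFin//.
  by rewrite ge0_mule_fsuml// => y; exact: nnfun_muleindic_ge0.
rewrite ge0_integral_fsum//; last 2 first.
- move=> y; apply: emeasurable_funM => //.
  by apply/measurable_EFinP; apply: measurable_funM.
- by move=> y x _; apply: mule_ge0; [exact: nnfun_muleindic_ge0|rewrite lee_fin].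
apply: eq_fsbigr => y yr.
have mh : measurable (h n @^-1` [set y]) by [].
rewrite nuE//.
under [RHS]eq_integral do rewrite EFinM -muleA.
have [y0|y0] := ltP y 0%R.
  rewrite preimage_nnfun0// integral_set0 mule0.
  by under eq_integral do rewrite indic0/= mul0e mule0; rewrite integral0.
rewrite ge0_integralZl//=; last 2 first.
- by apply: emeasurable_funM => //; exact/measurable_EFinP.
- by move=> x _; rewrite mule_ge0// lee_fin.
congr (_ * _); rewrite integral_mkcond.
apply: eq_integral => x _; rewrite patchE indicE.
by case: ifPn => _; rewrite ?mul1e ?mul0e.
Qed.

End density.

(** * Averages over an exponential time *)

Section triangle.
Context {R : realType}.
Notation leb := (@lebesgue_measure R).
Local Open Scope ereal_scope.

(** Tonelli's theorem on the triangle [0 <= y <= u]. This is integration by parts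
    for the antiderivative of [h], in a form that requires no integrability. *)
Lemma ge0_integral_triangle (e h : R -> \bar R) :
  measurable_fun setT e -> measurable_fun setT h ->
  (forall x, 0 <= e x) -> (forall x, 0 <= h x) ->
  \int[leb]_(u in `[0%R, +oo[) (e u * \int[leb]_(y in `[0%R, u]) h y) =
  \int[leb]_(y in `[0%R, +oo[) (h y * \int[leb]_(u in `[y, +oo[) e u).
Proof.
move=> me mh e0 h0.
pose G (p : R * R) := if (0 <= p.2 <= p.1)%R then e p.1 * h p.2 else 0.
have mG : measurable_fun setT G.
  apply: measurable_fun_ifT => //.
  - apply: measurable_and; apply: measurable_fun_ler => //.
  - by apply: emeasurable_funM; apply: measurableT_comp.
have G0 p : 0 <= G p by rewrite /G; case: ifPn => // _; rewrite mule_ge0.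
transitivity (\int[leb]_u \int[leb]_y G (u, y)).
  rewrite integral_mkcond; apply: eq_integral => u _; rewrite patchE.
  rewrite mem_setE in_itv/= andbT; case: ifPn => u0; last first.
    rewrite integral0_eq// => y _; rewrite /G/=; case: ifPn => // /andP[y0 yu].
    by move/negP: u0; rewrite (le_trans y0 yu).
  rewrite -ge0_integralZl//; last exact: measurable_funTS.
  rewrite integral_mkcond; apply: eq_integral => y _; rewrite patchE /G/=.
  by rewrite mem_setE in_itv.
rewrite fubini_tonelli//.
rewrite [RHS]integral_mkcond; apply: eq_integral => y _; rewrite patchE.
rewrite mem_setE in_itv/= andbT; case: ifPn => y0; last first.
  rewrite integral0_eq// => u _; rewrite /G/=; case: ifPn => // /andP[y1 _].
  by move/negP: y0; rewrite y1.
rewrite -ge0_integralZl//; last exact: measurable_funTS.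
rewrite [RHS]integral_mkcond; apply: eq_integral => u _; rewrite patchE /G/= y0/=.
by rewrite mem_setE in_itv/= andbT muleC.
Qed.

End triangle.

(** Carrying the positivity of the rate makes the exponential law a bundled
    probability, to which the theorems of Fubini and Jensen apply directly. *)
Definition explaw (R : realType) (a : R) (a0 : 0 < a) :
  probability (measurableTypeR R) R.
Proof. by refine (exponential_prob a : probability (measurableTypeR R) R). Defined.

Section exponential_law.
Context {R : realType} (a : R) (a0 : 0 < a).
Notation leb := (@lebesgue_measure R).
Notation E := (explaw a0).
Let pdf (u : R) : R := a * expR (- a * u).

Let pdf0 u : 0 <= pdf u. Proof. by rewrite mulr_ge0 ?expR_ge0 ?ltW. Qed.

Let mpdf : measurable_fun setT pdf.
Proof.
by apply: measurable_funM => //; apply: measurableT_comp.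
Qed.

Lemma ge0_integral_explaw (f : R -> \bar R) :
  measurable_fun setT f -> (forall x, 0 <= f x)%E ->
  (\int[E]_u f u = \int[leb]_(u in `[0%R, +oo[) (f u * (a * expR (- a * u))%:E))%E.
Proof.
move=> mf f0.
rewrite (@ge0_integral_density _ (measurableTypeR R) R leb E (exponential_pdf a))//; last 2 first.
- by move=> x; apply/exponential_pdf_ge0/ltW.
- exact: measurable_exponential_pdf.
rewrite [RHS]integral_mkcond; apply: eq_integral => u _.
rewrite patchE /exponential_pdf patchE; case: ifPn => // _.
by rewrite mule0.
Qed.

Lemma explaw_memoryless (s : R) (f : R -> \bar R) :
  0 <= s -> measurable_fun setT f -> (forall x, 0 <= f x)%E ->
  (\int[E]_(u in `[s, +oo[) f u = (expR (- a * s))%:E * \int[E]_u f (s + u)%R)%E.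
Proof.
move=> s0 mf f0; have msf : measurable_fun setT (fun u => f (s + u)).
  by apply: (measurableT_comp mf); exact: measurable_funD.
rewrite integral_mkcond [in RHS]ge0_integral_explaw//.
rewrite ge0_integral_explaw; last 2 first.
- by apply/(measurable_restrictT f) => //; exact: measurable_funTS.
- by move=> x; apply: erestrict_ge0.
rewrite -ge0_integralZl//; last 2 first.
- apply: measurable_funTS; apply: emeasurable_funM => //.
  by apply/measurable_EFinP; exact: mpdf.
- by move=> x _; rewrite mule_ge0// lee_fin pdf0.
transitivity (\int[leb]_(u in `[s, +oo[) (f u * (a * expR (- a * u))%:E))%E.
  rewrite integral_mkcond [RHS]integral_mkcond; apply: eq_integral => u _.
  rewrite !patchE; have [us|us] := boolP (u \in `[s, +oo[%classic); last first.
    by case: ifPn => //; rewrite mul0e.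
  rewrite ifT//; move: us; rewrite !mem_setE !in_itv/= !andbT; exact: le_trans.
rewrite (ge0_integral_shift s)//; last 2 first.
- by apply: emeasurable_funM => //; apply/measurable_EFinP; exact: mpdf.
- by move=> x; rewrite mule_ge0// lee_fin pdf0.
rewrite (_ : _ @^-1` _ = `[0%R, +oo[%classic); last first.
  by apply/seteqP; split => x /=; rewrite !in_itv/= !andbT; lra.
apply: eq_integral => u _; rewrite muleCA; congr (_ * _)%E.
by rewrite -EFinM mulrCA -expRD; congr (_ * expR _)%:E; ring.
Qed.

Lemma explaw_tail (y : R) : 0 <= y -> E `[y, +oo[%classic = (expR (- a * y))%:E.
Proof.
move=> y0; have h := @explaw_memoryless y (cst 1%E) y0 (measurable_cst _) (fun=> lee01).
transitivity (\int[E]_(u in `[y, +oo[) cst 1 u)%E; first by rewrite integral_cst// mul1e.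
rewrite h; transitivity ((expR (- a * y))%:E * \int[E]_u cst 1 u)%E => //.
by rewrite integral_cst// mul1e [X in (_ * X)%E](@probability_setT _ _ _ E) mule1.
Qed.

Lemma explaw_ge0 : E `[0, +oo[%classic = 1%E.
Proof. by rewrite explaw_tail// mulr0 expR0. Qed.

(** In the average over the upper bound [u], the value [h y] is weighted by the
    mass of the [u] beyond [y], which is the tail of the law. *)
Lemma ge0_integral_explaw_triangle (h : R -> \bar R) :
  measurable_fun setT h -> (forall x, 0 <= h x)%E ->
  (\int[E]_u \int[leb]_(y in `[0%R, u]) h y =
   \int[leb]_(y in `[0%R, +oo[) (h y * (expR (- a * y))%:E))%E.
Proof.
move=> mh h0; have mpdfE : measurable_fun setT (EFin \o pdf) by exact/measurable_EFinP.
rewrite ge0_integral_explaw; last 2 first.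
- pose G (p : R * R) := if (0 <= p.2 <= p.1)%R then h p.2 else 0%E.
  have mG : measurable_fun setT G.
    apply: measurable_fun_ifT => //.
    + by apply: measurable_and; apply: measurable_fun_ler.
    + exact: measurableT_comp.
  rewrite (_ : (fun _ => _) = fun u => (\int[leb]_y G (u, y))%E).
    apply: measurable_fun_fubini_tonelli_F => // p.
    by rewrite /G; case: ifPn.
  apply/funext => u; rewrite integral_mkcond; apply: eq_integral => y _.
  rewrite patchE /G/=.
  by rewrite mem_setE in_itv.
- by move=> x; exact: integral_ge0.
transitivity (\int[leb]_(u in `[0%R, +oo[)
    ((pdf u)%:E * \int[leb]_(y in `[0%R, u]) h y))%E.
  by apply: eq_integral => u _; rewrite muleC.
rewrite (@ge0_integral_triangle R (EFin \o pdf) h)//.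
apply: eq_integral => y; rewrite mem_setE in_itv/= andbT => y0; congr (_ * _)%E.
rewrite -explaw_tail// -[X in E X]setIT -integral_indic//.
rewrite [RHS]ge0_integral_explaw; last 2 first.
- exact/measurable_EFinP/measurable_indic.
- by move=> x; rewrite lee_fin.
rewrite integral_mkcond [RHS]integral_mkcond; apply: eq_integral => x _; rewrite !patchE indicE.
have [xy|xy] := boolP (x \in `[y, +oo[%classic); last first.
  by case: ifP => //; rewrite mul0e.
rewrite ifT ?mul1e//; move: xy; rewrite !mem_setE !in_itv/= !andbT; exact: le_trans.
Qed.

End exponential_law.

Section exponential_law_signed.
Context {R : realType} (a : R) (a0 : 0 < a).
Notation leb := (@lebesgue_measure R).
Notation E := (explaw a0).

(** Valid also when the difference is [+oo - +oo], which is how the lemmas below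
    dispense with integrability. *)
Let gt0_muleBr (c : R) (x y : \bar R) : 0 < c -> (0 <= x)%E -> (0 <= y)%E ->
  (c%:E * (x - y) = c%:E * x - c%:E * y)%E.
Proof.
move=> c0; case: x => [x||]// _; case: y => [y||]// _.
- by rewrite -EFinB -!EFinM -EFinB mulrBr.
- by rewrite /= gt0_muleNy ?gt0_muley ?lte_fin.
- by rewrite /= gt0_muley ?lte_fin.
- by rewrite /= gt0_muleNy ?gt0_muley ?lte_fin.
Qed.

(** The integral in the Ornstein-Uhlenbeck process is the average of the past
    [f (t - u)] over an exponential time [u]. Measurability of [f] is enough: an
    infinite or indeterminate integral is sent to the same value on both sides.
    The identity can therefore be used on every path. *)
Lemma Rintegral_explaw_reflect (f : R -> R) (t : R) : measurable_fun setT f ->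
  a * \int[leb]_(u in `]-oo, t]) (f u * expR (- a * (t - u))) =
  \int[E]_u f (t - u).
Proof.
move=> mf; rewrite /Rintegral -[a]/(fine a%:E).
have key (g : R -> R) : measurable_fun setT g -> (forall x, 0 <= g x) ->
    (a%:E * \int[leb]_(u in `]-oo, t]) (g u * expR (- a * (t - u)))%:E =
     \int[E]_u (g (t - u))%:E)%E.
  move=> mg g0.
  have me : measurable_fun setT (fun u => (g u * expR (- a * (t - u)))%:E).
    apply/measurable_EFinP; apply: measurable_funM => //.
    apply: measurableT_comp => //; apply: measurable_funM => //.
    exact: measurable_funB.
  rewrite ge0_integral_explaw//; last 2 first.
  - apply/measurable_EFinP; apply: (measurableT_comp mg).
    exact: measurable_funB.
  - by move=> x; rewrite lee_fin.
  rewrite (ge0_integral_reflect t)//; last first.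
    by move=> x; rewrite lee_fin mulr_ge0 ?expR_ge0.
  rewrite (_ : _ @^-1` _ = `[0%R, +oo[%classic); last first.
    by apply/seteqP; split => x /=; rewrite !in_itv/= andbT; lra.
  rewrite -ge0_integralZl; last 4 first.
  - by [].
  - apply: measurable_funTS; apply: (measurableT_comp me).
    exact: measurable_funB.
  - by move=> x _; rewrite lee_fin mulr_ge0 ?expR_ge0.
  - by rewrite lee_fin ltW.
  apply: eq_integral => u _; rewrite -!EFinM subKr; congr EFin; ring.
rewrite (_ : \int[leb]_(u in `]-oo, t]) (f u * expR (- a * (t - u)))%:E =
    \int[leb]_(u in `]-oo, t]) (Num.max (f u) 0 * expR (- a * (t - u)))%:E -
    \int[leb]_(u in `]-oo, t]) (Num.max (- f u) 0 * expR (- a * (t - u)))%:E)%E; last first.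
  rewrite integralE; congr (_ - _)%E; apply: eq_integral => u _.
    by rewrite funeposE -EFin_max maxr_pMl ?expR_ge0// mul0r.
  by rewrite funenegE -EFinN -EFin_max maxr_pMl ?expR_ge0// mul0r [- f u * _]mulNr.
rewrite (_ : \int[E]_u (f (t - u))%:E = \int[E]_u (Num.max (f (t - u)) 0)%:E -
    \int[E]_u (Num.max (- f (t - u)) 0)%:E)%E; last first.
  by rewrite integralE; congr (_ - _)%E; apply: eq_integral => u _;
    rewrite ?funeposE ?funenegE -?EFinN -EFin_max.
have i0 (g : R -> R) : (forall x, 0 <= g x) ->
   (0 <= \int[leb]_(u in `]-oo, t]) (g u * expR (- a * (t - u)))%:E)%E.
  by move=> g0; apply: integral_ge0 => x _; rewrite lee_fin mulr_ge0 ?expR_ge0.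
rewrite -(key (fun u => Num.max (f u) 0)); last 2 first.
- exact: measurable_maxr.
- by move=> x; rewrite le_max lexx orbT.
rewrite -(key (fun u => Num.max (- f u) 0)); last 2 first.
- by apply: measurable_maxr => //; exact: measurableT_comp.
- by move=> x; rewrite le_max lexx orbT.
rewrite -gt0_muleBr//; last 2 first.
- by apply: i0 => x; rewrite le_max lexx orbT.
- by apply: i0 => x; rewrite le_max lexx orbT.
case: (_ - _)%E => [r||] //=; first by rewrite mulr0 gt0_muley ?lte_fin.
by rewrite mulr0 gt0_muleNy ?lte_fin.
Qed.

(** Lack of memory for integrands of arbitrary sign. *)
Lemma integrable_explaw_shift (s : R) (g : R -> R) : 0 <= s ->
  measurable_fun setT g -> E.-integrable setT (EFin \o g) ->
  E.-integrable `[s, +oo[ (fun u => (g (u - s))%:E) /\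
  \int[E]_(u in `[s, +oo[) g (u - s) = expR (- a * s) * \int[E]_u g u.
Proof.
move=> s0 mg /integrableP[_ ig].
have ms : measurable_fun setT (fun u : R => g (u - s)).
  by apply: (measurableT_comp mg); exact: measurable_funB.
have key (h : R -> R) : measurable_fun setT h -> (forall x, 0 <= h x) ->
    (\int[E]_(u in `[s, +oo[) (h (u - s))%:E =
     (expR (- a * s))%:E * \int[E]_u (h u)%:E)%E.
  move=> mh h0; rewrite (@explaw_memoryless _ _ _ s (fun u => (h (u - s))%:E))//.
  - congr (_ * _)%E; apply: eq_integral => u _.
    by rewrite addrAC subrr add0r.
  - apply/measurable_EFinP; apply: (measurableT_comp mh).
    exact: measurable_funB.
  - by move=> x; rewrite lee_fin.
split.
  apply/integrableP; split; first exact/measurable_funTS/measurable_EFinP.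
  rewrite (_ : integral _ _ _ = \int[E]_(u in `[s, +oo[) (`|g (u - s)|)%:E)%E//.
  rewrite (key (fun u => `|g u|))//; last exact: measurableT_comp.
  by rewrite lte_mul_pinfty// lee_fin expR_ge0.
rewrite /Rintegral -[X in X * _]/(fine (expR (- a * s))%:E).
rewrite (_ : \int[E]_(u in `[s, +oo[) (g (u - s))%:E =
    \int[E]_(u in `[s, +oo[) (Num.max (g (u - s)) 0)%:E -
    \int[E]_(u in `[s, +oo[) (Num.max (- g (u - s)) 0)%:E)%E; last first.
  by rewrite integralE; congr (_ - _)%E; apply: eq_integral => u _;
    rewrite ?funeposE ?funenegE -?EFinN -EFin_max.
rewrite (key (fun u => Num.max (g u) 0)); last 2 first.
- exact: measurable_maxr.
- by move=> x; rewrite le_max lexx orbT.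
rewrite (key (fun u => Num.max (- g u) 0)); last 2 first.
- by apply: measurable_maxr => //; exact: measurableT_comp.
- by move=> x; rewrite le_max lexx orbT.
rewrite -gt0_muleBr ?expR_gt0//; last 2 first.
- by apply: integral_ge0 => x _; rewrite lee_fin le_max lexx orbT.
- by apply: integral_ge0 => x _; rewrite lee_fin le_max lexx orbT.
rewrite [in RHS]integralE.
rewrite (_ : \int[E]_u (EFin \o g)^\+ u = \int[E]_u (Num.max (g u) 0)%:E)%E; last first.
  by apply: eq_integral => u _; rewrite funeposE -EFin_max.
rewrite (_ : \int[E]_u (EFin \o g)^\- u = \int[E]_u (Num.max (- g u) 0)%:E)%E; last first.
  by apply: eq_integral => u _; rewrite funenegE -EFinN -EFin_max.
case: (_ - _)%E => [r||] //=; first by rewrite mulr0 gt0_muley ?lte_fin ?expR_gt0.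
by rewrite mulr0 gt0_muleNy ?lte_fin ?expR_gt0.
Qed.

Lemma explaw_poly4 : (\int[E]_u ((1 + `|u|) ^+ 4)%:E < +oo)%E.
Proof.
have mp : measurable_fun setT (fun u : R => ((1 + `|u|) ^+ 4)%:E).
  by apply/measurable_EFinP; apply: measurable_funX; apply: measurable_funD.
rewrite ge0_integral_explaw//.
(* [1 + u <= K * expR (a / 8 * u)], so the fourth power of [1 + u] absorbs only
   half of the exponential rate. *)
pose K := 1 + 8 / a; have a20 : 0 < a / 2 by rewrite divr_gt0.
have K0 : 0 <= K by rewrite addr_ge0// divr_ge0// ltW.
have e2 : (\int[leb]_(u in `[0%R, +oo[) ((a / 2) * expR (- (a / 2) * u))%:E = 1)%E.
  have := @ge0_integral_explaw _ _ a20 (cst 1%E) (measurable_cst _) (fun=> lee01).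
  have -> : (\int[explaw a20]_u cst 1 u = 1)%E.
    by rewrite integral_cst// mul1e; exact: (@probability_setT _ _ _ (explaw a20)).
  by move=> ->; apply: eq_integral => u _; rewrite mul1e.
apply: (@le_lt_trans _ _ ((2 * K ^+ 4)%:E * \int[leb]_(u in `[0%R, +oo[)
    ((a / 2) * expR (- (a / 2) * u))%:E)%E); last by rewrite e2 mule1 ltry.
rewrite -ge0_integralZl; last 4 first.
- by [].
- apply/measurable_funTS/measurable_EFinP; apply: measurable_funM => //.
  by apply: measurableT_comp.
- by move=> x _; rewrite lee_fin mulr_ge0 ?expR_ge0// ltW.
- by rewrite lee_fin mulr_ge0// exprn_ge0.
apply: ge0_le_integral => //.
- by move=> u _; rewrite mule_ge0// lee_fin ?exprn_ge0 ?addr_ge0// mulr_ge0 ?expR_ge0// ltW.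
- apply: measurable_funTS; apply: emeasurable_funM => //.
  apply/measurable_EFinP; apply: measurable_funM => //.
  by apply: measurableT_comp.
- apply: measurable_funTS; apply: emeasurable_funM => //.
  apply/measurable_EFinP; apply: measurable_funM => //.
  by apply: measurableT_comp.
move=> u /=; rewrite in_itv/= andbT => u0; rewrite -!EFinM lee_fin ger0_norm//.
rewrite (_ : expR (- a * u) = expR (- (a / 2) * u) * expR (- (a / 2) * u)); last first.
  by rewrite -expRD; congr expR; field.
rewrite (_ : 2 * K ^+ 4 * _ = K ^+ 4 * (a * expR (- (a / 2) * u))); last by field.
rewrite [a * (_ * _)]mulrA mulrCA mulrC ler_wpM2r//.
  by rewrite mulr_ge0 ?expR_ge0// ltW.
have h1 : 1 + u <= K * expR (a / 8 * u).
  apply: (@le_trans _ _ (K * (1 + a / 8 * u))); last first.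
    by rewrite ler_wpM2l// expR_ge1Dx.
  rewrite /K mulrDl mul1r mulrDr mulr1 addrA -subr_ge0.
  rewrite (_ : _ - _ = a / 8 * u + 8 / a + (8 / a * (a / 8) - 1) * u); last by ring.
  rewrite (_ : 8 / a * (a / 8) - 1 = 0); last by field; rewrite gt_eqF.
  rewrite mul0r addr0 addr_ge0//; last by rewrite divr_ge0// ltW.
  by rewrite mulr_ge0// divr_ge0// ltW.
have h4 : (1 + u) ^+ 4 <= K ^+ 4 * expR (a / 2 * u).
  rewrite (_ : expR (a / 2 * u) = expR (a / 8 * u) ^+ 4); last first.
    by rewrite -expRM_natl; congr expR; field.
  by rewrite -exprMn lerXn2r// nnegrE ?addr_ge0// mulr_ge0// expR_ge0.
apply: le_trans (ler_wpM2r _ h4) _; first exact: expR_ge0.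
by rewrite -[leLHS]mulrA -expRD mulNr subrr expR0 mulr1.
Qed.

(** Degree four is the growth allowed to the fourth moments of a process. *)
Lemma integrable_explaw_poly (C : R) (f : R -> R) : measurable_fun setT f ->
  (forall u, 0 <= u -> `|f u| <= C * (1 + u) ^+ 4) ->
  E.-integrable setT (EFin \o f).
Proof.
move=> mf fC; have C0 : 0 <= C.
  have /= := fC 0 (lexx _); rewrite addr0 expr1n mulr1; exact: le_trans.
have mp : measurable_fun setT (fun u : R => ((1 + `|u|) ^+ 4)%:E).
  by apply/measurable_EFinP; apply: measurable_funX; apply: measurable_funD.
apply/integrableP; split; first exact/measurable_EFinP.
apply: (@le_lt_trans _ _ (C%:E * \int[E]_u ((1 + `|u|) ^+ 4)%:E)%E); last first.
  by rewrite lte_mul_pinfty ?lee_fin// explaw_poly4.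
rewrite [X in (_ * X)%E]ge0_integral_explaw//.
rewrite ge0_integral_explaw//; last first.
  by apply/measurable_EFinP; exact: measurableT_comp.
have mpdf : measurable_fun setT (fun x => (a * expR (- a * x))%:E).
  by apply/measurable_EFinP; apply: measurable_funM => //; apply: measurableT_comp.
rewrite -ge0_integralZl; last 4 first.
- by [].
- by apply: measurable_funTS; exact: emeasurable_funM.
- by move=> u _; rewrite mule_ge0// lee_fin ?exprn_ge0 ?addr_ge0// mulr_ge0 ?expR_ge0// ltW.
- by rewrite lee_fin.
apply: ge0_le_integral => //.
- by move=> u _; rewrite mule_ge0// lee_fin mulr_ge0 ?expR_ge0// ltW.
- apply: measurable_funTS; apply: emeasurable_funM => //.
  by apply/measurable_EFinP; exact: measurableT_comp.
- by apply: measurable_funTS; apply: emeasurable_funM => //; exact: emeasurable_funM.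
move=> u /=; rewrite in_itv/= andbT => u0; rewrite muleA lee_wpmul2r//.
  by rewrite lee_fin mulr_ge0 ?expR_ge0// ltW.
by rewrite lee_fin [`|u|]ger0_norm// fC.
Qed.

End exponential_law_signed.

(** * Moments of Gaussian laws *)

Section gaussian_integrals.
Context {R : realType} (s : R) (s0 : s != 0).
Notation leb := (@lebesgue_measure R).
Local Notation q := (normal_fun 0 s).

Let s2 : 0 < s ^+ 2. Proof. by rewrite exprn_even_gt0. Qed.

Let mq : measurable_fun setT q. Proof. exact: measurable_normal_fun. Qed.

Let q0 x : 0 <= q x. Proof. exact: normal_fun_ge0. Qed.

Let qE x : q x = expR (- (x ^+ 2 * (s ^+ 2 *+ 2)^-1)).
Proof. by rewrite /normal_fun subr0 mulNr. Qed.

Let qN x : q (- x) = q x. Proof. by rewrite !qE sqrrN. Qed.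

Let derive_q (x : R) : is_derive x (1 : R) (fun y : R => - (s ^+ 2 * q y)) (x * q x).
Proof.
rewrite (_ : (fun _ => _) = (fun y => - (s ^+ 2 * expR (- (y ^+ 2 * (s ^+ 2 *+ 2)^-1))))); last first.
  by apply/funext => y; rewrite qE.
rewrite qE.
apply: is_derive_eq.
rewrite /GRing.scale/= mulr0 add0r mulr1 mulr2n.
have s22 : s ^+ 2 + s ^+ 2 != 0 by rewrite gt_eqF// addr_gt0.
by set c := expR _; rewrite -[RHS]mulr1 -(mulfV s22); field.
Qed.

Let q_cvgy : (- (s ^+ 2 * q x)) @[x --> +oo%R] --> (0 : R).
Proof.
rewrite -[X in _ --> X]oppr0 -[X in _ --> - X](mulr0 (s ^+ 2)).
apply: cvgN; apply: cvgMr => //; rewrite (funext qE).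
apply: (@cvg_comp _ _ _ (fun x => x ^+ 2 * (s ^+ 2 *+ 2)^-1) (fun z => expR (- z))
  _ (pinfty_nbhs R)); last exact: cvgr_expR.
by apply: gt0_cvgMly; [rewrite invr_gt0 mulrn_wgt0|exact: cvgr_expr2].
Qed.

Let continuous_q : continuous q.
Proof.
move=> x; rewrite (funext qE); apply: (cvg_comp _ expR); last exact: continuous_expR.
apply: cvgN; apply: cvgM; last exact: cvg_cst.
exact: exprn_continuous.
Qed.

Let derivable_q (x : R) : derivable (fun y : R => - (s ^+ 2 * q y)) x 1.
Proof. exact: (@ex_derive _ _ _ _ _ _ _ (derive_q x)). Qed.

Let gauss_tail y : 0 <= y ->
  (\int[leb]_(u in `[y, +oo[) (`|u| * q u)%:E = (s ^+ 2 * q y)%:E)%E.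
Proof.
move=> y0; transitivity (\int[leb]_(u in `[y, +oo[) (u * q u)%:E)%E.
  apply: eq_integral => u; rewrite mem_setE in_itv/= andbT => yu.
  by rewrite ger0_norm// (le_trans y0).
rewrite (@ge0_continuous_FTC2y _ _ (fun x => - (s ^+ 2 * q x)) _ 0)//.
- by rewrite EFinN oppeK add0e.
- by move=> x yx; rewrite mulr_ge0// (le_trans y0).
- apply: continuous_subspaceT => x.
  by apply: cvgM; [exact: cvg_id|exact: continuous_q].
- apply/cvg_at_right_filter; apply: cvgN; apply: cvgMr => //.
  exact: continuous_q.
- by move=> x _; rewrite derive1E (@derive_val _ _ _ _ _ _ _ (derive_q x)).
Qed.

(** Integrating [x * q x] by parts against an antiderivative of [h]; written
    with the triangle identity, so that no integrability has to be known. *)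
Let gauss_by_parts (h H : R -> R) : measurable_fun setT h -> (forall x, 0 <= h x) ->
  (forall u, 0 <= u -> (\int[leb]_(y in `[0%R, u]) (h y)%:E = (H u)%:E)%E) ->
  (\int[leb]_(u in `[0%R, +oo[) (u * H u * q u)%:E =
   \int[leb]_(u in `[0%R, +oo[) (s ^+ 2 * (h u * q u))%:E)%E.
Proof.
move=> mh h0 hH.
transitivity (\int[leb]_(u in `[0%R, +oo[)
    ((`|u| * q u)%:E * \int[leb]_(y in `[0%R, u]) (h y)%:E))%E.
  apply: eq_integral => u; rewrite mem_setE in_itv/= andbT => u0.
  by rewrite hH// -EFinM ger0_norm//; congr EFin; ring.
rewrite (@ge0_integral_triangle _ (fun u => (`|u| * q u)%:E) (EFin \o h))//.
- apply: eq_integral => u; rewrite mem_setE in_itv/= andbT => u0.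
  by rewrite gauss_tail// -EFinM; congr EFin; ring.
- by apply/measurable_EFinP; apply: measurable_funM.
- exact/measurable_EFinP.
- by move=> x; rewrite lee_fin mulr_ge0.
Qed.

Let M n := (\int[leb]_(u in `[0%R, +oo[) (u ^+ n * q u)%:E)%E.

Let M1 : M 1 = (s ^+ 2)%:E.
Proof.
have := gauss_tail (lexx 0); rewrite (_ : q 0 = 1) ?mulr1 => [<-|].
  apply: eq_integral => u; rewrite mem_setE in_itv/= andbT => u0.
  by rewrite ger0_norm.
by rewrite qE expr0n mul0r oppr0 expR0.
Qed.

Let Mstep n : M n.+2 = ((n.+1%:R * s ^+ 2)%:E * M n)%E.
Proof.
have h0 (x : R) : (0 <= n.+1%:R * `|x| ^+ n)%R by rewrite mulr_ge0// exprn_ge0.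
have mh : measurable_fun setT (fun x : R => n.+1%:R * `|x| ^+ n).
  by apply: measurable_funM => //; apply: measurable_funX.
have hH (u : R) : 0 <= u ->
    (\int[leb]_(y in `[0%R, u]) (n.+1%:R * `|y| ^+ n)%:E = (u ^+ n.+1)%:E)%E.
  rewrite le_eqVlt => /predU1P[<-|u0].
    by rewrite set_itv1 integral_set1 expr0n.
  transitivity (\int[leb]_(y in `[0%R, u]) (n.+1%:R * y ^+ n)%:E)%E.
    by apply: eq_integral => y; rewrite mem_setE in_itv/= => /andP[y0 _]; rewrite ger0_norm.
  rewrite (@continuous_FTC2 _ _ (fun x => x ^+ n.+1))//.
  - by rewrite [in X in (_ - X)%E]expr0n sube0.
  - apply: continuous_subspaceT => x.
    by apply: cvgM; [exact: cvg_cst|exact: exprn_continuous].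
  - split; first by move=> x _; exact: exprn_derivable.
    + by apply: cvg_at_right_filter; exact: exprn_continuous.
    + by apply: cvg_at_left_filter; exact: exprn_continuous.
  - by move=> x _; rewrite derive1E exp_derive/= /GRing.scale/= mulr1.
have := gauss_by_parts mh h0 hH.
under eq_integral do rewrite -exprS.
rewrite -/(M n.+2) => ->; rewrite /M -ge0_integralZl; last 4 first.
- by [].
- apply/measurable_funTS/measurable_EFinP; apply: measurable_funM => //.
- by move=> x /=; rewrite in_itv/= andbT => x0; rewrite lee_fin mulr_ge0// exprn_ge0.
- by rewrite lee_fin mulr_ge0// ltW.
apply: eq_integral => u; rewrite mem_setE in_itv/= andbT => u0.
by rewrite -EFinM ger0_norm//; congr EFin; ring.
Qed.

Let pdf x : R := normal_pdf 0 s x.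

Let pdfE x : pdf x = normal_peak s * q x.
Proof. by rewrite /pdf normal_pdfE. Qed.

Let peak0 : 0 <= normal_peak s. Proof. exact: normal_peak_ge0. Qed.

Let mpdf : measurable_fun setT pdf. Proof. exact: measurable_normal_pdf. Qed.

Let even_moment k : ~~ odd k ->
  (\int[leb]_x (x ^+ k * pdf x)%:E = (2 * normal_peak s)%:E * M k)%E.
Proof.
move=> ok; rewrite ge0_symfun_integralT.
- rewrite EFinM -muleA; congr (_ * _)%E.
  rewrite /M -ge0_integralZl; last 4 first.
  + by [].
  + apply/measurable_funTS/measurable_EFinP; apply: measurable_funM => //.
  + by move=> x /=; rewrite in_itv/= andbT => x0; rewrite lee_fin mulr_ge0// exprn_ge0.
  + by rewrite lee_fin.
  rewrite -set_itvcy; apply: eq_integral => u _.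
  by rewrite pdfE -EFinM mulrCA.
- by move=> x; rewrite pdfE mulr_ge0// ?mulr_ge0// exprn_even_ge0.
- move=> x; apply: cvgM; first exact: exprn_continuous.
  exact: continuous_normal_pdf.
- by move=> x /=; rewrite !pdfE qN exprNn -signr_odd (negbTE ok) expr0 mul1r.
Qed.

Lemma normal_sqr_moment : (\int[leb]_x (x ^+ 2 * normal_pdf 0 s x)%:E = (s ^+ 2)%:E)%E.
Proof.
rewrite even_moment// Mstep mul1r muleCA -(@even_moment 0)//.
under eq_integral do rewrite mul1r.
by rewrite integral_normal_pdf// mule1.
Qed.

Lemma normal_fourth_moment :
  (\int[leb]_x (x ^+ 4 * normal_pdf 0 s x)%:E = (3 * (s ^+ 2) ^+ 2)%:E)%E.
Proof.
rewrite even_moment// Mstep muleCA -even_moment// normal_sqr_moment -EFinM.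
by congr EFin; ring.
Qed.

(** The two half-moments coincide, so that the mean of a Gaussian variable is its
    location parameter. *)
Lemma normal_pos_moment :
  (\int[leb]_x (Num.max x 0 * normal_pdf 0 s x)%:E = (normal_peak s * s ^+ 2)%:E)%E.
Proof.
rewrite EFinM -M1 /M -ge0_integralZl; last 4 first.
- by [].
- by apply/measurable_funTS/measurable_EFinP; apply: measurable_funM.
- by move=> x /=; rewrite in_itv/= andbT => x0; rewrite lee_fin mulr_ge0// exprn_ge0.
- by rewrite lee_fin.
rewrite [RHS]integral_mkcond; apply: eq_integral => u _; rewrite patchE.
rewrite mem_setE in_itv/= andbT; case: ifPn => u0.
  by rewrite -/(pdf _) pdfE max_l// -EFinM mulrCA.
by rewrite max_r ?mul0r// ltW// ltNge.
Qed.

Lemma normal_neg_moment :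
  (\int[leb]_x (Num.max (- x) 0 * normal_pdf 0 s x)%:E = (normal_peak s * s ^+ 2)%:E)%E.
Proof.
have mpos : measurable_fun setT (fun x : R => (Num.max x 0 * normal_pdf 0 s x)%:E).
  by apply/measurable_EFinP; apply: measurable_funM => //; exact: measurable_maxr.
have pos x : (0 <= (Num.max x 0 * normal_pdf 0 s x)%:E)%E.
  by rewrite lee_fin mulr_ge0 ?le_max ?lexx ?orbT// normal_pdf_ge0.
rewrite -normal_pos_moment (@ge0_integral_reflect _ 0 _ _ measurableT mpos pos).
rewrite preimage_setT; apply: eq_integral => u _.
by rewrite sub0r -/(pdf _) -/(pdf _) !pdfE qN.
Qed.

End gaussian_integrals.

Section gaussian_random_variable.
Context d (T : measurableType d) (R : realType) (P : probability T R).
Notation leb := (@lebesgue_measure R).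
Variable G : T -> R.
Hypothesis mG : measurable_fun setT G.

Let law_integral (nu : {measure set (measurableTypeR R) -> \bar R}) :
  (forall A : set R, measurable A -> P (G @^-1` A) = nu A) ->
  forall f : R -> \bar R, measurable_fun setT f -> (forall x, 0 <= f x)%E ->
  (\int[P]_w f (G w) = \int[nu]_x f x)%E.
Proof.
move=> lawG f mf f0.
have := @ge0_integral_pushforward _ _ T (measurableTypeR R) R G mG P setT f
  measurableT mf (in1W f0).
rewrite preimage_setT => <-; apply: eq_measure_integral => A mA _.
exact: lawG.
Qed.

Let normal_integral (m s : R) (f : R -> \bar R) : s != 0 ->
  (forall A : set R, measurable A -> P (G @^-1` A) = normal_prob m s A) ->
  measurable_fun setT f -> (forall x, 0 <= f x)%E ->
  (\int[P]_w f (G w) = \int[leb]_x (f (m + x)%R * (normal_pdf 0 s x)%:E))%E.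
Proof.
move=> s0 lawG mf f0.
rewrite (@law_integral (normal_prob m s) lawG f mf f0).
rewrite (@ge0_integral_density _ (measurableTypeR R) R leb (normal_prob m s)
  (normal_pdf m s) (normal_pdf_ge0 m s) (measurable_normal_pdf m s)
  (fun A _ => erefl) f mf f0).
have mg : measurable_fun setT (fun x => f x * (normal_pdf m s x)%:E)%E.
  by apply: emeasurable_funM => //; apply/measurable_EFinP; exact: measurable_normal_pdf.
have g0 x : (0 <= f x * (normal_pdf m s x)%:E)%E.
  by rewrite mule_ge0// lee_fin normal_pdf_ge0.
rewrite (ge0_integral_shift m measurableT mg g0).
rewrite preimage_setT; apply: eq_integral => x _; congr (_ * _%:E)%E.
rewrite (normal_pdfE m s0) (normal_pdfE 0 s0); congr *%R.
by rewrite /normal_fun subr0 addrAC subrr add0r.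
Qed.

(** A zero mean forces the location parameter of the law to vanish, because the
    normal density is symmetric around it; the moments are then those of the
    centered normal density, or zero for a Dirac mass. *)
Lemma gaussian_fourth_moment : is_gaussian P G -> ('E_P[G] = 0)%E ->
  exists v : R, (\int[P]_w (G w ^+ 2)%:E = v%:E)%E /\
    (\int[P]_w (G w ^+ 4)%:E = (3 * v ^+ 2)%:E)%E.
Proof.
move=> [m [s lawG]]; rewrite unlock => EG.
have mX n : measurable_fun setT (fun x : R => (x ^+ n)%:E).
  by apply/measurable_EFinP; exact: exprn_measurable.
have X0 n : ~~ odd n -> forall x : R, (0 <= (x ^+ n)%:E)%E.
  by move=> on x; rewrite lee_fin exprn_even_ge0.
have [s0|s0] := eqVneq s 0.
  have dG (f : R -> \bar R) : measurable_fun setT f -> (forall x, 0 <= f x)%E ->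
      (\int[P]_w f (G w) = f m)%E.
    move=> mf f0; rewrite (@law_integral (@dirac _ (measurableTypeR R) m R))//; last first.
      by move=> A mA; rewrite lawG// s0 eqxx.
    by rewrite integral_dirac// diracT mul1e.
  suff m0 : m = 0.
    exists 0; rewrite (dG (fun x => (x ^+ 2)%:E))//; last exact: X0.
    rewrite (dG (fun x => (x ^+ 4)%:E))//; last exact: X0.
    by rewrite m0 !expr0n/= mulr0.
  have mpos : measurable_fun setT (fun x : R => (Num.max x 0)%:E).
    by apply/measurable_EFinP; exact: measurable_maxr.
  have mneg : measurable_fun setT (fun x : R => (Num.max (- x) 0)%:E).
    by apply/measurable_EFinP; apply: measurable_maxr => //; exact: measurableT_comp.
  move: EG; rewrite integralE.
  rewrite (_ : \int[P]_x (fun w => (G w)%:E)^\+ x = \int[P]_w (Num.max (G w) 0)%:E)%E; last first.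
    by apply: eq_integral => w _; rewrite funeposE -EFin_max.
  rewrite (_ : \int[P]_x (fun w => (G w)%:E)^\- x = \int[P]_w (Num.max (- G w) 0)%:E)%E; last first.
    by apply: eq_integral => w _; rewrite funenegE -EFinN -EFin_max.
  rewrite (dG _ mpos)// ?(dG _ mneg)//.
  - rewrite -EFinB => -[]; rewrite /Num.max; case: ifPn; case: ifPn; lra.
  - by move=> x; rewrite lee_fin le_max lexx orbT.
  - by move=> x; rewrite lee_fin le_max lexx orbT.
have lawN : forall A : set R, measurable A -> P (G @^-1` A) = normal_prob m s A.
  by move=> A mA; rewrite lawG// (negbTE s0).
have nG (f : R -> R) : measurable_fun setT f -> (forall x, 0 <= f x) ->
    (\int[P]_w (f (G w - m))%:E = \int[leb]_x (f x * normal_pdf 0 s x)%:E)%E.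
  move=> mf f0; have mfm : measurable_fun setT (fun x : R => (f (x - m))%:E).
    apply/measurable_EFinP; apply: (measurableT_comp mf).
    exact: measurable_funB.
  have fm0 x : (0 <= (f (x - m))%:E)%E by rewrite lee_fin.
  rewrite (normal_integral s0 lawN mfm fm0).
  by apply: eq_integral => x _; rewrite -EFinM addrAC subrr add0r.
have pos : (\int[P]_w (Num.max (G w - m) 0)%:E = (normal_peak s * s ^+ 2)%:E)%E.
  rewrite (nG (fun x => Num.max x 0)) ?normal_pos_moment//.
  - exact: measurable_maxr.
  - by move=> x; rewrite le_max lexx orbT.
have neg : (\int[P]_w (Num.max (- (G w - m)) 0)%:E = (normal_peak s * s ^+ 2)%:E)%E.
  rewrite (nG (fun x => Num.max (- x) 0)) ?normal_neg_moment//.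
  - by apply: measurable_maxr => //; exact: measurableT_comp.
  - by move=> x; rewrite le_max lexx orbT.
have mGm : measurable_fun setT (fun w => G w - m) by exact: measurable_funB.
have iGm : P.-integrable setT (fun w => (G w - m)%:E).
  apply/integrableP; split; first exact/measurable_EFinP.
  under eq_integral => w _.
    rewrite (_ : `|_|%E = (Num.max (G w - m) 0)%:E + (Num.max (- (G w - m)) 0)%:E)%E; last first.
      rewrite -EFinD /=; congr EFin; have [h|h] := leP 0 (G w - m).
        by rewrite ger0_norm// max_r ?addr0// oppr_le0.
      by rewrite ltr0_norm// add0r max_l// oppr_ge0 ltW.
    over.
  rewrite ge0_integralD//=.
  - by rewrite pos neg -EFinD ltry.
  - by move=> x _; rewrite lee_fin le_max lexx orbT.
  - by apply/measurable_EFinP; exact: measurable_maxr.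
  - by move=> x _; rewrite lee_fin le_max lexx orbT.
  - by apply/measurable_EFinP; apply: measurable_maxr => //; exact: measurableT_comp.
have m0 : m = 0.
  have : (\int[P]_w ((G w - m)%:E + m%:E) = 0)%E.
    by rewrite -EG; apply: eq_integral => w _; rewrite -EFinD subrK.
  rewrite integralD//; last exact: finite_measure_integrable_cst.
  have -> : (\int[P]_w m%:E = m%:E)%E.
    by rewrite (@integral_cst _ _ _ P _ measurableT m%:E)/= probability_setT mule1.
  rewrite integralE.
  rewrite (_ : \int[P]_x (fun w => (G w - m)%:E)^\+ x = (normal_peak s * s ^+ 2)%:E)%E; last first.
    by rewrite -pos; apply: eq_integral => w _; rewrite funeposE -EFin_max.
  rewrite (_ : \int[P]_x (fun w => (G w - m)%:E)^\- x = (normal_peak s * s ^+ 2)%:E)%E; last first.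
    by rewrite -neg; apply: eq_integral => w _; rewrite funenegE -EFinN -EFin_max.
  by rewrite -EFinB subrr add0e => -[].
exists (s ^+ 2); rewrite -normal_sqr_moment// -normal_fourth_moment//.
rewrite -(nG (fun x => x ^+ 2))//; last by move=> x; exact: sqr_ge0.
rewrite -(nG (fun x => x ^+ 4))//; last by move=> x; exact: exprn_even_ge0.
by split; apply: eq_integral => w _; rewrite m0 subr0.
Qed.

End gaussian_random_variable.

(** * Isserlis' formula *)

Section fourth_moments.
Context d (T : measurableType d) (R : realType) (P : probability T R).
Implicit Types (a b c e f g h : T -> R).

Definition mean (f : T -> R) : R := \int[P]_w f w.

Let Int f := P.-integrable setT (EFin \o f).

Lemma mean_cst (r : R) : mean (fun=> r) = r.
Proof. by rewrite /mean Rintegral_cst//= probability_setT mulr1. Qed.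

Lemma mean_lin (x y : R) f g : Int f -> Int g ->
  Int (fun w => x * f w + y * g w) /\
  mean (fun w => x * f w + y * g w) = x * mean f + y * mean g.
Proof.
move=> fi gi; have xf : Int (fun w => x * f w).
  by rewrite /Int (_ : _ \o _ = fun w => (x%:E * (f w)%:E)%E)//; exact: integrableZl.
have yg : Int (fun w => y * g w).
  by rewrite /Int (_ : _ \o _ = fun w => (y%:E * (g w)%:E)%E)//; exact: integrableZl.
split; last by rewrite /mean RintegralD// !RintegralZl.
rewrite /Int (_ : _ \o _ = fun w => ((x * f w)%:E + (y * g w)%:E)%E)//.
exact: integrableD.
Qed.

Lemma le_mean f g : Int f -> Int g -> (forall w, f w <= g w) -> mean f <= mean g.
Proof. by move=> fi gi fg; apply: le_Rintegral. Qed.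

(** Products of four such variables are integrable, which is what variances of
    products require. *)
Definition L4 f := measurable_fun setT f /\ Int (fun w => f w ^+ 4).

Lemma prod4_le (x y z t : R) : `|x * y * z * t| <= x ^+ 4 + y ^+ 4 + z ^+ 4 + t ^+ 4.
Proof.
have sq (u v : R) : `|u * v| <= (u ^+ 2 + v ^+ 2) / 2.
  have := sqr_ge0 (`|u| - `|v|); rewrite sqrrB !real_normK ?num_real// normrM.
  by rewrite -mulr_natl => h; lra.
have := sq (x * y) (z * t); rewrite mulrA => /le_trans; apply.
have h2 (u v : R) : (u * v) ^+ 2 <= (u ^+ 4 + v ^+ 4) / 2.
  have := sqr_ge0 (u ^+ 2 - v ^+ 2).
  rewrite (_ : (u ^+ 2 - v ^+ 2) ^+ 2 = u ^+ 4 + v ^+ 4 - 2 * (u * v) ^+ 2); last by ring.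
  by lra.
have hxy := h2 x y; have hzt := h2 z t.
have ge0 (u : R) : 0 <= u ^+ 4 by exact: exprn_even_ge0.
have := ge0 x; have := ge0 y; have := ge0 z; have := ge0 t; lra.
Qed.

Lemma L4_cst (r : R) : L4 (fun=> r).
Proof. by split => //; exact: finite_measure_integrable_cst. Qed.

Lemma L4_int4 a b c e : L4 a -> L4 b -> L4 c -> L4 e ->
  Int (fun w => a w * b w * c w * e w).
Proof.
move=> [ma ia] [mb ib] [mc ic] [me ie].
pose g w := a w ^+ 4 + b w ^+ 4 + c w ^+ 4 + e w ^+ 4.
have ig : Int g.
  rewrite /Int (_ : _ \o _ = (fun w => (a w ^+ 4)%:E + (b w ^+ 4)%:E + (c w ^+ 4)%:E
    + (e w ^+ 4)%:E)%E)//.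
  by do 3 apply: integrableD => //.
apply: le_integrable ig => //.
  by apply/measurable_EFinP; do 3 apply: measurable_funM => //.
by move=> w _; rewrite /= lee_fin (le_trans (prod4_le _ _ _ _))// ler_norm.
Qed.

Lemma L4_int2 a b : L4 a -> L4 b -> Int (fun w => a w * b w).
Proof.
move=> la lb; have := L4_int4 la lb (L4_cst 1) (L4_cst 1).
by congr (Int _); apply/funext => w; rewrite !mulr1.
Qed.

Lemma L4_int a : L4 a -> Int a.
Proof.
move=> la; have := L4_int2 la (L4_cst 1).
by congr (Int _); apply/funext => w; rewrite mulr1.
Qed.

Lemma L4_lin (x y : R) f g : L4 f -> L4 g -> L4 (fun w => x * f w + y * g w).
Proof.
move=> lf lg; have [mf _] := lf; have [mg _] := lg.
split; first by apply: measurable_funD; exact: measurable_funM.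
rewrite (_ : (fun w => _) = (fun w => 1 * (1 * (x ^+ 4 * (f w * f w * f w * f w) +
    (4 * x ^+ 3 * y) * (f w * f w * f w * g w)) +
    1 * ((6 * x ^+ 2 * y ^+ 2) * (f w * f w * g w * g w) +
    (4 * x * y ^+ 3) * (f w * g w * g w * g w))) +
    y ^+ 4 * (g w * g w * g w * g w))); last first.
  by apply/funext => w; ring.
have L := L4_int4.
have il x' y' f' g' fi gi := (@mean_lin x' y' f' g' fi gi).1.
apply: (il 1 (y ^+ 4)); last exact: L.
by apply: (il 1 1); apply: il; exact: L.
Qed.

Lemma mean_linl (x y : R) f g h : L4 f -> L4 g -> L4 h ->
  mean (fun w => (x * f w + y * g w) * h w) =
  x * mean (fun w => f w * h w) + y * mean (fun w => g w * h w).
Proof.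
move=> lf lg lh; rewrite -(mean_lin x y (L4_int2 lf lh) (L4_int2 lg lh)).2.
by congr mean; apply/funext => w; ring.
Qed.

Lemma mean_linr (x y : R) f g h : L4 f -> L4 g -> L4 h ->
  mean (fun w => h w * (x * f w + y * g w)) =
  x * mean (fun w => h w * f w) + y * mean (fun w => h w * g w).
Proof.
move=> lf lg lh; rewrite -(mean_lin x y (L4_int2 lh lf) (L4_int2 lh lg)).2.
by congr mean; apply/funext => w; ring.
Qed.

Lemma meanC f g : mean (fun w => f w * g w) = mean (fun w => g w * f w).
Proof. by congr mean; apply/funext => w; rewrite mulrC. Qed.

(** Both sides are linear in each variable; this is how the formula is
    transferred from a Gaussian process to its linear functionals. *)
Definition isserlis a b c e : Prop :=
  mean (fun w => a w * b w * c w * e w) =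
  mean (fun w => a w * b w) * mean (fun w => c w * e w) +
  mean (fun w => a w * c w) * mean (fun w => b w * e w) +
  mean (fun w => a w * e w) * mean (fun w => b w * c w).

Lemma isserlis_rot a b c e : isserlis a b c e -> isserlis b c e a.
Proof.
rewrite /isserlis => h.
rewrite (_ : mean (fun w => b w * c w * e w * a w) = mean (fun w => a w * b w * c w * e w)).
  rewrite h (meanC e a) (meanC c a) (meanC b a); ring.
by congr mean; apply/funext => w; ring.
Qed.

Lemma isserlis_lin (x y : R) f g b c e : L4 f -> L4 g -> L4 b -> L4 c -> L4 e ->
  isserlis f b c e -> isserlis g b c e ->
  isserlis (fun w => x * f w + y * g w) b c e.
Proof.
move=> lf lg lb lc le hf hg; rewrite /isserlis !mean_linl//.
rewrite (_ : mean _ = x * mean (fun w => f w * b w * c w * e w) +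
  y * mean (fun w => g w * b w * c w * e w)).
  rewrite hf hg; ring.
rewrite -(mean_lin x y (L4_int4 lf lb lc le) (L4_int4 lg lb lc le)).2.
by congr mean; apply/funext => w; ring.
Qed.

(** If the formula passes from [C] to [C'] in its first variable, then it passes
    in all four: the cyclic symmetry brings each variable to the front. *)
Lemma isserlis_extend (C C' : (T -> R) -> Prop) :
  (forall f, C f -> L4 f) -> (forall f, C' f -> L4 f) ->
  (forall f b c e, C' f -> L4 b -> L4 c -> L4 e ->
     (forall g, C g -> isserlis g b c e) -> isserlis f b c e) ->
  (forall a b c e, C a -> C b -> C c -> C e -> isserlis a b c e) ->
  forall a b c e, C' a -> C' b -> C' c -> C' e -> isserlis a b c e.
Proof.
move=> CL CL' step h0.
have h1 a b c e : C' a -> C b -> C c -> C e -> isserlis a b c e.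
  by move=> Ca /[dup] Cb /CL ? /[dup] Cc /CL ? /[dup] Ce /CL ?;
    apply: step => // g Cg; exact: h0.
have h2 a b c e : C' a -> C' b -> C c -> C e -> isserlis a b c e.
  move=> /[dup] Ca /CL' ? Cb /[dup] Cc /CL ? /[dup] Ce /CL ?.
  by do 3 apply: isserlis_rot; apply: step => // g Cg; apply: isserlis_rot; exact: h1.
have h3 a b c e : C' a -> C' b -> C' c -> C e -> isserlis a b c e.
  move=> /[dup] Ca /CL' ? /[dup] Cb /CL' ? Cc /[dup] Ce /CL ?.
  by do 2 apply: isserlis_rot; apply: step => // g Cg; do 2 apply: isserlis_rot; exact: h2.
move=> a b c e /[dup] Ca /CL' ? /[dup] Cb /CL' ? /[dup] Cc /CL' ? Ce.
by apply: isserlis_rot; apply: step => // g Cg; do 3 apply: isserlis_rot; exact: h3.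
Qed.

(** The product of four numbers is a combination of the fourth powers of their
    eight signed sums, so fourth moments of linear combinations determine the
    mixed moment. *)
Lemma isserlis_polarization a b c e : L4 a -> L4 b -> L4 c -> L4 e ->
  (forall x y z t : R, let G w := x * a w + y * b w + z * c w + t * e w in
     mean (fun w => G w ^+ 4) = 3 * mean (fun w => G w ^+ 2) ^+ 2) ->
  isserlis a b c e.
Proof.
move=> la lb lc le hG.
pose G (x y z t : R) w := x * a w + y * b w + z * c w + t * e w.
have GE x y z t : G x y z t = fun w =>
    1 * (1 * (x * a w + y * b w) + z * c w) + t * e w.
  by apply/funext => w; rewrite /G; ring.
have lG x y z t : L4 (G x y z t) by rewrite GE; do 3 apply: L4_lin => //.
have iG x y z t : Int (fun w => G x y z t w ^+ 4) by exact: (lG _ _ _ _).2.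
have mG x y z t h : L4 h -> mean (fun w => G x y z t w * h w) =
    x * mean (fun w => a w * h w) + y * mean (fun w => b w * h w) +
    z * mean (fun w => c w * h w) + t * mean (fun w => e w * h w).
  move=> lh; have lab := L4_lin x y la lb; have labc := L4_lin 1 z lab lc.
  rewrite GE (mean_linl 1 t labc le lh) (mean_linl 1 z lab lc lh) (mean_linl x y la lb lh).
  by rewrite !mul1r.
have sG x y z t : mean (fun w => G x y z t w ^+ 2) =
    x ^+ 2 * mean (fun w => a w * a w) + y ^+ 2 * mean (fun w => b w * b w) +
    z ^+ 2 * mean (fun w => c w * c w) + t ^+ 2 * mean (fun w => e w * e w) +
    2 * x * y * mean (fun w => a w * b w) + 2 * x * z * mean (fun w => a w * c w) +
    2 * x * t * mean (fun w => a w * e w) + 2 * y * z * mean (fun w => b w * c w) +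
    2 * y * t * mean (fun w => b w * e w) + 2 * z * t * mean (fun w => c w * e w).
  rewrite (_ : mean _ = mean (fun w => G x y z t w * G x y z t w)).
    rewrite mG// !(meanC _ (G _ _ _ _)) !mG//.
    by rewrite (meanC b a) (meanC c a) (meanC c b) (meanC e a) (meanC e b) (meanC e c);
      ring.
  by congr mean; apply/funext => w; rewrite expr2.
have h4 x y z t := hG x y z t; rewrite /= in h4.
rewrite /isserlis.
(* Each signed sum contributes [4! = 24] times the product, up to the product of
   its signs; there are eight of them. *)
have : mean (fun w => 192 * (a w * b w * c w * e w) + 0 * (a w * b w * c w * e w)) =
   mean (fun w => 1 * (1 * (1 * G 1 1 1 1 w ^+ 4 + 1 * G 1 1 (-1) (-1) w ^+ 4) +
                       1 * (1 * G 1 (-1) 1 (-1) w ^+ 4 + 1 * G 1 (-1) (-1) 1 w ^+ 4)) +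
                 1 * (1 * ((-1) * G 1 (-1) 1 1 w ^+ 4 + (-1) * G 1 1 (-1) 1 w ^+ 4) +
                      1 * ((-1) * G 1 1 1 (-1) w ^+ 4 + (-1) * G 1 (-1) (-1) (-1) w ^+ 4))).
  by congr mean; apply/funext => w; rewrite /G; ring.
have il x y f g fi gi := (@mean_lin x y f g fi gi).1.
rewrite (mean_lin _ _ (L4_int4 la lb lc le) (L4_int4 la lb lc le)).2.
rewrite (mean_lin _ _ (il _ _ _ _ (il _ _ _ _ (iG _ _ _ _) (iG _ _ _ _))
   (il _ _ _ _ (iG _ _ _ _) (iG _ _ _ _))) (il _ _ _ _ (il _ _ _ _ (iG _ _ _ _) (iG _ _ _ _))
   (il _ _ _ _ (iG _ _ _ _) (iG _ _ _ _)))).2.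
rewrite (mean_lin _ _ (il _ _ _ _ (iG _ _ _ _) (iG _ _ _ _))
   (il _ _ _ _ (iG _ _ _ _) (iG _ _ _ _))).2.
rewrite (mean_lin _ _ (il _ _ _ _ (iG _ _ _ _) (iG _ _ _ _))
   (il _ _ _ _ (iG _ _ _ _) (iG _ _ _ _))).2.
rewrite !(mean_lin _ _ (iG _ _ _ _) (iG _ _ _ _)).2.
rewrite !h4 !sG => h192.
set X := mean _ in h192 *.
have -> : X = 192^-1 * (192 * X + 0 * X) by field.
by rewrite h192; field.
Qed.

End fourth_moments.

(** * Averages of a process *)

(** By continuity [X] is the limit of its discretizations in the first variable,
    which glue countably many measurable functions. *)
Lemma measurable_caratheodory d (T : measurableType d) (R : realType)
    (X : R -> T -> R) :
  (forall u, measurable_fun setT (X u)) -> (forall w, continuous (X ^~ w)) ->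
  measurable_fun setT (fun p : R * T => X p.1 p.2).
Proof.
move=> mX cX.
pose r (n : nat) (u : R) : int := Num.floor (n.+1%:R * u).
pose f n (p : R * T) := X ((r n p.1)%:~R / n.+1%:R) p.2.
apply: (@measurable_fun_cvg _ _ _ _ f) => [n|[u w] _].
  move=> _ Y mY; rewrite setTI.
  rewrite (_ : f n @^-1` Y = \bigcup_k (((fun p : R * T => n.+1%:R * p.1) @^-1`
      [set` `[k%:~R, (k + 1)%:~R[]) `&` (X (k%:~R / n.+1%:R) \o snd) @^-1` Y)); last first.
    apply/seteqP; split => [[u w]/= Yfn|[u w] [k _ /= [uk Yk]]].
      exists (r n u) => //; split => //=.
      by rewrite in_itv/= /r; exact: floor_itv.
    rewrite /f /= /r (_ : Num.floor _ = k)//; apply: floor_def.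
    by move: uk; rewrite in_itv.
  apply: countable_bigcupT_measurable => // k; apply: measurableI.
    rewrite -[X in measurable X]setTI.
    have mm : measurable_fun setT (fun p : R * T => n.+1%:R * p.1).
      by apply: measurable_funM.
    exact: mm.
  rewrite -[X in measurable X]setTI.
  have mm : measurable_fun setT (X (k%:~R / n.+1%:R) \o (@snd R T)).
    exact: measurableT_comp.
  exact: mm.
apply: (@cvg_comp _ _ _ (fun n => (r n u)%:~R / n.+1%:R) (X ^~ w) _ (nbhs u)); last exact: cX.
apply/cvgrPdist_le => e e0; near=> n.
have n0 : 0 < n.+1%:R :> R by rewrite ltr0n.
have /andP[h1 h2] : (r n u)%:~R <= n.+1%:R * u < (r n u + 1)%:~R by exact: floor_itv.
rewrite intrD in h2.
have -> : u - (r n u)%:~R / n.+1%:R = (n.+1%:R * u - (r n u)%:~R) * n.+1%:R^-1.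
  by field; rewrite gt_eqF.
rewrite ger0_norm; last by rewrite mulr_ge0// ?invr_ge0// subr_ge0.
apply: (@le_trans _ _ (1 * n.+1%:R^-1)).
  by rewrite ler_wpM2r ?invr_ge0// lerBlDr addrC ltW.
rewrite mul1r; near: n.
by apply: filterS (near_infty_natSinv_lt (PosNum e0)) => n /= /ltW.
Unshelve. all: by end_near. Qed.

(** A fourth power lies above its tangent at the mean. Without integrability the
    left-hand side is [0] or the right-hand side is [+oo]. *)
Lemma jensen4 dS (S : measurableType dS) (R : realType) (mu : probability S R)
    (f : S -> R) : measurable_fun setT f ->
  (((\int[mu]_u f u) ^+ 4)%:E <= \int[mu]_u (f u ^+ 4)%:E)%E.
Proof.
move=> mf; have f40 u : 0 <= f u ^+ 4 by exact: exprn_even_ge0.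
have I0 : (0 <= \int[mu]_u (f u ^+ 4)%:E)%E by apply: integral_ge0 => u _; rewrite lee_fin.
have [If|] := boolP (mu.-integrable setT (EFin \o f)); last first.
  move=> nIf; suff -> : \int[mu]_u f u = 0 by rewrite expr0n.
  have h : ~~ ((\int[mu]_u (f u)%:E)%E \is a fin_num).
    apply: contra nIf => h; apply/integrableP; split; first exact/measurable_EFinP.
    by rewrite (integral_fin_num_abs mu measurableT mf).
  by rewrite /Rintegral; case: (\int[mu]_u (f u)%:E)%E h.
have [If4|] := boolP (mu.-integrable setT (fun u => (f u ^+ 4)%:E)); last first.
  move=> nIf; suff -> : (\int[mu]_u (f u ^+ 4)%:E = +oo)%E by rewrite leey.
  apply/eqP; rewrite -leye_eq leNgt; apply: contra nIf => h.
  apply/integrableP; split; first by apply/measurable_EFinP; exact: measurable_funX.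
  by under eq_integral do rewrite /= ger0_norm//.
pose m := \int[mu]_u f u.
have If2 := (mean_lin (P := mu) (4 * m ^+ 3) (m ^+ 4 - 4 * m ^+ 3 * m) If
   (finite_measure_integrable_cst mu 1 measurableT)).
rewrite -[leRHS]fineK; last exact: integrable_fin_num.
rewrite lee_fin -[leRHS]/(mean mu (fun u => f u ^+ 4)).
rewrite (_ : _ ^+ 4 = mean mu (fun u => 4 * m ^+ 3 * f u + (m ^+ 4 - 4 * m ^+ 3 * m) * 1)); last first.
  transitivity (4 * m ^+ 3 * m + (m ^+ 4 - 4 * m ^+ 3 * m) * 1); last first.
    by rewrite If2.2 mean_cst.
  by rewrite -/m; ring.
apply: le_mean => //; first exact: If2.1.
move=> u; rewrite -subr_ge0.
rewrite (_ : _ - _ = (f u - m) ^+ 2 * ((f u + m) ^+ 2 + 2 * m ^+ 2)); last by ring.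
by rewrite mulr_ge0 ?sqr_ge0// addr_ge0 ?sqr_ge0// mulr_ge0 ?sqr_ge0.
Qed.

Section averaging.
Context dS (S : measurableType dS) d (T : measurableType d) (R : realType).
Variables (mu : probability S R) (P : probability T R) (X : S -> T -> R).
Hypothesis mX : measurable_fun setT (fun p : S * T => X p.1 p.2).
Hypothesis LX : forall u, L4 P (X u).
Hypothesis iX : (\int[mu]_u \int[P]_w (X u w ^+ 4)%:E < +oo)%E.

Definition average (w : T) := \int[mu]_u X u w.

Let int_prod b c e : L4 P b -> L4 P c -> L4 P e ->
  (mu \x P)%E.-integrable setT
    (fun p : S * T => (X p.1 p.2 * b p.2 * c p.2 * e p.2)%:E).
Proof.
move=> lb lc le; have [mb ib] := lb; have [mc ic] := lc; have [me ie] := le.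
have m2 (f : T -> R) : measurable_fun setT f -> measurable_fun setT (fun p : S * T => f p.2).
  by move=> mf; exact: measurableT_comp.
have mf : measurable_fun setT (fun p : S * T => (X p.1 p.2 * b p.2 * c p.2 * e p.2)%:E).
  by apply/measurable_EFinP; do 3 (apply: measurable_funM; last exact: m2).
have mX4 : measurable_fun setT (fun p : S * T => (X p.1 p.2 ^+ 4)%:E).
  by apply/measurable_EFinP; exact: measurable_funX.
have iX4 : (mu \x P)%E.-integrable setT (fun p : S * T => (X p.1 p.2 ^+ 4)%:E).
  apply/integrable12ltyP => //; apply: le_lt_trans iX.
  apply: ge0_le_integral => //.
  - by move=> u _; exact: integral_ge0.
  - apply: (measurable_fun_fubini_tonelli_F (fun p => `|(X p.1 p.2 ^+ 4)%:E|%E)) => //.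
    exact: measurableT_comp.
  - apply: (measurable_fun_fubini_tonelli_F (fun p => (X p.1 p.2 ^+ 4)%:E)) => //.
    by move=> p; rewrite lee_fin exprn_even_ge0.
  - move=> u _; rewrite le_eqVlt; apply/orP; left; apply/eqP; apply: eq_integral => w _.
    by rewrite /= ger0_norm// exprn_even_ge0.
have i4 (f : T -> R) : measurable_fun setT f -> P.-integrable setT (fun w => (f w ^+ 4)%:E) ->
    (mu \x P)%E.-integrable setT (fun p : S * T => (f p.2 ^+ 4)%:E).
  move=> mf' If; apply/integrable21ltyP.
    by apply/measurable_EFinP; apply: measurable_funX; exact: m2.
  have /integrableP[_] := If; apply: le_lt_trans.
  apply: ge0_le_integral => //.
  - by move=> u _; exact: integral_ge0.
  - apply: (measurable_fun_fubini_tonelli_G (fun p : S * T => `|(f p.2 ^+ 4)%:E|%E)) => //.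
    apply: measurableT_comp => //; apply/measurable_EFinP.
    by apply: measurable_funX; exact: m2.
  - apply: measurableT_comp => //; apply/measurable_EFinP.
    exact: measurable_funX.
  - move=> w _; rewrite -[leLHS]/(\int[mu]_u cst `|(f w ^+ 4)%:E| u)%E.
    by rewrite integral_cst//= probability_setT mule1.
pose g (p : S * T) := ((X p.1 p.2 ^+ 4)%:E + (b p.2 ^+ 4)%:E + (c p.2 ^+ 4)%:E + (e p.2 ^+ 4)%:E)%E.
have ig : (mu \x P)%E.-integrable setT g.
  by apply: integrableD => //; [apply: integrableD => //; [apply: integrableD => //|]|];
    exact: i4.
apply: le_integrable ig => // p _.
rewrite /g -!EFinD /= lee_fin (le_trans (prod4_le _ _ _ _))//.
exact: ler_norm.
Qed.

Let one4 := L4_cst P 1.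

Let intX : (mu \x P)%E.-integrable setT (fun p : S * T => (X p.1 p.2)%:E).
Proof.
have := int_prod one4 one4 one4; congr (_.-integrable _ _).
by apply/funext => p; rewrite !mulr1.
Qed.

Lemma measurable_average : measurable_fun setT average.
Proof.
by apply: measurableT_comp => //; exact: (measurable_fubini_G intX).
Qed.

Lemma L4_average : L4 P average.
Proof.
split; first exact: measurable_average.
have mX4 : measurable_fun setT (fun p : S * T => (X p.1 p.2 ^+ 4)%:E).
  by apply/measurable_EFinP; exact: measurable_funX.
have X40 (p : S * T) : (0 <= (X p.1 p.2 ^+ 4)%:E)%E by rewrite lee_fin exprn_even_ge0.
apply/integrableP; split.
  by apply/measurable_EFinP/measurable_funX; exact: measurable_average.
move: iX; rewrite (fubini_tonelli (fun p : S * T => (X p.1 p.2 ^+ 4)%:E))//.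
apply: le_lt_trans; apply: ge0_le_integral => //.
- apply: measurableT_comp => //.
  by apply/measurable_EFinP/measurable_funX; exact: measurable_average.
- exact: (measurable_fun_fubini_tonelli_G (fun p : S * T => (X p.1 p.2 ^+ 4)%:E)).
move=> w _; rewrite /= ger0_norm ?exprn_even_ge0//; apply: jensen4.
exact: (measurableT_comp mX (measurable_pair2 w)).
Qed.

(** Fubini's theorem: the product is dominated by the sum of the fourth powers. *)
Lemma mean_average b c e : L4 P b -> L4 P c -> L4 P e ->
  mu.-integrable setT (fun u => (mean P (fun w => X u w * b w * c w * e w))%:E) /\
  mean P (fun w => average w * b w * c w * e w) =
  \int[mu]_u mean P (fun w => X u w * b w * c w * e w).
Proof.
move=> lb lc le; have imf := int_prod lb lc le.
have EX u : ((mean P (fun w => X u w * b w * c w * e w))%:E =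
    \int[P]_w (X u w * b w * c w * e w)%:E)%E.
  rewrite /mean /Rintegral fineK//; apply: integrable_fin_num => //.
  exact: L4_int4.
have iF := integrable_fubini_F imf.
split; first by under eq_fun do rewrite EX.
rewrite /Rintegral; under [in RHS]eq_integral do rewrite EX.
rewrite (Fubini imf)/=; congr fine.
have [ml _] := L4_average.
apply: ae_eq_integral => //.
- have [mb _] := lb; have [mc _] := lc; have [me _] := le.
  by apply/measurable_EFinP; do 3 apply: measurable_funM => //.
- exact: (measurable_fubini_G imf).
have := ae_integrable2 intX; apply: filterS => w iw _ /=.
have -> : (\int[mu]_u (X u w * b w * c w * e w)%:E =
    \int[mu]_u ((b w * c w * e w)%:E * (X u w)%:E))%E.
  by apply: eq_integral => u _; rewrite -EFinM; congr EFin; ring.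
rewrite integralZl// /average /Rintegral -!mulrA mulrC EFinM fineK//.
exact: integrable_fin_num.
Qed.

Lemma mean_average2 f : L4 P f ->
  mu.-integrable setT (fun u => (mean P (fun w => X u w * f w))%:E) /\
  mean P (fun w => average w * f w) = \int[mu]_u mean P (fun w => X u w * f w).
Proof.
move=> lf; have [h1 h2] := mean_average lf one4 one4; split.
  move: h1; congr (_.-integrable _ _); apply/funext => u; congr (mean _ _)%:E.
  by apply/funext => w; rewrite !mulr1.
transitivity (mean P (fun w => average w * f w * 1 * 1)).
  by congr mean; apply/funext => w; rewrite !mulr1.
rewrite h2; apply: eq_Rintegral => u _; congr mean.
by apply/funext => w; rewrite !mulr1.
Qed.

(** Both sides of the formula are linear in the first variable, so they commute
    with averaging. *)
Lemma isserlis_average b c e : L4 P b -> L4 P c -> L4 P e ->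
  (forall u, isserlis P (X u) b c e) -> isserlis P average b c e.
Proof.
move=> lb lc le h; rewrite /isserlis (mean_average lb lc le).2.
have [ib ->] := mean_average2 lb; have [ic ->] := mean_average2 lc; have [ie ->] := mean_average2 le.
under eq_Rintegral do rewrite h.
have iz (f : S -> R) (x : R) : mu.-integrable setT (EFin \o f) ->
    mu.-integrable setT (EFin \o (fun u => f u * x)).
  move=> If; rewrite (_ : _ \o _ = fun u => (x%:E * (f u)%:E)%E).
    exact: integrableZl.
  by apply/funext => u /=; rewrite -EFinM mulrC.
have ibz := iz _ (mean P (fun w => c w * e w)) ib.
have icz := iz _ (mean P (fun w => b w * e w)) ic.
have iez := iz _ (mean P (fun w => b w * c w)) ie.
rewrite RintegralD//; last first.
  by rewrite (_ : _ \o _ = fun u => ((mean P (fun w => X u w * b w) * mean P (fun w => c w * e w))%:E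
    + (mean P (fun w => X u w * c w) * mean P (fun w => b w * e w))%:E)%E)//; exact: integrableD.
by rewrite RintegralD// !RintegralZr.
Qed.

End averaging.

(** * Ornstein-Uhlenbeck averages of increments *)

Section ornstein_uhlenbeck.
Context d (T : measurableType d) (R : realType) (P : probability T R).
Local Notation E := (mean P).

(** Continuity of the paths gives joint measurability, and the polynomial growth
    makes the exponential averages of the process converge. *)
Record regular_process (X : R -> T -> R) : Prop := RegularProcess {
  regular_L4 : forall t, L4 P (X t);
  regular_continuous : forall w, continuous (X ^~ w);
  regular_growth : exists C : R, forall t, E (fun w => X t w ^+ 4) <= C * (1 + `|t|) ^+ 4
}.

Section one_process.
Variables (a nu : R) (a0 : 0 < a) (X : R -> T -> R).
Hypothesis rX : regular_process X.
Notation mu := (explaw a0).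
Let past t (u : R) := X (t - u).

Let mX t : measurable_fun setT (X t). Proof. by case: (regular_L4 rX t). Qed.

Lemma continuous_past t w : continuous (fun u => X (t - u) w).
Proof.
move=> u; apply: (@cvg_comp _ _ _ (fun u => t - u) (X ^~ w) _ (nbhs (t - u))).
  by apply: cvgB; [exact: cvg_cst|exact: cvg_id].
exact: (regular_continuous rX).
Qed.

Let mpast t : measurable_fun setT (fun p : R * T => past t p.1 p.2).
Proof.
by apply: measurable_caratheodory => [u|w]; [exact: mX|exact: continuous_past].
Qed.

Let Lpast t u : L4 P (past t u). Proof. exact: (regular_L4 rX). Qed.

Let ipast t : (\int[mu]_u \int[P]_w (past t u w ^+ 4)%:E < +oo)%E.
Proof.
have [C hC] := regular_growth rX.
pose f u := E (fun w => past t u w ^+ 4).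
have fE u : (\int[P]_w (past t u w ^+ 4)%:E = (f u)%:E)%E.
  by rewrite /f /mean /Rintegral fineK//; apply: integrable_fin_num => //; case: (Lpast t u).
have f0 u : 0 <= f u by apply: Rintegral_ge0 => w _; exact: exprn_even_ge0.
have mf : measurable_fun setT f.
  apply/measurable_EFinP.
  rewrite (_ : _ \o _ = fun u => (\int[P]_w (past t u w ^+ 4)%:E)%E); last first.
    by apply/funext => u; rewrite fE.
  apply: (measurable_fun_fubini_tonelli_F (fun p : R * T => (past t p.1 p.2 ^+ 4)%:E)).
    by apply/measurable_EFinP; exact: measurable_funX.
  by move=> p; rewrite lee_fin exprn_even_ge0.
under eq_integral do rewrite fE.
have : mu.-integrable setT (EFin \o f).
  apply: (@integrable_explaw_poly _ _ a0 (C * (1 + `|t|) ^+ 4)) => // u u0.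
  rewrite ger0_norm// (le_trans (hC _))// -mulrA -exprMn.
  have C0 : 0 <= C.
    have := le_trans (f0 t) (hC _); rewrite subrr normr0 addr0 expr1n mulr1; exact.
  rewrite ler_wpM2l// lerXn2r ?nnegrE ?mulr_ge0 ?addr_ge0//.
  apply: (@le_trans _ _ (1 + (`|t| + u))).
    by rewrite lerD2l (le_trans (ler_normB _ _))// [`|u|]ger0_norm.
  rewrite -subr_ge0 (_ : _ - _ = `|t| * u); last by ring.
  by rewrite mulr_ge0.
move/integrableP => [_]; congr (_ < _)%E.
by apply: eq_integral => u _; rewrite /= ger0_norm.
Qed.

(** The process [fOU], with its integral read as an average over the past. *)
Definition ou (t : R) (w : T) : R := nu * (X t w - average mu (past t) w).

Lemma fOU_ou : fOU a nu X = ou.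
Proof.
apply/funext => t; apply/funext => w; rewrite /fOU /ou Rintegral_explaw_reflect//.
by apply: continuous_measurable_fun; exact: (regular_continuous rX).
Qed.

Let Laverage t : L4 P (average mu (past t)).
Proof. exact: (@L4_average _ (measurableTypeR R) _ T R mu P (past t) (mpast t) (ipast t)). Qed.

Let ouE t : ou t = fun w => nu * X t w + - nu * average mu (past t) w.
Proof. by apply/funext => w; rewrite /ou mulrBr mulNr. Qed.

Lemma L4_ou t : L4 P (ou t).
Proof. by rewrite ouE; apply: L4_lin; [exact: regular_L4|exact: Laverage]. Qed.

Lemma isserlis_ou t b c e : L4 P b -> L4 P c -> L4 P e ->
  (forall u, isserlis P (X u) b c e) -> isserlis P (ou t) b c e.
Proof.
move=> lb lc le h; rewrite ouE; apply: isserlis_lin => //.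
- exact: regular_L4.
- by apply: (@isserlis_average _ (measurableTypeR R) _ T R mu P (past t) (mpast t) (Lpast t) (ipast t)) => // u; exact: h.
Qed.

(** The weights of the kernel have total mass one, so the process is an average
    of increments of [X]; covariances of increments do not see the individual
    variances of [X]. *)
Lemma mean_ou t b : L4 P b ->
  mu.-integrable setT (fun u => (E (fun w => (X t w - X (t - u) w) * b w))%:E) /\
  E (fun w => ou t w * b w) = nu * \int[mu]_u E (fun w => (X t w - X (t - u) w) * b w).
Proof.
move=> lb.
have [h1 h2] := @mean_average2 _ (measurableTypeR R) _ T R mu P (past t) (mpast t) (Lpast t)
  (ipast t) _ lb.
have eB u : E (fun w => (X t w - X (t - u) w) * b w) =
    E (fun w => X t w * b w) * 1 - E (fun w => past t u w * b w).
  rewrite (_ : (fun w => _) = (fun w => (1 * X t w + (-1) * past t u w) * b w)).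
    rewrite mean_linl//; first by rewrite mul1r mulr1 mulN1r.
    exact: regular_L4.
  by apply/funext => w; rewrite mul1r mulN1r.
have i1 : mu.-integrable setT (EFin \o (fun=> E (fun w => X t w * b w) * 1)).
  exact: finite_measure_integrable_cst.
split.
  under eq_fun do rewrite eB.
  by rewrite (_ : (fun _ => _) = fun u => ((E (fun w => X t w * b w) * 1)%:E -
    (E (fun w => past t u w * b w))%:E)%E)//; exact: integrableB.
under eq_Rintegral do rewrite eB.
rewrite RintegralB// -h2 -/(mean mu _) mean_cst mulr1 ouE.
rewrite mean_linl//; last exact: regular_L4.
by rewrite mulrBr mulNr.
Qed.

End one_process.

(** Second difference with steps [u] and [- v]: the covariance of two
    increments of lengths [u] and [v] at distance [x]. *)
Definition second_diff (g : R -> R) (x u v : R) : R :=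
  g (x + u) + g (x - v) - g x - g (x - v + u).

Section two_processes.
Variables (a b nu1 nu2 : R) (a0 : 0 < a) (b0 : 0 < b) (X V : R -> T -> R).
Hypotheses (rX : regular_process X) (rV : regular_process V).
Variables (f h g : R -> R).
Hypothesis covXV : forall s t, E (fun w => X s w * V t w) = f s + h t - g (t - s).

Notation Y1 := (ou nu1 a0 X).
Notation Y2 := (ou nu2 b0 V).

Let LX s u : L4 P (fun w => X s w - X (s - u) w).
Proof.
rewrite (_ : (fun w => _) = fun w => 1 * X s w + (-1) * X (s - u) w).
  by apply: L4_lin; exact: regular_L4.
by apply/funext => w; rewrite mul1r mulN1r.
Qed.

Let LV s u : L4 P (fun w => V s w - V (s - u) w).
Proof.
rewrite (_ : (fun w => _) = fun w => 1 * V s w + (-1) * V (s - u) w).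
  by apply: L4_lin; exact: regular_L4.
by apply/funext => w; rewrite mul1r mulN1r.
Qed.

Let cov_incr s t u v : E (fun w => (X s w - X (s - u) w) * (V t w - V (t - v) w)) =
  second_diff g (t - s) u v.
Proof.
have e1 (A : R -> T -> R) r z : (fun w => A r w - A z w) = fun w => 1 * A r w + (-1) * A z w.
  by apply/funext => w; rewrite mul1r mulN1r.
transitivity (E (fun w => (1 * X s w + (-1) * X (s - u) w) *
    (1 * V t w + (-1) * V (t - v) w))).
  by congr mean; apply/funext => w; rewrite !mul1r !mulN1r.
have rl := regular_L4.
rewrite mean_linl; [|exact: rl|exact: rl|by apply: L4_lin; exact: rl].
rewrite !mean_linr; try exact: rl.
rewrite !covXV /second_diff.
rewrite (_ : t - (s - u) = t - s + u); last by ring.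
rewrite (_ : t - v - s = t - s - v); last by ring.
rewrite (_ : t - v - (s - u) = t - s - v + u); last by ring.
by ring.
Qed.

Let inner s t u : E (fun w => (X s w - X (s - u) w) * Y2 t w) =
  nu2 * \int[explaw b0]_v second_diff g (t - s) u v.
Proof.
rewrite meanC (mean_ou nu2 b0 rV t (LX s u)).2; congr (_ * _).
by apply: eq_Rintegral => v _; rewrite meanC cov_incr.
Qed.

Lemma mean_ou_ou s t : E (fun w => Y1 s w * Y2 t w) =
  nu1 * \int[explaw a0]_u (nu2 * \int[explaw b0]_v second_diff g (t - s) u v).
Proof.
rewrite (mean_ou nu1 a0 rX s (L4_ou nu2 b0 rV t)).2; congr (_ * _).
by apply: eq_Rintegral => u _; exact: inner.
Qed.

(** In covariances of increments the terms [f s] and [h t] cancel, and only the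
    lag remains. *)
Lemma mean_ou_stationary s t s' t' : t - s = t' - s' ->
  E (fun w => Y1 s w * Y2 t w) = E (fun w => Y1 s' w * Y2 t' w).
Proof. by move=> st; rewrite !mean_ou_ou st. Qed.

Hypothesis varX : exists C, forall s u,
  E (fun w => (X s w - X (s - u) w) ^+ 2) <= C * (1 + `|u|) ^+ 4.
Hypothesis varV : exists C, forall s u,
  E (fun w => (V s w - V (s - u) w) ^+ 2) <= C * (1 + `|u|) ^+ 4.

(** Dominated convergence in the two exponential times: a covariance of increments
    is bounded by their variances, which grow polynomially with their lengths. *)
Lemma mean_ou_decay (x : nat -> R) :
  (forall u v, second_diff g (x n) u v @[n --> \oo] --> (0 : R)) ->
  E (fun w => Y1 0 w * Y2 (x n) w) @[n --> \oo] --> (0 : R).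
Proof.
move=> x0; have [C hC] := varX; have [D hD] := varV.
have bound s u v : `|second_diff g s u v| <= C * (1 + `|u|) ^+ 4 + D * (1 + `|v|) ^+ 4.
  rewrite -(subr0 s) -cov_incr.
  have iXV := L4_int2 (LX 0 u) (LV s v).
  apply: le_trans (le_normr_Rintegral measurableT iXV) _.
  have iX := L4_int2 (LX 0 u) (LX 0 u); have iV := L4_int2 (LV s v) (LV s v).
  have [i2 e2] := mean_lin 1 1 iX iV.
  apply: (@le_trans _ _ (E (fun w => 1 * ((X 0 w - X (0 - u) w) * (X 0 w - X (0 - u) w)) +
       1 * ((V s w - V (s - v) w) * (V s w - V (s - v) w))))).
    apply: le_mean => //.
      have := iXV => /integrable_norm; exact.
    move=> w; rewrite !mul1r -!expr2.
    move: (X 0 w - _) (V s w - _) => p q.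
    have := sqr_ge0 (`|p| - `|q|); have := sqr_ge0 p; have := sqr_ge0 q.
    rewrite normrM sqrrB !real_normK ?num_real// -mulr_natl => ? ? ?; lra.
  rewrite e2 !mul1r; apply: lerD.
    by apply: le_trans (hC 0 u); rewrite le_eqVlt; apply/orP; left; apply/eqP;
      congr mean; apply/funext => w; rewrite expr2.
  by apply: le_trans (hD s v); rewrite le_eqVlt; apply/orP; left; apply/eqP;
    congr mean; apply/funext => w; rewrite expr2.
have C0 : 0 <= C.
  have := le_trans (Rintegral_ge0 _ _) (hC 0 0); rewrite normr0 addr0 expr1n mulr1; apply.
  by move=> w _; exact: sqr_ge0.
have D0 : 0 <= D.
  have := le_trans (Rintegral_ge0 _ _) (hD 0 0); rewrite normr0 addr0 expr1n mulr1; apply.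
  by move=> w _; exact: sqr_ge0.
have poly_int (c : R) (c0 : 0 < c) (A B : R) : 0 <= A -> 0 <= B ->
    (explaw c0).-integrable setT (fun u => (A + B * (1 + `|u|) ^+ 4)%:E).
  move=> A0 B0; apply: (@integrable_explaw_poly _ _ c0 (A + B)).
    apply: measurable_funD => //; apply: measurable_funM => //.
    by apply: measurable_funX; apply: measurable_funD.
  move=> u u0; rewrite ger0_norm; last first.
    by rewrite addr_ge0// mulr_ge0// exprn_ge0// addr_ge0.
  rewrite (ger0_norm u0) mulrDl lerD2r ler_peMr// exprn_ege1// lerDl.
  by [].
have iD s u : (explaw b0).-integrable setT (EFin \o (fun v => second_diff g s u v)).
  have := (mean_ou nu2 b0 rV s (LX 0 u)).1.
  congr (_.-integrable _ _); apply/funext => v /=.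
  by rewrite meanC cov_incr subr0.
have iI s : (explaw a0).-integrable setT
    (EFin \o (fun u => nu2 * \int[explaw b0]_v second_diff g s u v)).
  have := (mean_ou nu1 a0 rX 0 (L4_ou nu2 b0 rV s)).1.
  congr (_.-integrable _ _); apply/funext => u /=.
  by rewrite inner subr0.
have cvgI u : nu2 * \int[explaw b0]_v second_diff g (x n) u v @[n --> \oo] --> (0 : R).
  rewrite -[X in _ --> X](mulr0 nu2); apply: cvgMr => //.
  have := @dominated_cvg _ _ _ (explaw b0) _ measurableT
    (fun n v => (second_diff g (x n) u v)%:E) (cst 0%E)
    (fun v => (C * (1 + `|u|) ^+ 4 + D * (1 + `|v|) ^+ 4)%:E).
  rewrite integral0 => /(_ _ _ _ _ _)/fine_cvg; apply.
  - by move=> n; case/integrableP: (iD (x n) u).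
  - by move=> v _; apply: cvg_EFin; [exact: nearW|exact: x0].
  - by move=> v _.
  - by apply: poly_int => //; rewrite mulr_ge0// exprn_ge0// addr_ge0.
  - by move=> n v _; rewrite lee_fin.
rewrite (_ : (fun n => _) = fun n => nu1 *
    \int[explaw a0]_u (nu2 * \int[explaw b0]_v second_diff g (x n) u v)); last first.
  by apply/funext => n; rewrite mean_ou_ou subr0.
rewrite -[X in _ --> X](mulr0 nu1); apply: cvgMr => //.
pose K := \int[explaw b0]_v (D * (1 + `|v|) ^+ 4).
have K0 : 0 <= K.
  by apply: Rintegral_ge0 => v _; rewrite mulr_ge0// exprn_ge0// addr_ge0.
have := @dominated_cvg _ _ _ (explaw a0) _ measurableT
  (fun n u => (nu2 * \int[explaw b0]_v second_diff g (x n) u v)%:E) (cst 0%E)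
  (fun u => (`|nu2| * K + `|nu2| * C * (1 + `|u|) ^+ 4)%:E).
rewrite integral0 => /(_ _ _ _ _ _)/fine_cvg; apply.
- by move=> n; case/integrableP: (iI (x n)).
- by move=> u _; apply: cvg_EFin; [exact: nearW|exact: cvgI].
- by move=> v _.
- by apply: poly_int; rewrite mulr_ge0.
- move=> n u _; rewrite lee_fin normrM -mulrA -mulrDr ler_wpM2l//.
  apply: le_trans (le_normr_Rintegral measurableT (iD (x n) u)) _.
  have ip0 : (explaw b0).-integrable setT (EFin \o (fun v : R => D * (1 + `|v|) ^+ 4)).
    have := poly_int b b0 0 D (lexx _) D0.
    by congr (_.-integrable _ _); apply/funext => v /=; rewrite add0r.
  have ic : (explaw b0).-integrable setT (EFin \o (fun=> C * (1 + `|u|) ^+ 4)).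
    exact: finite_measure_integrable_cst.
  have -> : K + C * (1 + `|u|) ^+ 4 =
      \int[explaw b0]_v (C * (1 + `|u|) ^+ 4 + D * (1 + `|v|) ^+ 4).
    by rewrite RintegralD// -/(mean (explaw b0) _) mean_cst addrC.
  apply: le_Rintegral => //.
    have := iD (x n) u => /integrable_norm; exact.
  by apply: poly_int => //; rewrite mulr_ge0// exprn_ge0// addr_ge0.
Qed.

End two_processes.

End ornstein_uhlenbeck.

(** * Second differences of powers *)

Section power_second_difference.
Context {R : realType}.

Lemma powR_cvgy0 (q : R) : q < 0 -> x `^ q @[x --> +oo%R] --> (0 : R).
Proof.
move=> q0; apply/cvgrPdist_le => e e0.
have [r r0 qr] : exists2 r : R, 0 < r & q = - r by exists (- q); rewrite ?oppr_gt0 ?opprK.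
have er : e = ((e^-1 `^ r^-1) `^ r)^-1.
  by rewrite -powRrM mulVf ?gt_eqF// powRr1 ?invrK// invr_ge0 ltW.
near=> x; have x0 : 0 < x by near: x; exact: nbhs_pinfty_gt.
rewrite sub0r normrN ger0_norm ?powR_ge0// qr powRN [leRHS]er.
rewrite lef_pV2 ?posrE ?powR_gt0 ?invr_gt0//.
apply: ge0_ler_powR; rewrite ?nnegrE ?powR_ge0 ?(ltW r0) ?(ltW x0)//.
Unshelve. all: by end_near. Qed.

Lemma mean_value_bound (F F' : R -> R) (m M : R) :
  (forall z : R, m < z -> is_derive z 1 F (F' z)) ->
  (forall z, m < z -> `|F' z| <= M) ->
  forall x y, m < x -> m < y -> `|F x - F y| <= M * `|x - y|.
Proof.
move=> dF bF.
have key x y : m < y -> y < x -> `|F x - F y| <= M * `|x - y|.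
  move=> my yx.
  have dz z : m < z -> derivable F z 1 by move=> mz; exact: (@ex_derive _ _ _ _ _ _ _ (dF z mz)).
  have dyx (z : R) : z \in `]y, x[ -> is_derive z 1 F (F' z).
    by rewrite in_itv/= => /andP[yz _]; apply: dF; exact: lt_trans yz.
  have cF : {within `[y, x], continuous F}.
    apply: derivable_within_continuous => z; rewrite in_itv/= => /andP[yz _].
    by apply: dz; exact: lt_le_trans yz.
  have [c cyx ->] := MVT yx dyx cF.
  rewrite normrM ler_wpM2r// bF//.
  by move: cyx; rewrite in_itv/= => /andP[yc _]; exact: lt_trans yc.
move=> x y mx my; have [xy|xy|->] := ltgtP x y.
- by rewrite distrC (distrC x) key.
- exact: key.
- by rewrite !subrr normr0 mulr0.
Qed.

Lemma is_derive_powR_shift (p u z : R) : 0 < z + u ->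
  is_derive z 1 (fun z => (z + u) `^ p) (p * (z + u) `^ (p - 1)).
Proof.
move=> zu0; have d1 := is_derive1_powR p zu0.
have d2 : is_derive z (1 : R) (fun z => z + u) 1 by apply: is_derive_eq; rewrite addr0.
have := @is_derive1_comp R (fun z => z `^ p) (fun z => z + u) z _ _ d1 d2.
by rewrite mulr1.
Qed.

(** Two applications of the mean value theorem show that second differences of
    [x `^ p] are of order [x `^ (p - 2)]. *)
Lemma second_diff_powR (p c : R) (g : R -> R) (u v : R) (x : nat -> R) :
  0 < p < 2 -> (forall y, 0 < y -> g y = c * y `^ p) ->
  x n @[n --> \oo] --> +oo%R ->
  second_diff g (x n) u v @[n --> \oo] --> (0 : R).
Proof.
move=> /andP[p0 p2] gE xy.
(* Every argument of [g], even at the intermediate points, exceeds [m n]. *)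
pose m n := x n - (`|u| + `|v| + 1).
pose B n := `|c| * (`|p * (p - 1)| * (m n) `^ (p - 2) * `|u| * `|v|).
have my : m n @[n --> \oo] --> +oo%R.
  apply/cvgryPge => A; near=> n; rewrite /m lerBrDr; near: n.
  by move/cvgryPge: xy; apply.
have B0 : B n @[n --> \oo] --> (0 : R).
  rewrite (_ : (0 : R) = `|c| * (`|p * (p - 1)| * 0 * `|u| * `|v|)); last by rewrite !(mulr0, mul0r).
  apply: cvgMr => //; apply: cvgMl => //; apply: cvgMl => //; apply: cvgMr => //.
  apply: (@cvg_comp _ _ _ m (fun z => z `^ (p - 2)) _ (pinfty_nbhs R)) => //.
  by apply: powR_cvgy0; rewrite subr_lt0.
have bound : \forall n \near \oo, `|second_diff g (x n) u v| <= B n.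
  near=> n.
  have m0 : 0 < m n by near: n; move/cvgryPgt: my; exact.
  set y := x n; rewrite /m -/y in m0.
  have u1 := ler_norm u; have v1 := ler_norm v.
  have u2 := ler_norm (- u); have v2 := ler_norm (- v); rewrite normrN in u2; rewrite normrN in v2.
  have nu0 := normr_ge0 u; have nv0 := normr_ge0 v.
  rewrite /second_diff !gE; [|lra|lra|lra|lra].
  rewrite (_ : _ - _ = c * (((y + u) `^ p - y `^ p) - ((y - v + u) `^ p - (y - v) `^ p))); last by ring.
  rewrite normrM /B ler_wpM2l//.
  pose psi z := (z + u) `^ p - z `^ p.
  pose dpsi z := p * (z + u) `^ (p - 1) - p * z `^ (p - 1).
  pose M := `|p * (p - 1)| * (m n) `^ (p - 2).
  have h2 (z t : R) : m n < z -> m n < t ->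
      `|p * z `^ (p - 1) - p * t `^ (p - 1)| <= M * `|z - t|.
    apply: (@mean_value_bound (fun z => p * z `^ (p - 1)) (fun z => p * ((p - 1) * z `^ (p - 2)))).
      move=> z' mz; have z0 : 0 < z' by rewrite (lt_trans m0).
      have -> : p - 2 = p - 1 - 1 by ring.
      exact: (is_deriveZ p (is_derive1_powR (p - 1) z0)).
    move=> z' mz; rewrite mulrA normrM ler_wpM2l// ger0_norm ?powR_ge0//.
    have z0 : 0 < z' by exact: lt_trans mz.
    rewrite (_ : p - 2 = - (2 - p)); last by ring.
    rewrite !powRN lef_pV2 ?posrE ?powR_gt0//.
    by rewrite ge0_ler_powR ?nnegrE ?(ltW z0) ?(ltW m0) ?(ltW mz)// subr_ge0 ltW.
  have := @mean_value_bound psi dpsi (y - `|v| - 1) (M * `|u|) _ _ y (y - v).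
  rewrite (_ : y - (y - v) = v); last by ring.
  apply.
  - move=> z mz; have z0 : 0 < z by lra.
    have zu0 : 0 < z + u by lra.
    exact: (is_deriveB (is_derive_powR_shift p zu0) (is_derive1_powR p z0)).
  - move=> z mz; rewrite /dpsi; apply: le_trans (h2 _ _ _ _) _.
    + rewrite /m -/y; lra.
    + rewrite /m -/y; lra.
    + by rewrite addrAC subrr add0r.
  - lra.
  - lra.
apply: (@squeeze_cvgr _ _ _ _ (fun n => - B n) B) => //; last first.
  by rewrite -[X in _ --> X]oppr0; exact: cvgN.
by apply: filterS bound => n; rewrite ler_norml.
Unshelve. all: by end_near. Qed.

End power_second_difference.

(** * The cross integrals *)

Section improper_ftc.
Context {R : realType}.
Notation leb := (@lebesgue_measure R).

(** Fundamental theorem of calculus for a nonnegative integrand that may be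
    singular at [0], where its antiderivative only has a right limit. *)
Lemma ge0_integral_FTC_singular (f F : R -> R) (u l : R) : 0 < u ->
  (forall x, 0 < x -> 0 <= f x) -> (forall x, 0 < x -> {for x, continuous f}) ->
  (forall x : R, 0 < x -> is_derive x 1 F (f x)) -> F x @[x --> 0^'+] --> l ->
  (\int[leb]_(x in `]0%R, u]) (f x)%:E = (F u - l)%:E)%E.
Proof.
move=> u0 f0 cf dF Fl.
pose e (n : nat) : R := u * n.+2%:R^-1.
have e0 n : 0 < e n by rewrite mulr_gt0// invr_gt0.
have eu n : e n < u by rewrite /e gtr_pMr// invf_lt1// ltr1n.
have e_cvg : e n @[n --> \oo] --> (0 : R).
  rewrite -[X in _ --> X](mulr0 u); apply: cvgMr => //.
  apply/cvgrPdist_lt => r r0; apply: filterS (near_infty_natSinv_lt (PosNum r0)) => n /=.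
  apply: le_lt_trans; rewrite sub0r normrN ger0_norm// lef_pV2 ?posrE//.
  by rewrite ler_nat.
have mf : measurable_fun (`]0, +oo[%classic : set R) f.
  apply: open_continuous_measurable_fun => // x; rewrite inE/= in_itv/= andbT.
  exact: cf.
have UE : \bigcup_n `[e n, u]%classic = `]0, u]%classic.
  apply/seteqP; split => x.
    move=> [n _] /=; rewrite !in_itv/= => /andP[h1 ->]; rewrite andbT.
    exact: lt_le_trans h1.
  move=> /=; rewrite in_itv/= => /andP[x0 xu].
  have : \forall n \near \oo, e n < x.
    by move/cvgrPdist_lt : e_cvg => /(_ x x0); apply: filterS => n;
      rewrite sub0r normrN gtr0_norm.
  move=> [n _ /(_ n (leqnn n))] enx; exists n => //=.
  by rewrite in_itv/= (ltW enx).
have sub n : `[e n, u]%classic `<=` `]0, +oo[%classic.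
  move=> x /=; rewrite !in_itv/= andbT => /andP[h1 _]; exact: lt_le_trans h1.
have cvg1 := @ge0_nondecreasing_set_cvg_integral _ (measurableTypeR R) R (fun n => `[e n, u]%classic)
  (EFin \o f) leb.
rewrite UE in cvg1.
have {}cvg1 : (\int[leb]_(x in `[e n, u]) (f x)%:E)%E @[n --> \oo] -->
    (\int[leb]_(x in `]0%R, u]) (f x)%:E)%E.
  apply: cvg1 => //.
  - move=> m n mn; apply/subsetPset => x /=; rewrite !in_itv/= => /andP[h1 ->].
    rewrite andbT (le_trans _ h1)// /e ler_pM2l// lef_pV2 ?posrE//.
    by rewrite ler_nat !ltnS.
  - by move=> n; apply/measurable_EFinP; apply: measurable_funS mf => //; exact: sub.
  - by move=> n x /sub/=; rewrite in_itv/= andbT => x0; rewrite lee_fin f0.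
have IE n : (\int[leb]_(x in `[e n, u]) (f x)%:E = (F u - F (e n))%:E)%E.
  have dx (x : R) : 0 < x -> derivable F x 1.
    by move=> x0; exact: (@ex_derive _ _ _ _ _ _ _ (dF x x0)).
  have cF (x : R) : 0 < x -> {for x, continuous F}.
    by move=> x0; apply: differentiable_continuous; apply/derivable1_diffP; exact: dx.
  rewrite (@continuous_FTC2 _ f F)//.
  - apply: continuous_in_subspaceT => x; rewrite inE => /sub/=.
    by rewrite in_itv/= andbT; exact: cf.
  - split.
    + by move=> x; rewrite in_itv/= => /andP[h1 _]; apply: dx; exact: lt_trans h1.
    + by apply: cvg_at_right_filter; apply: cF.
    + by apply: cvg_at_left_filter; apply: cF.
  - move=> x; rewrite in_itv/= => /andP[h1 _]; rewrite derive1E.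
    by rewrite (@derive_val _ _ _ _ _ _ _ (dF x (lt_trans (e0 n) h1))).
have cvg2 : (\int[leb]_(x in `[e n, u]) (f x)%:E)%E @[n --> \oo] --> (F u - l)%:E.
  rewrite (_ : (fun n => _) = fun n => (F u - F (e n))%:E); last exact/funext.
  apply: cvg_EFin; first exact: nearW.
  apply: cvgB; first exact: cvg_cst.
  by move/cvg_at_rightP : Fl; apply.
exact: (cvg_unique _ cvg1 cvg2).
Qed.

End improper_ftc.

Section power_kernel.
Context {R : realType} (H : R).
Hypothesis H02 : 0 < H < 2.
Hypothesis H1 : H != 1.
Notation leb := (@lebesgue_measure R).

Let H0 : 0 < H. Proof. by case/andP: H02. Qed.
Let Hn0 : H != 0. Proof. by rewrite gt_eqF. Qed.
Let Hm1 : H - 1 != 0. Proof. by rewrite subr_eq0. Qed.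

(** The factor [H * (H - 1)] makes this nonnegative in both regimes
    [H < 1] and [H > 1]. *)
Definition power_defect (u w : R) : R :=
  ((u + w) `^ H - u `^ H - w `^ H) / (H * (H - 1)).

Let q (x y : R) : R := (x + y) `^ (H - 2).

Let mq : measurable_fun setT (fun p : R * R => q p.1 p.2).
Proof.
by apply: (measurableT_comp (measurable_powR (H - 2))); exact: measurable_funD.
Qed.

Let mqx x : measurable_fun setT (q x).
Proof. exact: (measurableT_comp mq (measurable_pair1 x)). Qed.

Let powR_quot_ge0 (x w : R) : 0 < x -> 0 <= w ->
  0 <= ((x + w) `^ (H - 1) - x `^ (H - 1)) / (H - 1).
Proof.
move=> x0 w0; have xw : x <= x + w by rewrite lerDl.
have xw0 : 0 < x + w by rewrite ltr_pwDl.
have [h|h] := ltP 0 (H - 1).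
  by rewrite divr_ge0 ?(ltW h)// subr_ge0 ge0_ler_powR// ?nnegrE ltW.
rewrite mulr_le0// ?invr_le0// subr_le0.
rewrite (_ : H - 1 = - (1 - H)); last by ring.
rewrite !powRN lef_pV2 ?posrE ?powR_gt0//.
have h' : 0 <= 1 - H by rewrite -opprB oppr_ge0.
by apply: ge0_ler_powR => //; rewrite nnegrE ltW.
Qed.

Let inner_int (x w : R) : 0 < x -> 0 <= w ->
  (\int[leb]_(y in `[0%R, w]) (q x y)%:E =
   (((x + w) `^ (H - 1) - x `^ (H - 1)) / (H - 1))%:E)%E.
Proof.
move=> x0; rewrite le_eqVlt => /predU1P[<-|w0].
  by rewrite set_itv1 integral_set1 addr0 subrr mul0r.
pose F y := (x + y) `^ (H - 1) / (H - 1).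
have dF (y : R) : 0 < x + y -> is_derive y 1 F (q x y).
  move=> xy0; have yx0 : 0 < y + x by rewrite addrC.
  have d1 := is_deriveZ (H - 1)^-1 (is_derive_powR_shift (H - 1) yx0).
  rewrite /F /q; have -> : (x + y) `^ (H - 2) = (H - 1)^-1 *: ((H - 1) * (y + x) `^ (H - 1 - 1)).
    rewrite /GRing.scale/= mulrA mulVf// mul1r addrC; congr (_ `^ _); ring.
  rewrite (_ : (fun y => _) = (H - 1)^-1 \*: (fun z => (z + x) `^ (H - 1)))//.
  by apply/funext => z /=; rewrite /GRing.scale/= mulrC [x + z]addrC.
have dd (y : R) : 0 < x + y -> derivable F y 1.
  by move=> h; exact: (@ex_derive _ _ _ _ _ _ _ (dF y h)).
have cF (y : R) : 0 < x + y -> {for y, continuous F}.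
  by move=> h; apply: differentiable_continuous; apply/derivable1_diffP; exact: dd.
have xw0 : 0 < x + w by rewrite addr_gt0.
rewrite (@continuous_FTC2 _ (q x) F)//.
- by rewrite /F addr0 -EFinB mulrBl.
- apply: continuous_in_subspaceT => y; rewrite inE/= in_itv/= => /andP[y0 _].
  have yx0 : 0 < y + x by rewrite ltr_wpDl.
  have := is_derive_powR_shift (H - 2) yx0 => /(@ex_derive _ _ _ _ _ _ _) d1.
  rewrite (_ : q x = (fun z => (z + x) `^ (H - 2))); last first.
    by apply/funext => z; rewrite /q addrC.
  by apply: differentiable_continuous; apply/derivable1_diffP.
- split.
  + by move=> y; rewrite in_itv/= => /andP[h1 _]; apply: dd; rewrite addr_gt0.
  + by apply: cvg_at_right_filter; apply: cF; rewrite addr0.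
  + by apply: cvg_at_left_filter; apply: cF.
- move=> y; rewrite in_itv/= => /andP[h1 _]; rewrite derive1E.
  have h : 0 < x + y by rewrite addr_gt0.
  by rewrite (@derive_val _ _ _ _ _ _ _ (dF y h)).
Qed.

(** Two successive antiderivatives of the kernel. When [H < 1] the first one is
    singular at the origin, but the second one is continuous there. *)
Lemma integral_power_kernel (u w : R) : 0 <= u -> 0 <= w ->
  (\int[leb]_(x in `]0%R, u]) \int[leb]_(y in `[0%R, w]) ((x + y) `^ (H - 2))%:E =
   (power_defect u w)%:E)%E.
Proof.
rewrite le_eqVlt => /predU1P[<- w0|u0 w0].
  rewrite set_itvoc0 integral_set0 /power_defect add0r powR0//.
  by rewrite subr0 subrr mul0r.
transitivity (\int[leb]_(x in `]0%R, u])
    (((x + w) `^ (H - 1) - x `^ (H - 1)) / (H - 1))%:E)%E.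
  by apply: eq_integral => x; rewrite mem_setE in_itv/= => /andP[x0 _]; rewrite -inner_int.
pose f x := ((x + w) `^ (H - 1) - x `^ (H - 1)) / (H - 1).
pose F x := ((x + w) `^ H - x `^ H) / (H * (H - 1)).
have dF (x : R) : 0 < x -> is_derive x 1 F (f x).
  move=> x0; have xw0 : 0 < x + w by rewrite ltr_pwDl.
  have d1 := is_deriveZ (H * (H - 1))^-1
    (is_deriveB (is_derive_powR_shift H xw0) (is_derive1_powR H x0)).
  rewrite (_ : F = (H * (H - 1))^-1 \*: ((fun z => (z + w) `^ H) - (@powR R)^~ H)); last first.
    by apply/funext => z /=; rewrite /F /GRing.scale/= mulrC.
  rewrite (_ : f x = (H * (H - 1))^-1 *: (H * (x + w) `^ (H - 1) - H * x `^ (H - 1)))//.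
  by rewrite /f /GRing.scale/=; field; rewrite Hn0 Hm1.
have cpow (p z : R) : 0 < z -> {for z, continuous (@powR R ^~ p)}.
  move=> z0; apply: differentiable_continuous; apply/derivable1_diffP.
  exact: (@ex_derive _ _ _ _ _ _ _ (is_derive1_powR p z0)).
have cpows (p z : R) : 0 < z + w -> {for z, continuous (fun z => (z + w) `^ p)}.
  move=> z0; apply: differentiable_continuous; apply/derivable1_diffP.
  exact: (@ex_derive _ _ _ _ _ _ _ (is_derive_powR_shift p z0)).
have F0 : F x @[x --> 0^'+] --> (w `^ H / (H * (H - 1)) : R).
  rewrite -[w `^ H]subr0; apply: cvgMl => //; apply: cvgB; last exact: powR_cvg0.
  move: w0; rewrite le_eqVlt => /predU1P[<-|w0].
    rewrite powR0// (_ : (fun x => _) = (@powR R)^~ H); first exact: powR_cvg0.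
    by apply/funext => z; rewrite addr0.
  have := @cpows H 0; rewrite add0r => /(_ w0) c0.
  apply: cvg_at_right_filter; move: c0; rewrite /prop_for /continuous_at add0r.
  exact.
rewrite (@ge0_integral_FTC_singular _ f F _ _ u0 _ _ dF F0).
- by rewrite /F /power_defect -mulrBl.
- by move=> x x0; exact: powR_quot_ge0.
- move=> x x0; apply: cvgMl => //; apply: cvgB; [apply: cpows|exact: cpow].
  by rewrite ltr_pwDl.
Qed.

End power_kernel.

Section cross_integral.
Context {R : realType} (H : R).
Hypothesis H02 : 0 < H < 2.
Hypothesis H1 : H != 1.
Variables (b : R) (b0 : 0 < b).
Notation leb := (@lebesgue_measure R).
Notation E := (explaw b0).

Let H0 : 0 < H. Proof. by case/andP: H02. Qed.

Lemma ae_eq_explaw (f g : R -> \bar R) : measurable_fun setT f -> measurable_fun setT g ->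
  (forall u, 0 <= u -> f u = g u) -> (\int[E]_u f u = \int[E]_u g u)%E.
Proof.
move=> mf mg fg; apply: (@ae_eq_integral _ (measurableTypeR R)) => //.
exists `]-oo, 0[%classic; split => //.
  rewrite -setCitvr.
  have := @probability_setC _ _ _ E `[0, +oo[%classic (measurable_itv _).
  move=> h; etransitivity; first exact: h.
  transitivity (1 - 1 : \bar R)%E; last by rewrite subee.
  congr (_ - _)%E; exact: (explaw_ge0 b0).
move=> u /= h; rewrite in_itv/= ltNge; apply/negP => u0; apply: h => _.
exact: fg.
Qed.

(** The inner integral of [crossI] in the variable [y = - v]. It is infinite at
    [x = 0] when [H < 1]. *)
Definition kernelJ (x : R) : \bar R :=
  (\int[leb]_(y in `[0%R, +oo[) ((x + y) `^ (H - 2) * expR (- b * y))%:E)%E.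

Let q (x y : R) : R := (x + y) `^ (H - 2).

Let mq : measurable_fun setT (fun p : R * R => (q p.1 p.2)%:E).
Proof.
apply/measurable_EFinP.
by apply: (measurableT_comp (measurable_powR (H - 2))); exact: measurable_funD.
Qed.

Let mqx x : measurable_fun setT (fun y => (q x y)%:E).
Proof. exact: (measurableT_comp mq (measurable_pair1 x)). Qed.

Let mqr x : measurable_fun setT (q x).
Proof. by have /measurable_EFinP := mqx x. Qed.

Let q0 x y : 0 <= q x y. Proof. exact: powR_ge0. Qed.

Lemma kernelJ_ge0 x : (0 <= kernelJ x)%E.
Proof. by apply: integral_ge0 => y _; rewrite lee_fin mulr_ge0 ?expR_ge0 ?powR_ge0. Qed.

Lemma measurable_kernelJ : measurable_fun setT kernelJ.
Proof.
pose G (p : R * R) := if (0 <= p.2)%R then (q p.1 p.2 * expR (- b * p.2))%:E else 0%E.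
have mG : measurable_fun setT G.
  apply: measurable_fun_ifT => //; first exact: measurable_fun_ler.
  apply/measurable_EFinP; apply: measurable_funM; first exact/measurable_EFinP.
  by apply: measurableT_comp => //; apply: measurable_funM.
rewrite (_ : kernelJ = fun x => (\int[leb]_y G (x, y))%E).
  apply: measurable_fun_fubini_tonelli_F => // p.
  by rewrite /G; case: ifPn => // _; rewrite lee_fin mulr_ge0 ?expR_ge0.
apply/funext => x; rewrite /kernelJ integral_mkcond; apply: eq_integral => y _.
by rewrite patchE mem_setE in_itv/= andbT.
Qed.

Lemma kernelJ_fin x : 0 < x -> (kernelJ x < +oo)%E.
Proof.
move=> x0.
have b1 : (\int[leb]_(y in `[0%R, +oo[) (b * expR (- b * y))%:E = 1)%E.
  have := @ge0_integral_explaw _ _ b0 (cst 1%E) (measurable_cst _) (fun=> lee01).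
  have -> : (\int[E]_u cst 1 u = 1)%E.
    by rewrite integral_cst// mul1e; exact: (@probability_setT _ _ _ E).
  by move=> ->; apply: eq_integral => u _; rewrite mul1e.
apply: (@le_lt_trans _ _ ((x `^ (H - 2) / b)%:E *
  \int[leb]_(y in `[0%R, +oo[) (b * expR (- b * y))%:E)%E); last by rewrite b1 mule1 ltry.
have me : measurable_fun setT (fun y => (b * expR (- b * y))%:E).
  by apply/measurable_EFinP; apply: measurable_funM => //; apply: measurableT_comp.
rewrite -ge0_integralZl; last 4 first.
- by [].
- exact: measurable_funTS.
- by move=> y _; rewrite lee_fin mulr_ge0 ?expR_ge0 ?ltW.
- by rewrite lee_fin divr_ge0 ?powR_ge0 ?ltW.
apply: ge0_le_integral => //.
- by move=> y _; rewrite lee_fin mulr_ge0 ?expR_ge0 ?powR_ge0.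
- apply/measurable_funTS/measurable_EFinP; apply: measurable_funM.
    exact: mqr.
  by apply: measurableT_comp.
- by apply: measurable_funTS; exact: emeasurable_funM.
move=> y /=; rewrite in_itv/= andbT => y0; rewrite -EFinM lee_fin mulrA divfK ?gt_eqF//.
rewrite ler_wpM2r ?expR_ge0//.
have xy0 : 0 < x + y by rewrite ltr_wpDr.
rewrite (_ : H - 2 = - (2 - H)); last by ring.
rewrite !powRN lef_pV2 ?posrE ?powR_gt0//; apply: ge0_ler_powR.
- by rewrite subr_ge0 ltW//; case/andP: H02.
- by rewrite nnegrE ltW.
- by rewrite nnegrE ltW.
- by rewrite lerDl.
Qed.

Let mdefect (u : R) : measurable_fun setT (fun w : R => power_defect H u `|w|).
Proof.
apply: measurable_funM => //; apply: measurable_funB.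
  apply: measurable_funB => //; apply: (measurableT_comp (measurable_powR H)).
  exact: measurable_funD.
by apply: (measurableT_comp (measurable_powR H)).
Qed.

Lemma integrable_power_defect (u : R) : 0 <= u ->
  E.-integrable setT (fun w => (power_defect H u `|w|)%:E).
Proof.
move=> u0; pose C := 3 * (1 + u) ^+ 2 / `|H * (H - 1)|.
apply: (@integrable_explaw_poly _ _ b0 C) => // w w0.
rewrite (ger0_norm w0) /power_defect normrM normfV /C [leRHS]mulrAC ler_wpM2r ?invr_ge0//.
have pow (z : R) : 0 <= z -> z <= (1 + u) * (1 + w) -> z `^ H <= (1 + u) ^+ 2 * (1 + w) ^+ 2.
  move=> z0 zle; rewrite -exprMn -powR_mulrn ?mulr_ge0 ?addr_ge0//.
  apply: (@le_trans _ _ (((1 + u) * (1 + w)) `^ H)).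
    by apply: ge0_ler_powR; rewrite ?nnegrE ?(ltW H0) ?mulr_ge0 ?addr_ge0.
  apply: ler_powR; last by rewrite ltW//; case/andP: H02.
  by rewrite mulr_ege1// lerDl.
have uw0 : 0 <= u * w by rewrite mulr_ge0.
have h1 : (u + w) `^ H <= (1 + u) ^+ 2 * (1 + w) ^+ 2 by apply: pow; [rewrite addr_ge0|lra].
have h2 : u `^ H <= (1 + u) ^+ 2 * (1 + w) ^+ 2 by apply: pow => //; lra.
have h3 : w `^ H <= (1 + u) ^+ 2 * (1 + w) ^+ 2 by apply: pow => //; lra.
apply: (@le_trans _ _ (3 * ((1 + u) ^+ 2 * (1 + w) ^+ 2))).
  have := powR_ge0 (u + w) H; have := powR_ge0 u H; have := powR_ge0 w H => ? ? ?.
  by rewrite ler_norml; apply/andP; split; lra.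
rewrite mulrA ler_wpM2l//; first by rewrite mulr_ge0// exprn_ge0// addr_ge0.
by rewrite ler_weXn2l// lerDl.
Qed.

(** The exponential weight of [kernelJ] turns into an average over [w] of the
    integrals of the power kernel on the rectangles [0 < x <= u], [0 <= y <= w]. *)
Lemma integral_kernelJ (u : R) : 0 <= u ->
  (\int[leb]_(x in `]0%R, u]) kernelJ x = \int[E]_w (power_defect H u `|w|)%:E)%E.
Proof.
move=> u0.
pose A (p : R * R) := (\int[leb]_(y in `[0%R, p.2]) (q p.1 y)%:E)%E.
have A0 p : (0 <= A p)%E by apply: integral_ge0 => y _; rewrite lee_fin.
have mA : measurable_fun setT A.
  pose G (p : (R * R) * R) := if (0 <= p.2 <= p.1.2)%R then (q p.1.1 p.2)%:E else 0%E.
  have mG : measurable_fun setT G.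
    have m12 : measurable_fun setT (fun p : (R * R) * R => p.1.2).
      exact: (measurableT_comp measurable_snd measurable_fst).
    have m11 : measurable_fun setT (fun p : (R * R) * R => p.1.1).
      exact: (measurableT_comp measurable_fst measurable_fst).
    apply: measurable_fun_ifT => //.
      by apply: measurable_and; apply: measurable_fun_ler.
    apply/measurable_EFinP; apply: (measurableT_comp (measurable_powR (H - 2))).
    exact: measurable_funD.
  rewrite (_ : A = fun p => (\int[leb]_y G (p, y))%E).
    apply: measurable_fun_fubini_tonelli_F => // p.
    by rewrite /G; case: ifPn => // _; rewrite lee_fin.
  apply/funext => p; rewrite /A integral_mkcond; apply: eq_integral => y _.
  by rewrite patchE mem_setE in_itv.
pose B (p : R * R) := if (0 < p.1 <= u)%R then A p else 0%E.
have mB : measurable_fun setT B.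
  apply: measurable_fun_ifT => //.
  by apply: measurable_and; [exact: measurable_fun_ltr|exact: measurable_fun_ler].
have B0 p : (0 <= B p)%E by rewrite /B; case: ifPn.
transitivity (\int[leb]_x \int[E]_w B (x, w))%E.
  rewrite integral_mkcond; apply: eq_integral => x _; rewrite patchE mem_setE in_itv/=.
  rewrite /B/=; case: ifPn => _; last by rewrite integral0.
  rewrite /kernelJ -[RHS]/(\int[E]_w A (x, w))%E /A/=.
  rewrite (ge0_integral_explaw_triangle b0 (mqx x))// => y.
  by rewrite lee_fin.
rewrite (fubini_tonelli (m1 := leb) (m2 := E) B)//.
have mBx w : measurable_fun setT (fun x => B (x, w)).
  exact: (measurableT_comp mB (measurable_pair2 w)).
apply: ae_eq_explaw.
- exact: (@measurable_fun_fubini_tonelli_G _ _ (measurableTypeR R) (measurableTypeR R) R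
    leb B mB B0).
- exact/measurable_EFinP.
move=> w w0; rewrite (ger0_norm w0) -integral_power_kernel//.
rewrite [RHS]integral_mkcond; apply: eq_integral => x _.
by rewrite patchE mem_setE in_itv.
Qed.

Definition kernelK (u : R) : R := fine (\int[leb]_(x in `]0%R, u]) kernelJ x)%E.

Lemma kernelK_fin (u : R) : 0 <= u ->
  (kernelK u)%:E = (\int[leb]_(x in `]0%R, u]) kernelJ x)%E.
Proof.
move=> u0; rewrite /kernelK fineK// integral_kernelJ//.
exact: (integrable_fin_num _ (integrable_power_defect u0)).
Qed.

Lemma kernelKE (u : R) : 0 <= u -> kernelK u = \int[E]_w power_defect H u `|w|.
Proof. by move=> u0; rewrite /kernelK integral_kernelJ. Qed.

Lemma kernelK0 : kernelK 0 = 0.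
Proof. by rewrite /kernelK set_itvoc0 integral_set0. Qed.

Lemma crossI_inner (u : R) :
  \int[leb]_(v in `]-oo, 0]) (expR (b * v) * (u - v) `^ (H - 2)) = fine (kernelJ u).
Proof.
rewrite /Rintegral /kernelJ; congr fine.
rewrite [LHS](ge0_integral_reflect 0)//.
- rewrite (_ : _ @^-1` _ = `[0%R, +oo[%classic); last first.
    by apply/seteqP; split => x /=; rewrite !in_itv/= andbT; lra.
  apply: eq_integral => y _; rewrite sub0r opprK mulrC; congr (_ * expR _)%:E.
  by rewrite mulrN mulNr.
- apply/measurable_EFinP; apply: measurable_funM.
    by apply: measurableT_comp => //; apply: measurable_funM.
  apply: (measurableT_comp (measurable_powR (H - 2))); exact: measurable_funB.
- by move=> v; rewrite lee_fin mulr_ge0 ?expR_ge0 ?powR_ge0.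
Qed.

Let mexp (a : R) : measurable_fun setT (fun x => (expR (a * x))%:E * kernelJ x)%E.
Proof.
apply: emeasurable_funM; last exact: measurable_kernelJ.
by apply/measurable_EFinP; apply: measurableT_comp => //; apply: measurable_funM.
Qed.

Lemma crossIE (a : R) (s : nat) : 0 < a ->
  (crossI a b H s)%:E = (\int[leb]_(x in `]0%R, s%:R]) ((expR (a * x))%:E * kernelJ x))%E.
Proof.
move=> a0; rewrite /crossI.
under eq_Rintegral do rewrite crossI_inner.
rewrite /Rintegral -integral_itv_obnd_cbnd; last first.
  apply/measurable_funTS/measurable_EFinP; apply: measurable_funM.
    by apply: measurableT_comp => //; apply: measurable_funM.
  by apply: measurableT_comp => //; exact: measurable_kernelJ.
rewrite (_ : \int[leb]_(x in `]0%R, s%:R]) (expR (a * x) * fine (kernelJ x))%:E =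
    \int[leb]_(x in `]0%R, s%:R]) ((expR (a * x))%:E * kernelJ x))%E; last first.
  apply: eq_integral => x; rewrite mem_setE in_itv/= => /andP[x0 _].
  by rewrite EFinM fineK// ge0_fin_numE ?kernelJ_fin// kernelJ_ge0.
rewrite fineK// ge0_fin_numE; last first.
  by apply: integral_ge0 => x _; rewrite mule_ge0 ?kernelJ_ge0// lee_fin expR_ge0.
apply: (@le_lt_trans _ _ ((expR (a * s%:R))%:E * \int[leb]_(x in `]0%R, s%:R]) kernelJ x)%E).
  rewrite -ge0_integralZl; last 4 first.
  - by [].
  - exact: measurable_funTS measurable_kernelJ.
  - by move=> x _; exact: kernelJ_ge0.
  - by rewrite lee_fin expR_ge0.
  apply: ge0_le_integral => //.
  - by move=> x _; rewrite mule_ge0 ?kernelJ_ge0// lee_fin expR_ge0.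
  - by apply: measurable_funTS; exact: mexp.
  - apply: measurable_funTS; apply: emeasurable_funM => //; exact: measurable_kernelJ.
  - move=> x /=; rewrite in_itv/= => /andP[_ xs]; rewrite lee_wpmul2r ?kernelJ_ge0//.
    by rewrite lee_fin ler_expR ler_wpM2l// ltW.
by rewrite -kernelK_fin// -EFinM ltry.
Qed.

(** The integrand is bounded below by a positive constant where [y <= 1]. *)
Lemma crossI_gt0 (a : R) (s : nat) : 0 < a -> (0 < s)%N -> 0 < crossI a b H s.
Proof.
move=> a0 s0; have s0R : 0 < s%:R :> R by rewrite ltr0n.
rewrite -lte_fin crossIE//.
pose c : R := (s%:R + 1) `^ (H - 2) * expR (- b * 1).
have c0 : 0 < c by rewrite mulr_gt0 ?expR_gt0// powR_gt0// addr_gt0.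
have int_cst (r : R) : 0 < r -> (\int[leb]_(x in `]0%R, r]) c%:E = (c * r)%:E)%E.
  move=> r0; have lr : (leb `]0%R, r] = r%:E)%E.
    by rewrite lebesgue_measure_itv/= lte_fin r0 sube0.
  etransitivity; first exact: (@integral_cst _ _ _ leb _ (measurable_itv _) c%:E).
  by rewrite [RHS]EFinM; congr (_ * _)%E; exact: lr.
apply: (@lt_le_trans _ _ (\int[leb]_(x in `]0%R, s%:R]) c%:E)%E).
  by rewrite (int_cst _ s0R) lte_fin mulr_gt0.
apply: ge0_le_integral => //.
- by move=> x _; rewrite lee_fin ltW.
- by apply: measurable_funTS; exact: mexp.
move=> x /=; rewrite in_itv/= => /andP[x0 xs].
apply: (@le_trans _ _ (kernelJ x)); last first.
  by rewrite lee_pemull ?kernelJ_ge0// lee_fin -expR0 ler_expR mulr_ge0// ltW.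
apply: (@le_trans _ _ (\int[leb]_(y in `[0%R, 1%R]) c%:E)%E).
  by rewrite -integral_itv_obnd_cbnd// (int_cst _ ltr01) mulr1.
have mJ : measurable_fun setT (fun y => ((x + y) `^ (H - 2) * expR (- b * y))%:E).
  apply/measurable_EFinP; apply: measurable_funM; first exact: mqr.
  by apply: measurableT_comp => //; apply: measurable_funM.
apply: (@le_trans _ _ (\int[leb]_(y in `[0%R, 1%R])
    ((x + y) `^ (H - 2) * expR (- b * y))%:E)%E).
  apply: ge0_le_integral => //.
  - by move=> y _; rewrite lee_fin ltW.
  - exact: measurable_funTS.
  move=> y /=; rewrite in_itv/= => /andP[y0 y1]; rewrite lee_fin /c.
  have xy0 : 0 < x + y by rewrite ltr_wpDr.
  apply: ler_pM; rewrite ?powR_ge0 ?expR_ge0//; last first.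
    by rewrite ler_expR !mulNr lerN2 ler_wpM2l// ltW.
  rewrite (_ : H - 2 = - (2 - H)); last by ring.
  rewrite !powRN lef_pV2 ?posrE ?powR_gt0// ?addr_gt0//; apply: ge0_ler_powR.
  - by rewrite subr_ge0 ltW//; case/andP: H02.
  - by rewrite nnegrE ltW.
  - by rewrite nnegrE addr_ge0.
  - exact: lerD.
apply: ge0_subset_integral => //.
- exact: measurable_funTS.
- by move=> y _; rewrite lee_fin mulr_ge0 ?expR_ge0 ?powR_ge0.
- by move=> y /=; rewrite !in_itv/= andbT => /andP[].
Qed.

End cross_integral.

(** * Covariances at a positive lag *)

Section lagged_covariance.
Context d (T : measurableType d) (R : realType) (P : probability T R).
Variables (H a b nu1 nu2 c : R) (a0 : 0 < a) (b0 : 0 < b).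
Hypothesis H02 : 0 < H < 2.
Hypothesis H1 : H != 1.
Variables (X V : R -> T -> R).
Hypotheses (rX : regular_process P X) (rV : regular_process P V).
Hypothesis covXV : forall u v, 0 <= u -> 0 <= v ->
  mean P (fun w => X u w * V (- v) w) = c * (u `^ H + v `^ H - (u + v) `^ H).
Notation leb := (@lebesgue_measure R).
Local Notation J := (kernelJ H b).
Local Notation K := (kernelK H b).
Local Notation Y1 := (ou nu1 a0 X).
Local Notation Y2 := (ou nu2 b0 V).

Let H0 : 0 < H. Proof. by case/andP: H02. Qed.
Let HH : H * (H - 1) != 0. Proof. by rewrite mulf_neq0 ?subr_eq0// gt_eqF. Qed.

Let k (t : R) : R := mean P (fun w => X t w * Y2 0 w).
Let kappa : R := nu2 * c * (H * (H - 1)).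

Let LY2 : L4 P (Y2 0). Proof. exact: L4_ou. Qed.
Let LX t : L4 P (X t). Proof. exact: regular_L4. Qed.

(** The covariance of increments of [X] after time [0] and of [V] before time [0]
    is proportional to the power defect of their lengths. *)
Let kE u : 0 <= u -> k u = kappa * K u.
Proof.
move=> u0; rewrite /k meanC (mean_ou nu2 b0 rV 0 (LX u)).2.
rewrite (_ : kappa * K u = nu2 * ((c * (H * (H - 1))) * K u)); last by rewrite /kappa; ring.
congr (_ * _).
have [i1 _] := mean_ou nu2 b0 rV 0 (LX u).
have i2 := integrable_power_defect H02 b0 u0.
rewrite kernelKE// -RintegralZl//.
rewrite /Rintegral; congr fine; apply: ae_eq_explaw.
- by case/integrableP: i1.
- apply/measurable_EFinP; apply: measurable_funM => //; apply/measurable_EFinP.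
  by case/integrableP: i2.
move=> v v0; congr EFin; rewrite (ger0_norm v0) sub0r.
transitivity (mean P (fun w => X u w * (1 * V (- 0) w + (-1) * V (- v) w))).
  by congr mean; apply/funext => w; rewrite oppr0 mul1r mulN1r mulrC.
rewrite mean_linr//; [|exact: regular_L4|exact: regular_L4].
rewrite !covXV// powR0 ?gt_eqF// !addr0 subrr !mulr0 add0r mulN1r /power_defect.
by rewrite -[RHS]mulrA [_ * (_ / _)]mulrC divfK//; ring.
Qed.

Let k0 : k 0 = 0. Proof. by rewrite kE// kernelK0 mulr0. Qed.

Let mean_incr s u : mean P (fun w => (X s w - X (s - u) w) * Y2 0 w) = k s - k (s - u).
Proof.
rewrite (_ : (fun w => _) = fun w => (1 * X s w + (-1) * X (s - u) w) * Y2 0 w).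
  by rewrite mean_linl// mul1r mulN1r.
by apply/funext => w; rewrite mul1r mulN1r.
Qed.

Let int_k s : (explaw a0).-integrable setT (EFin \o (fun u => k s - k (s - u))).
Proof.
have := (mean_ou nu1 a0 rX s LY2).1; congr (_.-integrable _ _).
by apply/funext => u /=; rewrite mean_incr.
Qed.

Let mean_k s : mean P (fun w => Y1 s w * Y2 0 w) =
  nu1 * \int[explaw a0]_u (k s - k (s - u)).
Proof.
rewrite (mean_ou nu1 a0 rX s LY2).2; congr (_ * _).
by apply: eq_Rintegral => u _; rewrite mean_incr.
Qed.

Let mJs (s : R) : measurable_fun setT (fun y : R => J (s - y)).
Proof.
apply: (measurableT_comp (measurable_kernelJ H b)); exact: measurable_funB.
Qed.

(** Up to the factor [kappa], the derivative of [k] read backwards from time [s]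
    and cut at time [0]. *)
Let recent (s y : R) : \bar R := if 0 <= y < s then J (s - y) else 0%E.

Let recent_ge0 s y : (0 <= recent s y)%E.
Proof. by rewrite /recent; case: ifPn => // _; exact: kernelJ_ge0. Qed.

Let mrecent s : measurable_fun setT (recent s).
Proof.
apply: measurable_fun_ifT => //.
by apply: measurable_and; [exact: measurable_fun_ler|exact: measurable_fun_ltr].
Qed.

Let integral_recent (s u : R) : 0 <= s -> 0 <= u ->
  (\int[leb]_(y in `[0%R, u]) recent s y = (K s - K (s - Num.min u s))%:E)%E.
Proof.
move=> s0 u0; set m := Num.min u s.
have m0 : 0 <= m by rewrite le_min u0.
have ms : m <= s by rewrite ge_min lexx orbT.
have mu : m <= u by rewrite ge_min lexx.
transitivity (\int[leb]_(y in `[0%R, m[) J (s - y))%E.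
  rewrite -integral_itv_bndo_bndc; last exact: measurable_funTS.
  rewrite integral_mkcond [RHS]integral_mkcond; apply: eq_integral => y _.
  rewrite !patchE !mem_setE !in_itv/= /recent /m lt_min.
  by case: (0 <= y) => //=; case: (y < u) => //=; case: (y < s).
transitivity (\int[leb]_(x in `](s - m)%R, s]) J x)%E.
  rewrite [RHS](ge0_integral_reflect s)//.
  - congr (integral _ _ _); apply/seteqP; split => y /=;
      by rewrite !in_itv/= => /andP[h1 h2]; apply/andP; split; lra.
  - exact: measurable_kernelJ.
  - by move=> x; exact: kernelJ_ge0.
have sm0 : 0 <= s - m by rewrite subr_ge0.
have := kernelK_fin H02 H1 b0 s0.
rewrite (@itv_bndbnd_setU _ _ _ (BRight (s - m))) ?bnd_simp//; last by rewrite gerBl.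
rewrite ge0_integral_setU//=.
- rewrite -kernelK_fin// => e1.
  rewrite EFinB e1 addeAC subee ?add0e//.
- apply: measurable_funTS; exact: measurable_kernelJ.
- by move=> x _; exact: kernelJ_ge0.
- apply/disj_setPS => y [/=]; rewrite 2!in_itv/= => /andP[_ ys] /andP[].
  by rewrite ltNge ys.
Qed.

(** Splitting the exponential average at time [0]: by lack of memory, the part
    of the past before [0] contributes [expR (- a * s)] times the covariance at
    lag zero, and the part after [0] is the cross integral. *)
Lemma mean_ou_lag (s : nat) :
  mean P (fun w => Y1 s%:R w * Y2 0 w) =
  expR (- a * s%:R) * (mean P (fun w => Y1 0 w * Y2 0 w) +
     nu1 * nu2 * c * (H * (H - 1)) * crossI a b H s).
Proof.
have s0 : 0 <= s%:R :> R by [].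
set t : R := s%:R in s0 *.
pose f1 u := K t - K (t - Num.min u t).
pose g u := k 0 - k (0 - u).
pose f2 u := (fun u => g (u - t)) \_ `[t, +oo[ u.
have mf1 u : 0 <= u -> (\int[leb]_(y in `[0%R, u]) recent t y = (f1 u)%:E)%E.
  exact: integral_recent.
pose F1 u := (\int[leb]_(y in `[0%R, u]) recent t y)%E.
have F10 u : (0 <= F1 u)%E by apply: integral_ge0.
have mF1 : measurable_fun setT F1.
  pose G (p : R * R) := if (0 <= p.2 <= p.1)%R then recent t p.2 else 0%E.
  have mG : measurable_fun setT G.
    apply: measurable_fun_ifT => //; last exact: measurableT_comp.
    by apply: measurable_and; apply: measurable_fun_ler.
  rewrite (_ : F1 = fun u => (\int[leb]_y G (u, y))%E).
    apply: measurable_fun_fubini_tonelli_F => // p.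
    by rewrite /G; case: ifPn.
  apply/funext => u; rewrite /F1 integral_mkcond; apply: eq_integral => y _.
  by rewrite patchE mem_setE in_itv.
have F1E : (\int[explaw a0]_u F1 u = (expR (- a * t) * crossI a b H s)%:E)%E.
  rewrite ge0_integral_explaw_triangle//.
  rewrite EFinM crossIE// -ge0_integralZl; last 4 first.
  - by [].
  - apply: measurable_funTS; apply: emeasurable_funM; last exact: measurable_kernelJ.
    by apply/measurable_EFinP; apply: measurableT_comp => //; apply: measurable_funM.
  - by move=> x _; rewrite mule_ge0 ?kernelJ_ge0// lee_fin expR_ge0.
  - by rewrite lee_fin expR_ge0.
  rewrite [RHS](ge0_integral_reflect t); last 3 first.
  - by [].
  - apply: emeasurable_funM => //; apply: emeasurable_funM; last exact: measurable_kernelJ.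
    by apply/measurable_EFinP; apply: measurableT_comp => //; apply: measurable_funM.
  - by move=> x; rewrite mule_ge0 ?mule_ge0 ?kernelJ_ge0// lee_fin expR_ge0.
  rewrite integral_mkcond [RHS]integral_mkcond; apply: eq_integral => y _.
  rewrite !patchE (_ : (y \in (fun x : R => t - x) @^-1` `]0, t]%classic) = (0 <= y < t)); last first.
    by apply/idP/idP; rewrite inE /= in_itv/= => /andP[h1 h2]; apply/andP; split; lra.
  rewrite mem_setE in_itv/= andbT /recent.
  case: (0 <= y) => //=; case: (y < t) => //=; last by rewrite mul0e.
  by rewrite muleA -EFinM -expRD muleC; congr ((expR _)%:E * _)%E; ring.
have iF1 : (explaw a0).-integrable setT F1.
  apply/integrableP; split => //.
  by under eq_integral do rewrite gee0_abs//; rewrite F1E ltry.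
have ig : (explaw a0).-integrable setT (EFin \o g) by exact: int_k.
have mg : measurable_fun setT g by apply/measurable_EFinP; case/integrableP: ig.
have [if2 f2E] := integrable_explaw_shift s0 mg ig.
have if2' : (explaw a0).-integrable setT (EFin \o f2).
  rewrite (_ : _ \o _ = (fun u => (g (u - t))%:E) \_ `[t, +oo[).
    by rewrite -integrable_mkcond.
  by apply/funext => u; rewrite /= /f2 !patchE; case: ifPn.
have le_fineF u : (`|(fine (F1 u))%:E| <= `|F1 u|)%E.
  by case: (F1 u) => [r||] //=; rewrite ?normr0 ?leey.
have f1F u : 0 <= u -> f1 u = fine (F1 u) by move=> u0; rewrite /F1 mf1.
rewrite !mean_k [X in expR _ * (X + _)](_ : _ = nu1 * \int[explaw a0]_u g u)//.
have if1 : (explaw a0).-integrable setT (EFin \o (fun u => kappa * fine (F1 u))).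
  rewrite (_ : _ \o _ = fun u => (kappa%:E * (fine (F1 u))%:E)%E)//; apply: integrableZl => //.
  apply: (le_integrable _ _ _ iF1) => //.
  by apply/measurable_EFinP; exact: measurableT_comp.
have -> : \int[explaw a0]_u (k t - k (t - u)) = \int[explaw a0]_u (kappa * fine (F1 u) + f2 u).
  rewrite /Rintegral; congr fine; apply: ae_eq_explaw.
  - by case/integrableP: (int_k t).
  - apply/measurable_EFinP; apply: measurable_funD; apply/measurable_EFinP.
      by case/integrableP: if1.
    by case/integrableP: if2'.
  move=> u u0; congr EFin; rewrite -f1F// /f1 /f2 patchE mem_setE in_itv/= andbT.
  have [tu|ut] := leP t u.
    rewrite subrr kernelK0 subr0 /g -kE// k0 opprB; congr (_ + _).
    by rewrite !add0r.
  rewrite [point]/(0 : R) addr0 mulrBr -!kE ?subr_ge0 ?(ltW ut)//.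
rewrite RintegralD// {2}/Rintegral.
have -> : \int[explaw a0]_u (kappa * fine (F1 u)) = kappa * (expR (- a * t) * crossI a b H s).
  rewrite RintegralZl//.
    congr (_ * _); rewrite /Rintegral -[RHS]/(fine (_%:E)) -F1E; congr fine.
    apply: ae_eq_explaw => //.
      by apply/measurable_EFinP; exact: measurableT_comp.
    by move=> u u0; rewrite -f1F// /F1 mf1.
  apply: (le_integrable _ _ _ iF1) => //.
    by apply/measurable_EFinP; exact: measurableT_comp.
  by move=> u _; exact: le_fineF.
rewrite -[fine (integral _ _ _)]/(\int[explaw a0]_u f2 u) /f2 -Rintegral_mkcond f2E.
by rewrite /kappa; ring.
Qed.

End lagged_covariance.

(** * Gaussian families and fractional Brownian motions *)

Section gaussian_families.
Context d (T : measurableType d) (R : realType) (P : probability T R).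

Lemma expectation_mean (f : T -> R) : P.-integrable setT (EFin \o f) ->
  ('E_P[f] = (mean P f)%:E)%E.
Proof. by move=> fi; rewrite unlock /mean /Rintegral fineK//; exact: integrable_fin_num. Qed.

Lemma centered_gaussian_L4 (G : T -> R) : measurable_fun setT G -> is_gaussian P G ->
  ('E_P[G] = 0)%E ->
  L4 P G /\ mean P (fun w => G w ^+ 4) = 3 * mean P (fun w => G w ^+ 2) ^+ 2.
Proof.
move=> mG gG EG; have [v [v2 v4]] := gaussian_fourth_moment mG gG EG.
split; last by rewrite /mean /Rintegral v2 v4.
split=> //; apply/integrableP; split.
  by apply/measurable_EFinP; exact: measurable_funX.
under eq_integral do rewrite /= ger0_norm ?exprn_even_ge0//.
by rewrite v4 ltry.
Qed.

Variables (I : Type) (Z : I -> T -> R).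
Hypothesis mZ : forall i, measurable_fun setT (Z i).
Hypothesis gZ : gaussian_process P Z.
Hypothesis cZ : centered P Z.

Lemma gaussian_process_L4 i :
  L4 P (Z i) /\ mean P (fun w => Z i w ^+ 4) = 3 * mean P (fun w => Z i w ^+ 2) ^+ 2.
Proof.
apply: centered_gaussian_L4 => //.
have := gZ (fun=> i) (fun _ : 'I_1 => 1).
by congr is_gaussian; apply/funext => w; rewrite big_ord1 mul1r.
Qed.

Let LZ i : L4 P (Z i). Proof. exact: (gaussian_process_L4 i).1. Qed.

Let meanZ i : mean P (Z i) = 0.
Proof. by have := cZ i; rewrite expectation_mean; [case|exact: L4_int]. Qed.

(** All linear combinations are centered Gaussian, so polarization applies. *)
Lemma gaussian_process_isserlis i j k l : isserlis P (Z i) (Z j) (Z k) (Z l).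
Proof.
apply: isserlis_polarization => // x y z t G.
have GE : G = fun w => 1 * (1 * (x * Z i w + y * Z j w) + z * Z k w) + t * Z l w.
  by apply/funext => w; rewrite /G; ring.
have L2 := L4_lin x y (LZ i) (LZ j); have L3 := L4_lin 1 z L2 (LZ k).
have LG : L4 P G by rewrite GE; exact: L4_lin.
apply: (centered_gaussian_L4 LG.1 _ _).2; last first.
  rewrite expectation_mean; last exact: L4_int.
  rewrite GE (mean_lin _ _ (L4_int L3) (L4_int (LZ l))).2.
  rewrite (mean_lin _ _ (L4_int L2) (L4_int (LZ k))).2.
  rewrite (mean_lin _ _ (L4_int (LZ i)) (L4_int (LZ j))).2 !meanZ.
  by congr EFin; ring.
have := gZ (tnth [tuple i; j; k; l]) (tnth [tuple x; y; z; t]).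
congr is_gaussian; apply/funext => w; rewrite /G !big_ord_recl big_ord0.
by rewrite !(tnth_nth i) !(tnth_nth x) /= /bump/= addr0 !addrA.
Qed.

Lemma centered_covariance i j :
  covariance P (Z i) (Z j) = (mean P (fun w => Z i w * Z j w))%:E.
Proof.
rewrite covariance.unlock !cZ /= -expectation_mean; last exact: L4_int2.
congr expectation; apply/funext => w.
by rewrite -[LHS]/((Z i w - 0) * (Z j w - 0)) !subr0.
Qed.

End gaussian_families.

Section fractional_brownian_motion.
Context d (T : measurableType d) (R : realType) (P : probability T R).

Lemma powR_le_exprn (p x : R) n : 0 <= p <= n%:R -> 0 <= x -> x `^ p <= (1 + x) ^+ n.
Proof.
move=> /andP[p0 pn] x0; apply: (@le_trans _ _ ((1 + x) `^ p)).
  by apply: ge0_ler_powR; rewrite ?nnegrE ?addr_ge0// lerDr.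
by rewrite -powR_mulrn ?addr_ge0//; apply: ler_powR => //; rewrite lerDl.
Qed.

Variables (h : R) (X : R -> {RV P >-> R}).
Hypotheses (h01 : 0 < h < 1) (fX : is_fbm h X).
Local Notation E := (mean P).

Lemma fbm_covariance : exists c, forall s t,
  E (fun w => X s w * X t w) =
  c * `|s| `^ (2 * h) + c * `|t| `^ (2 * h) - c * `|t - s| `^ (2 * h).
Proof.
have [gX cX [sigma _ covX] _] := fX; exists (sigma ^+ 2 / 2) => s t.
have := covX s t; rewrite (centered_covariance (fun t => measurable_funPT (X t)) gX cX s t).
by case=> ->; rewrite (distrC t s); ring.
Qed.

Let LX t : L4 P (X t).
Proof.
have [gX cX _ _] := fX.
exact: (gaussian_process_L4 (fun t => measurable_funPT (X t)) gX cX t).1.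
Qed.

Lemma regular_fbm : regular_process P (fun t => X t : T -> R).
Proof.
have [gX cX _ pX] := fX; split=> //.
have [c hc] := fbm_covariance; exists (3 * (2 * c) ^+ 2) => t.
rewrite (gaussian_process_L4 (fun t => measurable_funPT (X t)) gX cX t).2.
rewrite (_ : E (fun w => X t w ^+ 2) = 2 * c * `|t| `^ (2 * h)); last first.
  rewrite (_ : (fun w => _) = fun w => X t w * X t w).
    rewrite hc subrr normr0 powR0 ?mulr0 ?subr0; first by ring.
    by rewrite mulf_neq0 ?gt_eqF//; case/andP: h01.
  by apply/funext => w; rewrite expr2.
rewrite exprMn mulrA ler_wpM2l//; first by rewrite pmulr_rge0// sqr_ge0.
rewrite -[4%N]/(2 * 2)%N exprM.
rewrite lerXn2r ?nnegrE ?powR_ge0 ?exprn_ge0 ?addr_ge0// powR_le_exprn//.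
by case/andP: h01 => h0 h1; apply/andP; split; lra.
Qed.

Lemma fbm_increment_variance : exists C, forall s u,
  E (fun w => (X s w - X (s - u) w) ^+ 2) <= C * (1 + `|u|) ^+ 4.
Proof.
have [c hc] := fbm_covariance; exists `|2 * c| => s u.
rewrite (_ : (fun w => _) = fun w => (1 * X s w + (-1) * X (s - u) w) *
    (1 * X s w + (-1) * X (s - u) w)); last by apply/funext => w; ring.
rewrite mean_linl//; last exact: L4_lin.
rewrite !mean_linr// !hc !subrr normr0 powR0 ?mulr0 ?subr0; last first.
  by rewrite mulf_neq0 ?gt_eqF//; case/andP: h01.
rewrite (_ : s - u - s = - u); last by ring.
rewrite (_ : s - (s - u) = u); last by ring.
rewrite normrN.
rewrite (_ : 1 * _ + _ = 2 * c * `|u| `^ (2 * h)); last by ring.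
apply: le_trans (ler_norm _) _; rewrite normrM ler_wpM2l// ger0_norm ?powR_ge0//.
apply: powR_le_exprn => //.
by case/andP: h01 => h0 h1; apply/andP; split; lra.
Qed.

End fractional_brownian_motion.

(** * A law of large numbers in mean square *)

Section mean_square_convergence.
Context d (T : measurableType d) (R : realType) (P : probability T R).
Implicit Types f g : T -> R.

Let Int f := P.-integrable setT (EFin \o f).

Definition L2 f := measurable_fun setT f /\ Int (fun w => f w ^+ 2).

Lemma L2_int2 f g : L2 f -> L2 g -> Int (fun w => f w * g w).
Proof.
move=> [mf lf] [mg lg]; apply: le_integrable (mean_lin 1 1 lf lg).1 => //.
  by apply/measurable_EFinP; exact: measurable_funM.
move=> w _; rewrite lee_fin !mul1r.
have := sqr_ge0 (`|f w| - `|g w|); rewrite sqrrB !real_normK ?num_real// normrM -mulr_natl.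
have := sqr_ge0 (f w); have := sqr_ge0 (g w) => h1 h2.
by rewrite (ger0_norm (addr_ge0 h2 h1)); have := normr_ge0 (f w); have := normr_ge0 (g w); nra.
Qed.

Lemma L2_cst (r : R) : L2 (fun=> r).
Proof. by split => //; exact: finite_measure_integrable_cst. Qed.

Lemma L2_int f : L2 f -> Int f.
Proof.
move=> lf; have := L2_int2 lf (L2_cst 1).
by congr (Int _); apply/funext => w; rewrite mulr1.
Qed.

Lemma L2_lin (x y : R) f g : L2 f -> L2 g -> L2 (fun w => x * f w + y * g w).
Proof.
move=> lf lg; have [mf _] := lf; have [mg _] := lg.
split; first by apply: measurable_funD; exact: measurable_funM.
have il x' y' f' g' fi gi := (@mean_lin _ _ _ P x' y' f' g' fi gi).1.
have := il 1 1 _ _ (il (x ^+ 2) (2 * x * y) _ _ (L2_int2 lf lf) (L2_int2 lf lg))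
  (il (y ^+ 2) 0 _ _ (L2_int2 lg lg) (L2_int2 lg lg)).
by congr (Int _); apply/funext => w; ring.
Qed.

Lemma L2_sum (X : nat -> T -> R) n : (forall j, L2 (X j)) ->
  L2 (fun w => \sum_(0 <= j < n) X j w).
Proof.
move=> LX; elim: n => [|n IHn].
  rewrite (_ : (fun w => _) = fun=> 0); first exact: L2_cst.
  by apply/funext => w; rewrite big_nil.
have := L2_lin 1 1 IHn (LX n); congr L2.
by apply/funext => w; rewrite big_nat_recr//= !mul1r.
Qed.

Lemma L4_L2 f g : L4 P f -> L4 P g -> L2 (fun w => f w * g w).
Proof.
move=> lf lg; split; first by apply: measurable_funM; [case: lf|case: lg].
have := L4_int4 lf lg lf lg.
by congr (Int _); apply/funext => w; rewrite expr2 !mulrA.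
Qed.

Lemma L2_Lfun f : L2 f -> f \in Lfun P 2%:E.
Proof.
move=> [mf lf]; rewrite inE; apply/andP; split; rewrite inE//=.
rewrite /finite_norm unlock /Lnorm poweR_lty//.
have := integrable_lty measurableT lf; congr (_ < _)%E.
by apply: eq_integral => w _; rewrite /= powR_mulrn// real_normK ?num_real.
Qed.

Definition cvg_mean2 (X : nat -> T -> R) (l : R) : Prop :=
  (forall n, L2 (X n)) /\ mean P (fun w => (X n w - l) ^+ 2) @[n --> \oo] --> (0 : R).

Let L2B f (l : R) : L2 f -> L2 (fun w => f w - l).
Proof.
move=> lf; have := L2_lin 1 (- l) lf (L2_cst 1); congr L2.
by apply/funext => w; rewrite mul1r mulr1.
Qed.

Let mean2_ge0 f : 0 <= mean P (fun w => f w ^+ 2).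
Proof. by apply: Rintegral_ge0 => w _; exact: sqr_ge0. Qed.

Lemma cvg_mean2_lin (x y : nat -> R) (x0 y0 l m : R) (X Y : nat -> T -> R) :
  x n @[n --> \oo] --> x0 -> y n @[n --> \oo] --> y0 ->
  cvg_mean2 X l -> cvg_mean2 Y m ->
  cvg_mean2 (fun n w => x n * X n w + y n * Y n w) (x0 * l + y0 * m).
Proof.
move=> cx cy [LX cX] [LY cY]; split; first by move=> n; exact: L2_lin.
(* The error splits into three terms, and the square of a sum of three terms is
   at most three times the sum of their squares. *)
pose c n := (x n * l + y n * m - (x0 * l + y0 * m)) ^+ 2.
pose B n := 3 * (x n ^+ 2 * mean P (fun w => (X n w - l) ^+ 2) +
  y n ^+ 2 * mean P (fun w => (Y n w - m) ^+ 2)) + 3 * c n.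
have c0 : c n @[n --> \oo] --> (0 : R).
  rewrite (_ : (0 : R) = (x0 * l + y0 * m - (x0 * l + y0 * m)) ^+ 2).
    have cc : x n * l + y n * m - (x0 * l + y0 * m) @[n --> \oo] -->
        x0 * l + y0 * m - (x0 * l + y0 * m).
      by apply: cvgB; [apply: cvgD; exact: cvgMl|exact: cvg_cst].
    by rewrite /c; under eq_fun do rewrite expr2; rewrite expr2; exact: cvgM.
  by rewrite subrr expr0n.
have B0 : B n @[n --> \oo] --> (0 : R).
  rewrite (_ : (0 : R) = 3 * (x0 * x0 * 0 + y0 * y0 * 0) + 3 * 0); last by ring.
  apply: cvgD; last exact: cvgMr.
  by apply: cvgMr; apply: cvgD; apply: cvgM => //; under eq_fun do rewrite expr2; exact: cvgM.
apply: (squeeze_cvgr _ (cvg_cst 0) B0); apply: nearW => n; rewrite mean2_ge0/=.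
have LA := L2B l (LX n); have LB := L2B m (LY n).
have [i1 e1] := mean_lin (x n ^+ 2) (y n ^+ 2) LA.2 LB.2.
have [i2 e2] := mean_lin 3 (3 * c n) i1 (L2_int (L2_cst 1)).
have -> : B n = mean P (fun w =>
    3 * (x n ^+ 2 * (X n w - l) ^+ 2 + y n ^+ 2 * (Y n w - m) ^+ 2) + 3 * c n * 1).
  by rewrite e2 mean_cst mulr1 e1.
apply: le_mean => //.
  exact: (L2B _ (L2_lin _ _ (LX n) (LY n))).2.
move=> w; rewrite mulr1 /c.
set p := X n w - l; set q := Y n w - m; set r := x n * l + _ - _.
have -> : x n * X n w + y n * Y n w - (x0 * l + y0 * m) = x n * p + y n * q + r.
  by rewrite /p /q /r; ring.
rewrite -!exprMn; move: (x n * p) (y n * q) r => u v z.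
have := sqr_ge0 (u - v); have := sqr_ge0 (u - z); have := sqr_ge0 (v - z); nra.
Qed.

Lemma cvg_mean2_L2 (X : nat -> T -> R) (l : R) : cvg_mean2 X l -> cvg_L2 P X (cst l).
Proof.
move=> [LX cX]; split; first by move=> n; exact: L2_Lfun.
  exact: Lfun_cst.
rewrite (_ : (fun n => _) = fun n => (mean P (fun w => (X n w - l) ^+ 2))%:E); last first.
  by apply/funext => n; rewrite expectation_mean//; exact: (L2B l (LX n)).2.
by apply: cvg_EFin => //; exact: nearW.
Qed.

(** Chebyshev's inequality. *)
Lemma cvg_mean2_in_probability (X : nat -> T -> R) (l : R) : cvg_mean2 X l ->
  cvg_in_probability P X (cst l).
Proof.
move=> [LX cX] eps eps0.
have c0 : ((eps ^- 2 * mean P (fun w => (X n w - l) ^+ 2))%:E)%E @[n --> \oo] --> 0%E.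
  apply: cvg_EFin; first exact: nearW.
  by rewrite -(mulr0 (eps ^- 2)); exact: cvgMr.
apply: (squeeze_cvge _ (cvg_cst 0%E) c0); apply: nearW => n; rewrite measure_ge0/=.
have LA := L2B l (LX n).
set S := [set w | _].
have mN : measurable_fun setT (fun w => `|X n w - l|).
  by apply: measurableT_comp => //; exact: LA.1.
have mS : measurable S.
  have := mN measurableT `]eps, +oo[%classic (measurable_itv _).
  rewrite setTI; congr measurable; apply/seteqP; split => w /=;
    by rewrite in_itv/= andbT.
have iB : Int (fun w => eps ^- 2 * (X n w - l) ^+ 2 + 0 * (X n w - l) ^+ 2).
  exact: (mean_lin _ _ LA.2 LA.2).1.
have -> : (eps ^- 2 * mean P (fun w => (X n w - l) ^+ 2))%:E =
    (\int[P]_w (eps ^- 2 * (X n w - l) ^+ 2 + 0 * (X n w - l) ^+ 2)%:E)%E.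
  have := (mean_lin (eps ^- 2) 0 LA.2 LA.2).2; rewrite mul0r addr0 => <-.
  by rewrite /mean /Rintegral fineK//; exact: integrable_fin_num.
rewrite -[P S]/(P S) -[S]setIT -integral_indic//.
apply: ge0_le_integral => //.
- by apply/measurable_EFinP; exact: measurable_indic.
- by case/integrableP: iB.
move=> w _; rewrite lee_fin mul0r addr0 indicE.
case: (boolP (w \in S)) => [|_]; last by rewrite mulr_ge0 ?sqr_ge0// invr_ge0 sqr_ge0.
rewrite inE /S/= => ew; rewrite mulrC ler_pdivlMr ?exprn_gt0// mul1r.
by rewrite -[leRHS]real_normK ?num_real// lerXn2r ?nnegrE// ltW.
Qed.

Section stationary_sequence.
Variables (Z : nat -> T -> R) (r : nat -> R).
Hypothesis LZ : forall j, L2 (Z j).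
Hypothesis covZ : forall j m, mean P (fun w => Z j w * Z (j + m) w) = r m.
Hypothesis r0 : r m @[m --> \oo] --> (0 : R).

Let S n w := \sum_(0 <= j < n) Z j w.

Let meanSZ n : mean P (fun w => S n w * Z n w) = \sum_(0 <= j < n) r (n - j)%N.
Proof.
suff H k : (k <= n)%N -> mean P (fun w => S k w * Z n w) = \sum_(0 <= j < k) r (n - j)%N.
  exact: H.
elim: k => [|k IHk] kn.
  rewrite big_nil -[RHS](mean_cst P 0); congr mean; apply/funext => w.
  by rewrite /S big_nil mul0r.
rewrite big_nat_recr//= -(IHk (ltnW kn)).
have -> : r (n - k)%N = mean P (fun w => Z k w * Z n w).
  by rewrite -(covZ k) subnKC// ltnW.
rewrite -[X in _ = X + _]mul1r -[X in _ = _ + X]mul1r.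
rewrite -(mean_lin 1 1 (L2_int2 (L2_sum k LZ) (LZ n)) (L2_int2 (LZ k) (LZ n))).2.
by congr mean; apply/funext => w; rewrite /S big_nat_recr//=; ring.
Qed.

Let mean_sqrS n : mean P (fun w => S n w ^+ 2) <= 2 * n%:R * \sum_(0 <= j < n) `|r j|.
Proof.
elim: n => [|n IHn].
  rewrite big_nil mulr0 -[leRHS](mean_cst P 0) le_eqVlt; apply/orP; left; apply/eqP.
  by congr mean; apply/funext => w; rewrite /S big_nil expr0n.
have LS := L2_sum n LZ.
have -> : mean P (fun w => S n.+1 w ^+ 2) =
    mean P (fun w => S n w ^+ 2) + 2 * mean P (fun w => S n w * Z n w) + r 0%N.
  have -> : r 0%N = mean P (fun w => Z n w * Z n w) by rewrite -(covZ n) addn0.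
  have [i1 e1] := mean_lin 1 2 LS.2 (L2_int2 LS (LZ n)).
  have [i2 e2] := mean_lin 1 1 i1 (L2_int2 (LZ n) (LZ n)).
  rewrite -[X in _ = X + _ + _]mul1r -e1.
  rewrite -[X in _ = X + _]mul1r -[X in _ = _ + X]mul1r -e2.
  by congr mean; apply/funext => w; rewrite /S big_nat_recr//=; ring.
set A := \sum_(0 <= j < n.+1) `|r j|.
have An : \sum_(0 <= j < n) `|r j| <= A by rewrite /A big_nat_recr//= lerDl.
have h1 : 2 * mean P (fun w => S n w * Z n w) + r 0%N <= 2 * A.
  have : mean P (fun w => S n w * Z n w) + r 0%N <= A.
    rewrite meanSZ -[X in _ + r X](subnn n).
    rewrite -(big_nat_recr n 0 (fun j => r (n - j)%N))//= big_nat_rev/= add0n.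
    by apply: ler_sum_nat => j /andP[_ jn]; rewrite subSS subKn// ler_norm.
  have : mean P (fun w => S n w * Z n w) <= A.
    rewrite meanSZ big_nat_rev/= add0n /A big_nat_recl//= -[leLHS]add0r lerD//.
    apply: ler_sum_nat => j /andP[_ jn].
    by rewrite subKn// ler_norm.
  lra.
rewrite -addrA (_ : 2 * n.+1%:R * A = 2 * n%:R * A + 2 * A) ?lerD//; last first.
  by rewrite -[n.+1%:R]natr1; ring.
by rewrite (le_trans IHn)// ler_wpM2l// mulr_ge0.
Qed.

(** Decorrelation at large lags makes the averages of a stationary centered
    sequence negligible: by counting pairs of indices at each distance, the
    variance of the average is at most twice a Cesaro mean of the covariances. *)
Lemma cvg_mean2_average : cvg_mean2 (fun n w => n%:R^-1 * \sum_(0 <= j < n) Z j w) 0.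
Proof.
have LS n : L2 (fun w => n%:R^-1 * S n w).
  have := L2_lin n%:R^-1 0 (L2_sum n LZ) (L2_cst 0); congr L2.
  by apply/funext => w; rewrite mulr0 addr0.
split => //.
have Cr : 2 * arithmetic_mean (fun j => `|r j|) n @[n --> \oo] --> (0 : R).
  rewrite -(mulr0 2); apply: cvgMr; apply: cesaro.
  by rewrite -(normr0 R); exact: cvg_norm.
rewrite -cvg_shiftS.
apply: (squeeze_cvgr _ (cvg_cst 0) Cr); apply: nearW => n; rewrite mean2_ge0/=.
have -> : mean P (fun w => (n.+1%:R^-1 * \sum_(0 <= j < n.+1) Z j w - 0) ^+ 2) =
    n.+1%:R ^- 2 * mean P (fun w => S n.+1 w ^+ 2).
  have LS1 := (L2_sum n.+1 LZ).2.
  have := (mean_lin (n.+1%:R ^- 2) 0 LS1 LS1).2; rewrite mul0r addr0 => <-.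
  congr mean; apply/funext => w.
  by rewrite subr0 mul0r addr0 exprMn exprVn.
rewrite mulrC ler_pdivrMr ?exprn_gt0//.
apply: le_trans (mean_sqrS n.+1) _.
rewrite /arithmetic_mean/= seriesEnat/= le_eqVlt; apply/orP; left; apply/eqP.
by field.
Qed.

End stationary_sequence.

End mean_square_convergence.

Section lagged_averages.
Context d (T : measurableType d) (R : realType) (P : probability T R).
Local Notation E := (mean P).

Lemma cvg_mean2_cst (l : R) : cvg_mean2 P (fun _ _ => l) l.
Proof.
split; first by move=> n; exact: L2_cst.
rewrite (_ : (fun _ => _) = fun=> 0); first exact: cvg_cst.
by apply/funext => n; rewrite -[RHS](mean_cst P 0); congr mean; apply/funext => w;
  rewrite subrr expr0n.
Qed.

Lemma cvg_truncated_ratio s : (n - s)%:R / n%:R @[n --> \oo] --> (1 : R).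
Proof.
rewrite -cvg_shiftS.
have h : 1 - s%:R * harmonic n @[n --> \oo] --> (1 : R).
  rewrite -[X in _ --> X]subr0; apply: cvgB; first exact: cvg_cst.
  by rewrite -(mulr0 s%:R); apply: cvgMr; exact: cvg_harmonic.
apply: cvg_trans h; apply: near_eq_cvg; near=> n.
have sn : (s <= n)%N by near: n; exact: nbhs_infty_ge.
rewrite /harmonic/= natrB; last exact: leq_trans sn _.
by field.
Unshelve. all: end_near. Qed.

(** The numbers of terms of the full and of the truncated sums are equivalent, so
    both averages have the same limit. *)
Lemma cvg_mean2_truncated (U : nat -> T -> R) (l : R) s :
  cvg_mean2 P (fun n w => n%:R^-1 * \sum_(1 <= j < n.+1) U j w) l ->
  cvg_mean2 P (fun n w => n%:R^-1 * \sum_(1 <= j < (n - s).+1) U j w) l.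
Proof.
move=> [LU cU].
have cUs : cvg_mean2 P
    (fun n w => (n - s)%:R^-1 * \sum_(1 <= j < (n - s).+1) U j w) l.
  split; first by move=> n; exact: LU.
  apply: (@cvg_comp _ _ _ (subn^~ s)
    (fun n => E (fun w => (n%:R^-1 * \sum_(1 <= j < n.+1) U j w - l) ^+ 2)) _ _ _ _ cU).
  exact: cvg_subnr.
have c0 : (0 : R) @[n --> \oo] --> (0 : R) by exact: cvg_cst.
have := cvg_mean2_lin (cvg_truncated_ratio s) c0 cUs (cvg_mean2_cst 0).
rewrite mul1r mulr0 addr0; congr cvg_mean2.
apply/funext => n; apply/funext => w; rewrite addr0.
have [->|ns] := eqVneq (n - s)%N 0%N; first by rewrite big_nil !mulr0.
have n0 : n%:R != 0 :> R.
  by rewrite pnatr_eq0; apply: contraNneq ns => ->; rewrite sub0n.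
by move: (\sum_(_ <= _ < _) _) => A; field; rewrite n0 pnatr_eq0.
Qed.

Variables (Y1 Y2 : R -> T -> R) (c11 c22 c12 : R -> R).
Hypothesis LY1 : forall t, L4 P (Y1 t).
Hypothesis LY2 : forall t, L4 P (Y2 t).
Hypothesis isserlisY : forall s t u v, isserlis P (Y1 s) (Y2 t) (Y1 u) (Y2 v).
Hypothesis cov11 : forall s t, E (fun w => Y1 s w * Y1 t w) = c11 (t - s).
Hypothesis cov22 : forall s t, E (fun w => Y2 s w * Y2 t w) = c22 (t - s).
Hypothesis cov12 : forall s t, E (fun w => Y1 s w * Y2 t w) = c12 (t - s).
Hypothesis decay11 : forall x : nat -> R,
  x n @[n --> \oo] --> +oo -> c11 (x n) @[n --> \oo] --> (0 : R).
Hypothesis decay22 : forall x : nat -> R,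
  x n @[n --> \oo] --> +oo -> c22 (x n) @[n --> \oo] --> (0 : R).
Hypothesis decay12 : forall x : nat -> R,
  x n @[n --> \oo] --> +oo -> c12 (x n) @[n --> \oo] --> (0 : R).
Hypothesis decay21 : forall x : nat -> R,
  x n @[n --> \oo] --> +oo -> c12 (- x n) @[n --> \oo] --> (0 : R).

Let cvg_natD (b : R) : n%:R + b @[n --> \oo] --> (+oo : set_system R).
Proof.
apply/cvgryPge => A; near=> n; rewrite -lerBlDr; near: n.
exact: nbhs_infty_ger.
Unshelve. all: end_near. Qed.

Let cvg_nat : n%:R @[n --> \oo] --> (+oo : set_system R).
Proof. by have := @cvg_natD 0; under eq_fun do rewrite addr0. Qed.

(** The products [Y1 Y2] along a lag form a stationary sequence, whose
    covariances reduce to those of the processes by Isserlis' formula. *)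
Lemma cvg_mean2_lagged a b :
  cvg_mean2 P (fun n w =>
    n%:R^-1 * \sum_(1 <= j < n.+1) Y1 (j + a)%:R w * Y2 (j + b)%:R w) (c12 (b%:R - a%:R)).
Proof.
set l := c12 _.
pose U j w := Y1 (j + a)%:R w * Y2 (j + b)%:R w.
have LU j : L2 P (U j) by exact: L4_L2.
have meanU j : E (U j) = l by rewrite /U cov12 !natrD; congr c12; ring.
pose Z j w := 1 * U j.+1 w + (- l) * 1.
have LZ j : L2 P (Z j) by apply: L2_lin; [exact: LU|exact: L2_cst].
pose r m : R := c11 m%:R * c22 m%:R +
  c12 (m%:R + (b%:R - a%:R)) * c12 (- (m%:R + (a%:R - b%:R))).
have covZ j m : E (fun w => Z j w * Z (j + m)%N w) = r m.
  have iU j' := L2_int (LU j').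
  have i1 := L2_int (L2_cst P (1 : R)).
  have [iL eL] := mean_lin (- l) (l * l) (iU (j + m).+1) i1.
  have [iM eM] := mean_lin (- l) 1 (iU j.+1) iL.
  have [iN eN] := mean_lin 1 1 (L2_int2 (LU j.+1) (LU (j + m).+1)) iM.
  transitivity (E (fun w => 1 * (U j.+1 w * U (j + m).+1 w) +
      1 * (- l * U j.+1 w + 1 * (- l * U (j + m).+1 w + l * l * 1)))).
    by congr mean; apply/funext => w; rewrite /Z; ring.
  rewrite eN eM eL !meanU mean_cst.
  rewrite (_ : (fun w => U _ w * U _ w) = fun w => Y1 (j.+1 + a)%:R w * Y2 (j.+1 + b)%:R w *
     Y1 ((j + m).+1 + a)%:R w * Y2 ((j + m).+1 + b)%:R w); last first.
    by apply/funext => w; rewrite /U; ring.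
  rewrite isserlisY (meanC _ (Y2 _) (Y1 _)) !cov12 cov11 cov22.
  rewrite (_ : (j.+1 + b)%:R - (j.+1 + a)%:R = b%:R - a%:R); last by rewrite !natrD; ring.
  rewrite (_ : ((j + m).+1 + b)%:R - ((j + m).+1 + a)%:R = b%:R - a%:R); last first.
    by rewrite !natrD; ring.
  rewrite (_ : ((j + m).+1 + a)%:R - (j.+1 + a)%:R = m%:R); last first.
    by rewrite -addSn !natrD; ring.
  rewrite (_ : ((j + m).+1 + b)%:R - (j.+1 + b)%:R = m%:R); last first.
    by rewrite -addSn !natrD; ring.
  rewrite (_ : ((j + m).+1 + b)%:R - (j.+1 + a)%:R = m%:R + (b%:R - a%:R)); last first.
    by rewrite -addSn !natrD; ring.
  rewrite (_ : (j.+1 + b)%:R - ((j + m).+1 + a)%:R = - (m%:R + (a%:R - b%:R))); last first.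
    by rewrite -addSn !natrD; ring.
  by rewrite /r -/l; ring.
have r0 : r m @[m --> \oo] --> (0 : R).
  rewrite (_ : (0 : R) = 0 * 0 + 0 * 0); last by rewrite mulr0 addr0.
  apply: cvgD; apply: cvgM.
  - by apply: decay11; exact: cvg_nat.
  - by apply: decay22; exact: cvg_nat.
  - by apply: decay12; exact: cvg_natD.
  - by apply: decay21; exact: cvg_natD.
have c1 : (1 : R) @[n --> \oo] --> (1 : R) by exact: cvg_cst.
have := cvg_mean2_lin c1 (cvg_truncated_ratio 0) (cvg_mean2_average LZ covZ r0)
  (cvg_mean2_cst l).
rewrite mulr0 add0r mul1r; congr cvg_mean2.
apply/funext => n; apply/funext => w; rewrite mul1r big_add1/= /Z big_split/=.
rewrite sumr_const_nat subn0 -mulr_sumr mulr1 mul1r mulNrn -mulr_natr.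
by rewrite mulrDr; ring.
Qed.

Lemma cvg_mean2_cross_estimator c1 c2 c3 s :
  cvg_mean2 P (cross_estimator c1 c2 c3 s Y1 Y2)
    (c1 * c12 0 + c2 * c12 (- s%:R) + c3 * c12 s%:R).
Proof.
have h0 := cvg_mean2_lagged 0 0; rewrite subrr in h0.
have h1 := cvg_mean2_truncated s (cvg_mean2_lagged s 0); rewrite sub0r in h1.
have h2 := cvg_mean2_truncated s (cvg_mean2_lagged 0 s); rewrite subr0 in h2.
have cc (c : R) : c @[n --> \oo] --> c by exact: cvg_cst.
have := cvg_mean2_lin (cc 1) (cc c3) (cvg_mean2_lin (cc c1) (cc c2) h0 h1) h2.
rewrite mul1r; congr cvg_mean2; apply/funext => n; apply/funext => w.
rewrite /cross_estimator mul1r !mulrA.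
by congr (_ * _ + _ * _ + _ * _); apply: eq_bigr => j _; rewrite addn0.
Qed.

End lagged_averages.

(** * Consistency of the estimators *)

Section bivariate_fractional_brownian_motion.
Context d (T : measurableType d) (R : realType) (P : probability T R).
Variables (H1 H2 rho eta : R) (B1 B2 : R -> {RV P >-> R}).
Hypotheses (H1_01 : 0 < H1 < 1) (H2_01 : 0 < H2 < 1).
Hypotheses (hB : is_bivariate_fbm H1 H2 B1 B2) (hcorr : bfbm_correlation H1 H2 rho eta B1 B2).
Local Notation E := (mean P).
Local Notation H := (H1 + H2).

Let Z (i : R + R) : T -> R := match i with inl t => B1 t | inr t => B2 t end.

Let mZ i : measurable_fun setT (Z i).
Proof. by case: i => t; exact: measurable_funPT. Qed.

Let cZ : centered P Z.
Proof.
by case=> t; [have [_ c _ _] := bfbm_fbm1 hB|have [_ c _ _] := bfbm_fbm2 hB]; exact: c.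
Qed.

Let gZ : gaussian_process P Z. Proof. exact: (bfbm_gaussian hB). Qed.

Lemma bfbm_isserlis i j k l : isserlis P (Z i) (Z j) (Z k) (Z l).
Proof. exact: gaussian_process_isserlis. Qed.

Lemma bfbm_regular1 : regular_process P (fun t => B1 t : T -> R).
Proof. exact: regular_fbm H1_01 (bfbm_fbm1 hB). Qed.

Lemma bfbm_regular2 : regular_process P (fun t => B2 t : T -> R).
Proof. exact: regular_fbm H2_01 (bfbm_fbm2 hB). Qed.

Lemma bfbm_cross t u : E (fun w => B1 t w * B2 u w) =
  2^-1 * ((rho + sign t * eta) * `|t| `^ H + (rho - sign u * eta) * `|u| `^ H
    - (rho - sign (u - t) * eta) * `|u - t| `^ H).
Proof.
by have := hcorr.2 t u; rewrite (centered_covariance mZ gZ cZ (inl t) (inr u)); case.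
Qed.

Let H0 : H != 0. Proof. by rewrite gt_eqF// addr_gt0; case/andP: H1_01; case/andP: H2_01. Qed.

Let sign_powR (x c e : R) : 0 <= x -> (c + sign x * e) * `|x| `^ H = (c + e) * x `^ H.
Proof. by move=> x0; rewrite /sign x0 mul1r ger0_norm. Qed.

Let sign_powRN (x c e : R) : 0 <= x -> (c + sign (- x) * e) * `|- x| `^ H = (c - e) * x `^ H.
Proof.
rewrite le_eqVlt => /predU1P[<-|x0]; first by rewrite oppr0 normr0 powR0// !mulr0.
by rewrite /sign oppr_ge0 leNgt x0 mulN1r normrN gtr0_norm.
Qed.

(** At times of opposite signs the three coefficients of the covariance agree:
    they are [rho + eta] when the first motion is at the positive time, and
    [rho - eta] when it is at the negative one. This asymmetry is what makes both
    parameters visible. *)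
Lemma bfbm_cross_quadrant u v : 0 <= u -> 0 <= v ->
  E (fun w => B1 u w * B2 (- v) w) = (rho + eta) / 2 * (u `^ H + v `^ H - (u + v) `^ H).
Proof.
move=> u0 v0; rewrite bfbm_cross -opprD (addrC v) sign_powR// -!(mulrN (sign _)).
by rewrite !sign_powRN ?addr_ge0//; field.
Qed.

Lemma bfbm_cross_quadrantC u v : 0 <= u -> 0 <= v ->
  E (fun w => B2 u w * B1 (- v) w) = (rho - eta) / 2 * (u `^ H + v `^ H - (u + v) `^ H).
Proof.
move=> u0 v0; rewrite meanC bfbm_cross opprK -!(mulrN (sign _)).
by rewrite sign_powRN// !sign_powR ?addr_ge0//; field.
Qed.

End bivariate_fractional_brownian_motion.

(** With [I] and [J] the two cross integrals, the lag formula expresses the three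
    limits through the unknowns [m], [rho + eta] and [rho - eta]; the weights are
    the solution of this linear system that eliminates [m]. *)
Lemma weights_recover_parameters (R : realType) (m rho eta nu1 nu2 H e1 e2 I J : R) :
  0 < nu1 -> 0 < nu2 -> 0 < H -> H != 1 -> 0 < e1 -> 0 < e2 -> 0 < I -> 0 < J ->
  let m1 := e1 * (m + nu1 * nu2 * ((rho + eta) / 2) * (H * (H - 1)) * I) in
  let m2 := e2 * (m + nu2 * nu1 * ((rho - eta) / 2) * (H * (H - 1)) * J) in
  let K := nu1 * nu2 * H * (H - 1) in
  - ((I + J) / (K * I * J)) * m + 1 / (K * e1 * I) * m1 + 1 / (K * e2 * J) * m2 = rho /\
  (I - J) / (K * I * J) * m + 1 / (K * e1 * I) * m1 + - (1 / (K * e2 * J)) * m2 = eta.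
Proof.
move=> ? ? ? H1 ? ? ? ? m1 m2 K; rewrite /m1 /m2 /K.
by split; field; rewrite subr_eq0 H1 !gt_eqF.
Qed.

Section bivariate_ornstein_uhlenbeck.
Context d (T : measurableType d) (R : realType) (P : probability T R).
Variables (H1 H2 alpha1 alpha2 nu1 nu2 rho eta : R) (B1 B2 : R -> {RV P >-> R}) (s : nat).
Hypotheses (H1_01 : 0 < H1 < 1) (H2_01 : 0 < H2 < 1) (H_neq1 : H1 + H2 != 1).
Hypotheses (a1 : 0 < alpha1) (a2 : 0 < alpha2) (nu1_gt0 : 0 < nu1) (nu2_gt0 : 0 < nu2).
Hypotheses (hB : is_bivariate_fbm H1 H2 B1 B2) (hcorr : bfbm_correlation H1 H2 rho eta B1 B2).
Hypothesis s1 : (1 <= s)%N.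
Local Notation E := (mean P).
Local Notation H := (H1 + H2).
Local Notation Y1 := (ou nu1 a1 (fun t => B1 t : T -> R)).
Local Notation Y2 := (ou nu2 a2 (fun t => B2 t : T -> R)).

Let rB1 := bfbm_regular1 H1_01 hB.
Let rB2 := bfbm_regular2 H2_01 hB.
Let vB1 := fbm_increment_variance H1_01 (bfbm_fbm1 hB).
Let vB2 := fbm_increment_variance H2_01 (bfbm_fbm2 hB).
Let H02 : 0 < H < 2.
Proof. by move: H1_01 H2_01 => /andP[? ?] /andP[? ?]; apply/andP; split; lra. Qed.

(** The formula holds for the fractional Brownian motions, and the
    Ornstein-Uhlenbeck processes are linear in them. *)
Lemma ou_isserlis t u v x : isserlis P (Y1 t) (Y2 u) (Y1 v) (Y2 x).
Proof.
pose C f := (exists t, f = B1 t :> (T -> R)) \/ exists t, f = B2 t :> (T -> R).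
pose C' f := (exists t, f = Y1 t) \/ exists t, f = Y2 t.
apply: (@isserlis_extend _ _ _ P C C'); last first.
- by right; exists x.
- by left; exists v.
- by right; exists u.
- by left; exists t.
- have CZ f : C f -> exists i : R + R, f = match i with inl t => B1 t | inr t => B2 t end.
    by case=> -[y ->]; [exists (inl y)|exists (inr y)].
  move=> _ _ _ _ /CZ[i ->] /CZ[j ->] /CZ[k ->] /CZ[l ->].
  exact: (bfbm_isserlis hB).
- move=> f b c e [[y ->]|[y ->]] lb lc le h; apply: isserlis_ou => // z; apply: h.
  + by left; exists z.
  + by right; exists z.
- by move=> f [[y ->]|[y ->]]; exact: L4_ou.
- by move=> f [[y ->]|[y ->]]; [exact: (regular_L4 rB1)|exact: (regular_L4 rB2)].
Qed.

Let decay (h c : R) (g : R -> R) : 0 < h < 2 -> (forall y, 0 < y -> g y = c * y `^ h) ->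
  forall x : nat -> R, x n @[n --> \oo] --> +oo ->
  forall u v, second_diff g (x n) u v @[n --> \oo] --> (0 : R).
Proof. by move=> h02 gE x xy u v; exact: second_diff_powR gE xy. Qed.

Let decay_ou (h nu a : R) (a0 : 0 < a) (B : R -> {RV P >-> R}) : 0 < h < 1 -> is_fbm h B ->
  (forall t u t' u', u - t = u' - t' ->
    E (fun w => ou nu a0 (fun t => B t : T -> R) t w * ou nu a0 (fun t => B t : T -> R) u w) =
    E (fun w => ou nu a0 (fun t => B t : T -> R) t' w * ou nu a0 (fun t => B t : T -> R) u' w)) /\
  forall x : nat -> R, x n @[n --> \oo] --> +oo ->
  E (fun w => ou nu a0 (fun t => B t : T -> R) 0 w * ou nu a0 (fun t => B t : T -> R) (x n) w)
    @[n --> \oo] --> (0 : R).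
Proof.
move=> h01 fB; have rB := regular_fbm h01 fB; have vB := fbm_increment_variance h01 fB.
have [c cov] := fbm_covariance fB.
pose g (x : R) := c * `|x| `^ (2 * h).
have {}cov t u : E (fun w => B t w * B u w) = g t + g u - g (u - t) by exact: cov.
split; first by move=> *; exact: (mean_ou_stationary (g := g) nu nu a0 a0 rB rB cov).
move=> x xy; apply: (mean_ou_decay (g := g) nu nu a0 a0 rB rB cov vB vB).
have h02 : 0 < 2 * h < 2 by move/andP: h01 => [? ?]; apply/andP; split; lra.
by apply: (@decay (2 * h) c) => // y y0; rewrite /g gtr0_norm.
Qed.

Let cov12 := bfbm_cross hB hcorr.

Let f x := (rho + sign x * eta) / 2 * `|x| `^ H.
Let g x := (rho - sign x * eta) / 2 * `|x| `^ H.

Let cov12_split t u : E (fun w => B1 t w * B2 u w) = f t + g u - g (u - t).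
Proof. by rewrite cov12 /f /g; field. Qed.

Let cov21_split t u : E (fun w => B2 t w * B1 u w) = g t + f u - g (- (u - t)).
Proof. by rewrite meanC cov12 /f /g opprB; field. Qed.

Let c12 x := E (fun w => Y1 0 w * Y2 x w).

Let c12E t u : E (fun w => Y1 t w * Y2 u w) = c12 (u - t).
Proof. by apply: (mean_ou_stationary (g := g) nu1 nu2 a1 a2 rB1 rB2 cov12_split); rewrite subr0. Qed.

Let I12 := crossI alpha1 alpha2 H s.
Let I21 := crossI alpha2 alpha1 H s.

(** The limits of the three lagged averages are linked by the lag formula, in
    which the two signs of the lag see [rho + eta] and [rho - eta]. *)
Lemma cvg_mean2_cross_estimator_ou : exists m0 m1 m2 : R, [/\
  m1 = expR (- alpha1 * s%:R) * (m0 + nu1 * nu2 * ((rho + eta) / 2) * (H * (H - 1)) * I12),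
  m2 = expR (- alpha2 * s%:R) * (m0 + nu2 * nu1 * ((rho - eta) / 2) * (H * (H - 1)) * I21) &
  forall c1 c2 c3, cvg_mean2 P (cross_estimator c1 c2 c3 s Y1 Y2)
    (c1 * m0 + c2 * m1 + c3 * m2)].
Proof.
have [st1 de1] := @decay_ou H1 nu1 alpha1 a1 B1 H1_01 (bfbm_fbm1 hB).
have [st2 de2] := @decay_ou H2 nu2 alpha2 a2 B2 H2_01 (bfbm_fbm2 hB).
have q12 := bfbm_cross_quadrant H1_01 H2_01 hB hcorr.
have q21 := bfbm_cross_quadrantC H1_01 H2_01 hB hcorr.
exists (c12 0), (c12 (- s%:R)), (c12 s%:R); split.
- apply: etrans (mean_ou_lag nu1 nu2 a1 a2 H02 H_neq1 rB1 rB2 q12 s).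
  by apply/esym; rewrite -[- s%:R]add0r; exact: c12E.
- apply: etrans (meanC P (Y1 0) (Y2 s%:R)) _.
  apply: etrans (mean_ou_lag nu2 nu1 a2 a1 H02 H_neq1 rB2 rB1 q21 s) _.
  have <- : E (fun w => Y2 0 w * Y1 0 w) = c12 0 := meanC P (Y2 0) (Y1 0).
  by [].
move=> c1 c2 c3.
have L1 t : L4 P (Y1 t) := L4_ou nu1 a1 rB1 t.
have L2 t : L4 P (Y2 t) := L4_ou nu2 a2 rB2 t.
pose c11 x := E (fun w => Y1 0 w * Y1 x w).
pose c22 x := E (fun w => Y2 0 w * Y2 x w).
have c11E t u : E (fun w => Y1 t w * Y1 u w) = c11 (u - t).
  by apply: st1; rewrite subr0.
have c22E t u : E (fun w => Y2 t w * Y2 u w) = c22 (u - t).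
  by apply: st2; rewrite subr0.
have de12 (x : nat -> R) : x n @[n --> \oo] --> +oo -> c12 (x n) @[n --> \oo] --> (0 : R).
  move=> xy; apply: (mean_ou_decay (g := g) nu1 nu2 a1 a2 rB1 rB2 cov12_split vB1 vB2).
  apply: (@decay H ((rho - eta) / 2)) => // y y0.
  by rewrite /g /sign (ltW y0) gtr0_norm// mul1r.
have de21 (x : nat -> R) : x n @[n --> \oo] --> +oo -> c12 (- x n) @[n --> \oo] --> (0 : R).
  move=> xy.
  rewrite (_ : (fun n => _) = fun n => E (fun w => Y2 0 w * Y1 (x n) w)); last first.
    by apply/funext => n; rewrite (meanC P (Y2 0)) c12E sub0r.
  apply: (mean_ou_decay (g := fun x => g (- x)) nu2 nu1 a2 a1 rB2 rB1 cov21_split vB2 vB1).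
  apply: (@decay H ((rho + eta) / 2)) => // y y0.
  by rewrite /g /sign oppr_ge0 leNgt y0/= normrN gtr0_norm// mulN1r opprK.
exact (cvg_mean2_cross_estimator L1 L2 ou_isserlis c11E c22E c12E de1 de2 de12 de21 c1 c2 c3 s).
Qed.

Lemma cvg_mean2_estimators :
  cvg_mean2 P (rho_hat alpha1 alpha2 nu1 nu2 H s Y1 Y2) rho /\
  cvg_mean2 P (eta12_hat alpha1 alpha2 nu1 nu2 H s Y1 Y2) eta.
Proof.
have [m0 [m1 [m2 [e1 e2 c123]]]] := cvg_mean2_cross_estimator_ou.
have I12_gt0 : 0 < I12 by exact: crossI_gt0.
have I21_gt0 : 0 < I21 by exact: crossI_gt0.
have H_gt0 : 0 < H by case/andP: H02.
have [r1 r2] := weights_recover_parameters m0 rho eta nu1_gt0 nu2_gt0 H_gt0 H_neq1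
  (expR_gt0 (- alpha1 * s%:R)) (expR_gt0 (- alpha2 * s%:R)) I12_gt0 I21_gt0.
rewrite -e1 -e2 in r1 r2.
split.
  by rewrite -[X in cvg_mean2 _ _ X]r1; exact: c123.
by rewrite -[X in cvg_mean2 _ _ X]r2; exact: c123.
Qed.

End bivariate_ornstein_uhlenbeck.

Theorem theorem3p4 (R : realType) (d : measure_display) (T : measurableType d)
    (P : probability T R) (H1 H2 alpha1 alpha2 nu1 nu2 rho eta12 : R)
    (B1 B2 : R -> {RV P >-> R}) (s : nat)
    (hH1 : 0 < H1 < 1) (hH1_half : H1 != 1 / 2)
    (hH2 : 0 < H2 < 1) (hH2_half : H2 != 1 / 2)
    (hH : H1 + H2 != 1)
    (halpha1 : 0 < alpha1) (halpha2 : 0 < alpha2)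
    (hnu1 : 0 < nu1) (hnu2 : 0 < nu2)
    (hB : is_bivariate_fbm H1 H2 B1 B2)
    (hcorr : bfbm_correlation H1 H2 rho eta12 B1 B2)
    (hs : (1 <= s)%N) :
  let H := H1 + H2 in
  let Y1 := fOU alpha1 nu1 B1 in
  let Y2 := fOU alpha2 nu2 B2 in
  let rhoh := rho_hat alpha1 alpha2 nu1 nu2 H s Y1 Y2 in
  let etah := eta12_hat alpha1 alpha2 nu1 nu2 H s Y1 Y2 in
  [/\ cvg_L2 P rhoh (cst rho),
      cvg_L2 P etah (cst eta12),
      cvg_in_probability P rhoh (cst rho)
    & cvg_in_probability P etah (cst eta12)].
Proof.
move=> H Y1 Y2 rhoh etah.
have [crho ceta] := cvg_mean2_estimators hH1 hH2 hH halpha1 halpha2 hnu1 hnu2 hB hcorr hs.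
have Y1E : Y1 = ou nu1 halpha1 (fun t => B1 t : T -> R).
  exact: (fOU_ou nu1 halpha1 (bfbm_regular1 hH1 hB)).
have Y2E : Y2 = ou nu2 halpha2 (fun t => B2 t : T -> R).
  exact: (fOU_ou nu2 halpha2 (bfbm_regular2 hH2 hB)).
rewrite /rhoh /etah Y1E Y2E; split.
- exact: cvg_mean2_L2.
- exact: cvg_mean2_L2.
- exact: cvg_mean2_in_probability.
- exact: cvg_mean2_in_probability.
Qed.
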